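(* Assume the perforated geometry described in the context. Let $v\in\mathcal X(\Omega)$ and let $v_\varepsilon\in L^6(\Omega;\mathbb R^3)$ vanish a.e. in $\mathcal H_\varepsilon$. Then $$\liminf_{\varepsilon\to0}\varepsilon^{-1}\|v_\varepsilon-v\|_{L^6(\Omega)}\ge|T_0|^{1/6}\|v\|_{L^6(\Omega)}.$$ In particular, for each nonzero $v\in\mathcal X(\Omega)$ there exist constants $c_v,C_v>0$ such that, for all sufficiently small $\varepsilon$, $$c_v\varepsilon\le\|\widetilde{\mathcal R_\varepsilon v}-v\|_{L^6(\Omega)}\le C_v\varepsilon,$$ where $\mathcal R_\varepsilon$ is the solenoidal restriction operator defined in the context and $\widetilde{\mathcal R_\varepsilon v}$ is the extension of $\mathcal R_\varepsilon v$ by zero to $\Omega$.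
   Context: Notation. $(\nabla v)_{ij}=\partial_jv_i$, $A:B=\sum_{i,j}A_{ij}B_{ij}$; $\mathbf e_i$ canonical basis of $\mathbb R^3$. $H^1_{0,\sigma}(U)=\{z\in H_0^1(U;\mathbb R^3):\operatorname{div}z=0\}$, $\mathcal X(\Omega)=W^{1,\infty}(\Omega;\mathbb R^3)\cap H^1_{0,\sigma}(\Omega)$. Perforated geometry. $Y=(-\frac12,\frac12)^3$; $\Omega\subset\mathbb R^3$ is a bounded connected domain of class $C^{2,\beta}$, $\beta\in(0,1)$; $T_0\subset\subset B(0,1/8)$ is a fixed simply connected reference hole of class $C^{2,\beta}$ with connected exterior. $\mathcal K_\varepsilon=\{k\in\mathbb Z^3:\varepsilon(k+\overline Y)\subset\subset\Omega\}$, $T_{\varepsilon,k}=\varepsilon k+\varepsilon^3T_0$, $\mathcal H_\varepsilon=\bigcup_{k\in\mathcal K_\varepsilon}\overline{T_{\varepsilon,k}}$, $\Omega_\varepsilon=\Omega\setminus\mathcal H_\varepsilon$. Restriction operator $\mathcal R_\varepsilon$ (for small $\varepsilon$). For $R\ge4$ let $(V_R^i,Q_R^i)$, $i=1,2,3$, solve $-\Delta V_R^i+\nabla Q_R^i=0$, $\operatorname{div}V_R^i=0$ in $B_R\setminus\overline{T_0}$, $V_R^i=0$ on $\partial T_0$, $V_R^i=\mathbf e_i$ on $\partial B_R$. With $R_\varepsilon=(4\varepsilon^2)^{-1}$ and $B_{\varepsilon,k}=B(\varepsilon k,\varepsilon/4)$, put $W_\varepsilon^i(x)=V_{R_\varepsilon}^i((x-\varepsilon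 k)/\varepsilon^3)$ in $B_{\varepsilon,k}\setminus T_{\varepsilon,k}$, $W_\varepsilon^i=0$ in $T_{\varepsilon,k}$ ($k\in\mathcal K_\varepsilon$), $W_\varepsilon^i=\mathbf e_i$ elsewhere in $\Omega$; $W_\varepsilon=(W_\varepsilon^1\,W_\varepsilon^2\,W_\varepsilon^3)$. Let $\mathcal B_\varepsilon:\{h\in L^2(\Omega_\varepsilon):\int h=0\}\to H_0^1(\Omega_\varepsilon;\mathbb R^3)$ be a fixed linear right inverse of the divergence, $\operatorname{div}\mathcal B_\varepsilon h=h$, with operator norm bounded uniformly in small $\varepsilon$ (such operators exist by Diening–Feireisl–Lu). For $v\in\mathcal X(\Omega)$, $\mathcal R_\varepsilon v=W_\varepsilon v-\mathcal B_\varepsilon[(W_\varepsilon^{T}-I):\nabla v]\in H^1_{0,\sigma}(\Omega_\varepsilon)$. *)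

(* Defs.v *)
From mathcomp Require Import all_boot all_order all_algebra.
From mathcomp Require Import all_classical all_reals all_analysis.

Set Implicit Arguments.
Unset Strict Implicit.
Unset Printing Implicit Defensive.

Import Order.TTheory GRing.Theory Num.Theory.
Import numFieldNormedType.Exports.

Local Open Scope classical_set_scope.
Local Open Scope ring_scope.

(* Points of R^3 are triples, so that Lebesgue measure is the library product
   measure; vectors and matrices that are values of fields are MathComp
   matrices.  The canonical norm of the product type is the sup norm: it is only
   used up to equivalence of norms; balls and L^p norms are Euclidean. *)
Notation R3 R := (R * R * R)%type.

Definition mu3 (R : realType) :=
  ((@lebesgue_measure R \x @lebesgue_measure R) \x @lebesgue_measure R)%E.

Definition vec (R : realType) (x : R3 R) : 'cV[R]_3 :=
  \col_(i < 3) [:: x.1.1; x.1.2; x.2]`_i.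

Definition pt (R : realType) (w : 'cV[R]_3) : R3 R := (w 0 0, w 1 0, w 2 0).

Definition e_ (R : realType) (i : 'I_3) : R3 R := pt (delta_mx i 0).

Definition ddot (R : realType) m n (A B : 'M[R]_(m, n)) : R :=
  \sum_(i < m) \sum_(j < n) A i j * B i j.

Definition frob (R : realType) m n (A : 'M[R]_(m, n)) : R :=
  Num.sqrt (ddot A A).

Definition enorm (R : realType) (x : R3 R) : R := frob (vec x).

Definition eball (R : realType) (c : R3 R) (r : R) : set (R3 R) :=
  [set x | enorm (x - c) < r].

Definition compactly_included (T : topologicalType) (A B : set T) : Prop :=
  compact (closure A) /\ closure A `<=` B.

Definition domain (R : realType) (U : set (R3 R)) : Prop :=
  [/\ open U, U !=set0 & connected U].

(* C^k regularity on a finite-dimensional space, by iterated directional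
   derivatives along all (fixed) directions. *)
Fixpoint Ck (R : realType) (V : normedModType R) (k : nat) (f : V -> R) : Prop :=
  continuous f /\
  if k is k'.+1 then
    forall w : V, (forall x, derivable f x w) /\ Ck k' (fun x => 'D_w f x)
  else True.

Definition smooth (R : realType) (V : normedModType R) (f : V -> R) : Prop :=
  forall k, Ck k f.

Definition C2beta (R : realType) (V : normedModType R) (beta : R) (f : V -> R)
    : Prop :=
  Ck 2 f /\
  forall w w' : V, exists C : R, forall x y,
    `| 'D_w ('D_w' f) x - 'D_w ('D_w' f) y | <= C * `|x - y| `^ beta.

(* Near each boundary point, after a rigid motion, U is the part of a small ball
   lying strictly above the graph of a C^{2,beta} function; a function given near
   the base point can be cut off, so that it may be taken global. *)
Definition class_C2beta (R : realType) (beta : R) (U : set (R3 R)) : Prop :=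
  forall x0, x0 \in closure U `\` interior U ->
  exists (r : R) (O : 'M[R]_3) (gamma : R * R -> R),
    [/\ 0 < r, O *m O^T = 1%:M, C2beta beta gamma &
     forall x, eball x0 r x ->
       let y := pt (O *m vec (x - x0)) in U x <-> gamma y.1 < y.2].

Definition path_connected (R : realType) (U : set (R3 R)) : Prop :=
  U !=set0 /\
  forall x y, U x -> U y -> exists g : R -> R3 R,
    [/\ {within `[0, 1]%classic, continuous g}, g @` `[0, 1]%classic `<=` U,
        g 0 = x & g 1 = y].

Definition simply_connected (R : realType) (U : set (R3 R)) : Prop :=
  path_connected U /\
  forall g : R -> R3 R, {within `[0, 1]%classic, continuous g} ->
    g @` `[0, 1]%classic `<=` U -> g 0 = g 1 ->
  exists H : R * R -> R3 R,
    [/\ {within `[0, 1]%classic `*` `[0, 1]%classic, continuous H},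
        H @` (`[0, 1]%classic `*` `[0, 1]%classic) `<=` U,
        forall t, t \in `[0, 1]%classic -> H (0, t) = g t /\ H (1, t) = g 0 &
        forall s, s \in `[0, 1]%classic -> H (s, 0) = g 0 /\ H (s, 1) = g 0].

Definition reference_hole (R : realType) (beta : R) (T0 : set (R3 R)) : Prop :=
  [/\ domain T0, compactly_included T0 (eball 0 (1 / 8)), simply_connected T0,
      class_C2beta beta T0 & connected (~` closure T0)].

Definition unit_cell (R : realType) : set (R3 R) :=
  [set x | forall i, `|vec x i 0| < 1 / 2].

Definition lattice (R : realType) (k : 'cV[int]_3) : R3 R :=
  pt (map_mx intr k).

Section Perforation.
Context (R : realType) (Omega T0 : set (R3 R)).

Definition cells (eps : R) : set 'cV[int]_3 :=
  [set k | compactly_included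
    [set eps *: (lattice R k + y) | y in closure (@unit_cell R)] Omega].

Definition hole (eps : R) (k : 'cV[int]_3) : set (R3 R) :=
  [set eps *: lattice R k + eps ^+ 3 *: y | y in T0].

Definition holes (eps : R) : set (R3 R) :=
  \bigcup_(k in cells eps) closure (hole eps k).

Definition perforated (eps : R) : set (R3 R) := Omega `\` holes eps.

Definition cell_ball (eps : R) (k : 'cV[int]_3) : set (R3 R) :=
  eball (eps *: lattice R k) (eps / 4).

End Perforation.

(* Fields are total functions on R^3; only their values on U matter, and all the
   notions below are invariant under modification on a null subset of U. *)

Definition LN (R : realType) (p : \bar R) (U : set (R3 R)) m n
    (u : R3 R -> 'M[R]_(m, n)) : \bar R :=
  Lnorm (@mu3 R) p (EFin \o (fun x => if x \in U then frob (u x) else 0)).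

Definition inLp (R : realType) (p : \bar R) (U : set (R3 R)) m n
    (u : R3 R -> 'M[R]_(m, n)) : Prop :=
  (forall i j, measurable_fun U (fun x => u x i j)) /\ (LN p U u < +oo)%E.

(* Scalar functions as 1 x 1 matrix fields. *)
Definition scal (R : realType) (h : R3 R -> R) (x : R3 R) : 'M[R]_1 := (h x)%:M.

Definition test_fun (R : realType) (U : set (R3 R)) (phi : R3 R -> R) : Prop :=
  smooth phi /\ compactly_included [set x | phi x != 0] U.

Definition test_field (R : realType) (U : set (R3 R)) (phi : R3 R -> 'cV[R]_3)
    : Prop :=
  forall i, test_fun U (fun x => phi x i 0).

Definition loc_integrable (R : realType) (U : set (R3 R)) (u : R3 R -> R)
    : Prop :=
  measurable_fun U u /\
  forall K, compact K -> K `<=` U -> (@mu3 R).-integrable K (EFin \o u).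

Definition is_weak_partial (R : realType) (U : set (R3 R)) (j : 'I_3)
    (u g : R3 R -> R) : Prop :=
  [/\ loc_integrable U u, loc_integrable U g &
   forall phi, test_fun U phi ->
     \int[@mu3 R]_(x in U) (u x * 'D_(e_ R j) phi x) =
     - \int[@mu3 R]_(x in U) (g x * phi x)].

(* Some weak partial derivative; it is unique a.e. in U when it exists. *)
Definition weak_partial (R : realType) (U : set (R3 R)) (j : 'I_3)
    (u : R3 R -> R) : R3 R -> R :=
  get [set g | is_weak_partial U j u g].

Definition wgrad (R : realType) (U : set (R3 R)) (v : R3 R -> 'cV[R]_3)
    (x : R3 R) : 'M[R]_3 :=
  \matrix_(i, j) weak_partial U j (fun y => v y i 0) x.

Definition wdiv (R : realType) (U : set (R3 R)) (v : R3 R -> 'cV[R]_3)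
    (x : R3 R) : R :=
  \tr (wgrad U v x).

Definition cgrad (R : realType) (v : R3 R -> 'cV[R]_3) (x : R3 R) : 'M[R]_3 :=
  \matrix_(i, j) 'D_(e_ R j) (fun y => v y i 0) x.

Definition inW1p (R : realType) (p : \bar R) (U : set (R3 R))
    (v : R3 R -> 'cV[R]_3) : Prop :=
  [/\ inLp p U v,
      forall i j, exists g, is_weak_partial U j (fun y => v y i 0) g &
      inLp p U (wgrad U v)].

Definition H1norm (R : realType) (U : set (R3 R)) (v : R3 R -> 'cV[R]_3)
    : \bar R :=
  (LN 2%:E U v + LN 2%:E U (wgrad U v))%E.

Definition inH10 (R : realType) (U : set (R3 R)) (z : R3 R -> 'cV[R]_3)
    : Prop :=
  inW1p 2%:E U z /\
  forall d : R, 0 < d -> exists2 phi, test_field U phi &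
    (H1norm U (fun x => (z x - phi x)%R) < d%:E)%E.

Definition inH10s (R : realType) (U : set (R3 R)) (z : R3 R -> 'cV[R]_3)
    : Prop :=
  inH10 U z /\ {ae @mu3 R, forall x, U x -> wdiv U z x = 0}.

Definition inX (R : realType) (Omega : set (R3 R)) (v : R3 R -> 'cV[R]_3)
    : Prop :=
  inW1p +oo%E Omega v /\ inH10s Omega v.

Definition annulus (R : realType) (T0 : set (R3 R)) (r : R) : set (R3 R) :=
  eball 0 r `\` closure T0.

(* Weak (finite energy) solution of the Stokes problem; the Dirichlet data are
   attained in the sense that V - g is in H^1_0 for a smooth field g equal to 0
   near the hole and to e_i near the sphere of radius r. *)
Definition stokes_cell (R : realType) (T0 : set (R3 R)) (r : R) (i : 'I_3)
    (V : R3 R -> 'cV[R]_3) (Q : R3 R -> R) : Prop :=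
  let D := annulus T0 r in
  [/\ inW1p 2%:E D V, inLp 2%:E D (scal Q),
      forall phi, test_field D phi ->
        \int[@mu3 R]_(x in D)
          (ddot (wgrad D V x) (cgrad phi x) - Q x * \tr (cgrad phi x)) = 0,
      {ae @mu3 R, forall x, D x -> wdiv D V x = 0} &
      exists g : R3 R -> 'cV[R]_3,
        [/\ forall a, smooth (fun x => g x a 0),
            exists A, [/\ open A, closure T0 `<=` A &
                          forall x, A x -> g x = 0],
            exists A, [/\ open A, [set x | enorm x = r] `<=` A &
                          forall x, A x -> g x = delta_mx i 0] &
            inH10 D (fun x => V x - g x)]].

(* A linear right inverse L^2_0(U) -> H^1_0(U) of the divergence with norm at
   most C; boundedness makes B compatible with equality a.e. in U. *)
Definition div_right_inverse (R : realType) (U : set (R3 R)) (C : R)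
    (B : (R3 R -> R) -> R3 R -> 'cV[R]_3) : Prop :=
  let L20 h := inLp 2%:E U (scal h) /\ \int[@mu3 R]_(x in U) h x = 0 in
  [/\ forall h, L20 h -> inH10 U (B h),
      forall h, L20 h -> {ae @mu3 R, forall x, U x -> wdiv U (B h) x = h x},
      forall a h1 h2, L20 h1 -> L20 h2 -> {ae @mu3 R, forall x, U x ->
        B (fun y => a * h1 y + h2 y) x = a *: B h1 x + B h2 x} &
      forall h, L20 h -> (H1norm U (B h) <= C%:E * LN 2%:E U (scal h))%E].

Section Restriction.
Context (R : realType) (Omega T0 : set (R3 R)).
Context (V : R -> 'I_3 -> R3 R -> 'cV[R]_3).
Context (B : R -> (R3 R -> R) -> R3 R -> 'cV[R]_3).

(* The balls are pairwise disjoint, so k is determined by x whenever x lies in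
   one of them. *)
Definition Wcol (eps : R) (i : 'I_3) (x : R3 R) : 'cV[R]_3 :=
  let P := [set k | cells Omega eps k /\ cell_ball eps k x] in
  let k := xget 0 P in
  if ~~ `[< P k >] then delta_mx i 0
  else if x \in hole T0 eps k then 0
  else V (4 * eps ^+ 2)^-1 i ((eps ^+ 3)^-1 *: (x - eps *: lattice R k)).

Definition Wmx (eps : R) (x : R3 R) : 'M[R]_3 :=
  \matrix_(a, i) Wcol eps i x a 0.

Definition restriction (eps : R) (v : R3 R -> 'cV[R]_3) (x : R3 R)
    : 'cV[R]_3 :=
  Wmx eps x *m v x
  - B eps (fun y => ddot ((Wmx eps y)^T - 1%:M) (wgrad Omega v y)) x.

Definition zero_ext (U : set (R3 R)) (u : R3 R -> 'cV[R]_3) (x : R3 R)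
    : 'cV[R]_3 :=
  if x \in U then u x else 0.

End Restriction.

(* Main.v *)
(* Lower bound.  Extended by zero, v is Lipschitz up to null sets, hence so is
   p = |v|^6.  Comparing the averages of p over a cell of side eps and over the
   hole of volume eps^9 |T_0| inside it, where v_eps - v = - v, gives
     eps^6 |T_0| int_cell p <= int_hole |v_eps - v|^6 + O(eps^10),
   and it remains to sum over the cells and to exhaust Omega by the points at
   distance more than 1/n from the boundary.

   Upper bound.  Let g be a fixed solenoidal cut-off, 0 near T_0 and e_i for
   |x|^2 > 2.  Testing the cell problem with V - g bounds the Dirichlet integral
   of V by that of g, uniformly in the radius, and the Sobolev inequality bounds
   int |V - e_i|^6; after rescaling, int |W - I|^6 = O(eps^6), where W is set
   to 0 in the holes.  With this W the error equals (W - I) v - B[h] on the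
   whole of Omega.  The columns of W - I are weakly divergence free, which makes
   the mean of h vanish, and |B[h]|_6 <= C |grad B[h]|_2 <= C |h|_2 = O(eps). *)
From HB Require Import structures.
Require Import Defs.
From mathcomp Require Import all_boot all_order all_algebra.
From mathcomp Require Import all_classical all_reals all_analysis.
From mathcomp Require Import ess_sup_inf measurable_realfun ring lra.

Import Order.TTheory GRing.Theory Num.Theory.
Import numFieldNormedType.Exports.

Set Implicit Arguments.
Unset Strict Implicit.
Unset Printing Implicit Defensive.

Local Open Scope classical_set_scope.
Local Open Scope ring_scope.

(** * Measurability and changes of variables *)

Section Measurability.
Context {R : realType}.
Local Notation mu := (@mu3 R).

(** The fields v, V - g and B[h] are known only as H^1_0 limits of test functions. Their components
    are handled by the scalar predicate [H10s], and three facts are carried from test functions to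
    such limits: the Sobolev inequality, the Lipschitz bound for the extension by zero, and the
    vanishing of continuous linear functionals. The approximants are smooth on the whole space, so
    no jump appears across the boundary, and the Sobolev constant is the same for annuli of growing
    radius and for perforated sets.

    The Lipschitz bound holds, at each fixed shift, for almost every point; this dictates the order
    of integration in the averaging argument.

    The cut-off is solenoidal so that the pressure drops out of the energy identity. A cell
    contributes eps^9, the volume factor of the hole scale, and the cells have total volume at most
    that of Omega, hence number O(eps^-3): this is the origin of eps^6. The L^2 bound on W - I that
    h requires is deduced from the L^6 one through z^2 <= eps^2 + eps^-4 z^6. *)

Lemma open_measurable3 (A : set (R3 R)) : open A -> measurable A.
Proof.
move=> oA.
(* Measurability of sets of triples refers to the product sigma-algebra, so A is written as a
   countable union of boxes with rational centres; a box that is not inside A contributes the empty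
   set. *)
pose box (c1 c2 c3 : rat) (n : nat) : set (R3 R) :=
  (ball (ratr c1 : R) n.+1%:R^-1 `*` ball (ratr c2 : R) n.+1%:R^-1) `*`
   ball (ratr c3 : R) n.+1%:R^-1.
have mball (c : R) r : measurable (ball c r).
  by apply: open_measurable; apply: ball_open.
have -> : A = \bigcup_c1 \bigcup_c2 \bigcup_c3 \bigcup_n
    [set x | box c1 c2 c3 n x /\ box c1 c2 c3 n `<=` A].
  apply/seteqP; split => [x Ax|x [c1 _ [c2 _ [c3 _ [n _ [bx /(_ _ bx)]]]]] //].
  have /nbhs_ballP[e /= e0 xeA] : nbhs x A by exact: open_nbhs_nbhs.
  have [n ne] : exists n, n.+1%:R^-1 < e / 2.
    have e20 : 0 < e / 2 by rewrite divr_gt0.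
    have [n _ nP] := near_infty_natSinv_lt (PosNum e20).
    by exists n; apply: (nP n) => /=.
  have rd (y : R) : exists c : rat, `|ratr c - y| < n.+1%:R^-1.
    have : y - n.+1%:R^-1 < y + n.+1%:R^-1.
      by rewrite ltrD2l gtrN // invr_gt0.
    move=> /rat_in_itvoo[c]; rewrite in_itv /= => /andP[c1' c2'].
    by exists c; rewrite ltr_distl c1' c2'.
  have [c1 h1] := rd x.1.1; have [c2 h2] := rd x.1.2; have [c3 h3] := rd x.2.
  exists c1 => //; exists c2 => //; exists c3 => //; exists n => //; split.
    by split=> //; split.
  move=> y [[/= y1 y2] y3]; apply: xeA.
  have tri (a b c : R) : `|a - b| < n.+1%:R^-1 -> ball a n.+1%:R^-1 c ->
      ball b e c.
    rewrite /ball /= => ab ac; rewrite (_ : b - c = (b - a) + (a - c)); last lra.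
    apply: (le_lt_trans (ler_normD _ _)).
    rewrite (_ : e = e / 2 + e / 2); last lra.
    by apply: ltrD; [rewrite distrC (lt_trans ab)|rewrite (lt_trans ac)].
  by split; [split|]; apply: tri; eassumption.
apply: bigcupT_measurable_rat => c1; apply: bigcupT_measurable_rat => c2.
apply: bigcupT_measurable_rat => c3; apply: bigcupT_measurable => n.
have [h|h] := pselect (box c1 c2 c3 n `<=` A).
  rewrite (_ : [set x | _] = box c1 c2 c3 n); last first.
    by apply/seteqP; split=> x //= [].
  by apply: measurableX => //; exact: measurableX.
rewrite (_ : [set x | _] = set0) //.
by apply/seteqP; split=> x //= [].
Qed.

Lemma closed_measurable3 (A : set (R3 R)) : closed A -> measurable A.
Proof.
move=> cA; rewrite -(setCK A); apply: measurableC; apply: open_measurable3.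
exact: closed_openC.
Qed.

Lemma continuous_measurable3 (f : R3 R -> R) :
  continuous f -> measurable_fun setT f.
Proof.
move=> /continuousP cf; apply: (measurability _ (RGenOInfty.measurableE R)).
move=> /= _ [_ [a ->]] <-; rewrite setTI; apply: open_measurable3.
exact/cf/interval_open.
Qed.

End Measurability.

Section SigmaFiniteProduct.
Local Open Scope ereal_scope.
Context d1 d2 (T1 : measurableType d1) (T2 : measurableType d2) (R : realType).
Variable m1 : {sigma_finite_measure set T1 -> \bar R}.
Variable m2 : {sigma_finite_measure set T2 -> \bar R}.

Lemma sigma_finite_product : sigma_finite setT (m1 \x m2).
Proof.
have /sigma_finiteP[F [TF ndF Foo]] := sigma_finiteT m1.
have /sigma_finiteP[G [TG ndG Goo]] := sigma_finiteT m2.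
exists (fun n => F n `*` G n).
  apply/seteqP; split => // -[x y] _.
  have [n _ Fn] : (\bigcup_i F i) x by rewrite -TF.
  have [k _ Gk] : (\bigcup_i G i) y by rewrite -TG.
  exists (maxn n k) => //; split.
    exact: (subsetPset _ _ (ndF _ _ (leq_maxl n k))).
  exact: (subsetPset _ _ (ndG _ _ (leq_maxr n k))).
move=> k; have [? ?] := Foo k; have [? ?] := Goo k; split.
  exact: measurableX.
by rewrite product_measure1E // lte_mul_pinfty // ge0_fin_numE.
Qed.

(* The sigma-finite structure that the library declares on [m1 \x m2] is
   shadowed by the one for subprobabilities, hence this renamed copy. *)
Definition sfprod : set (T1 * T2) -> \bar R := m1 \x m2.
HB.instance Definition _ := Measure.copy sfprod
  (lebesgue_integral_fubini_product_measure1__canonical__measure_function_Measure m1 m2).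
HB.instance Definition _ :=
  Measure_isSigmaFinite.Build _ _ _ sfprod sigma_finite_product.

End SigmaFiniteProduct.

Section ChangeOfVariables.
Context {R : realType}.
Local Notation mu := (@mu3 R).
Local Notation leb := (@lebesgue_measure R).

Lemma measurable_affine1 (c l : R) : measurable_fun [set: measurableTypeR R] (fun y : measurableTypeR R => c + l * y : measurableTypeR R).
Proof. by apply: measurable_funD => //; exact: measurable_funM. Qed.

(** The image of Lebesgue measure under the affine map, multiplied by l, gives each half-open
    interval its length, so it is Lebesgue measure by uniqueness. *)
Lemma lebesgue_affine (c l : R) (A : set R) : 0 < l -> measurable A ->
  (leb [set y | A (c + l * y)%R] = (l^-1)%:E * leb A)%E.
Proof.
move=> l0 mA.
have l0' : 0 <= l by exact: ltW.
pose af (y : measurableTypeR R) : measurableTypeR R := c + l * y.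
have maf : measurable_fun setT af by exact: measurable_affine1.
pose m0 := measure_function_pushforward__canonical__measure_function_Measure leb maf.
pose m := measure_function_mscale__canonical__measure_function_Measure (NngNum l0') m0.
have -> : (leb A = m A)%E.
  apply: lebesgue_measure_unique => // X [[a b] _ <-].
  rewrite /m /m0 /= /mscale /pushforward /=.
  rewrite (_ : pushforward leb af _ = leb (`](a - c) / l, (b - c) / l]%classic)); last first.
    rewrite /pushforward /af; congr (leb _).
    apply/seteqP; split => y /=; rewrite !in_itv /= ltr_pdivrMr // ler_pdivlMr//;
    move=> /andP[ya yb]; apply/andP; split; lra.
  have [ab|ba] := ltP a b; last first.
    by rewrite !set_itv_ge ?measure0 ?mule0 ?bnd_simp -?leNgt ?ler_pM2r ?invr_gt0 ?lerD2r.
  rewrite !lebesgue_measure_itv /= !lte_fin ab ltr_pM2r ?invr_gt0// ltrD2r ab.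
  rewrite -!EFinD -EFinM; congr EFin; field; lra.
by rewrite /m /m0 /= /mscale /pushforward /= muleA -EFinM mulVf ?gt_eqF// mul1e.
Qed.

Lemma ge0_integral_affine1 (c l : R) (f : R -> \bar R) : 0 < l ->
  measurable_fun setT f -> (forall x, 0 <= f x)%E ->
  (\int[leb]_y f (c + l * y)%R = (l^-1)%:E * \int[leb]_x f x)%E.
Proof.
move=> l0 mf f0.
have l0' : 0 <= l^-1 by rewrite invr_ge0 ltW.
pose af (y : measurableTypeR R) : measurableTypeR R := c + l * y.
have maf : measurable_fun setT af by exact: measurable_affine1.
pose m0 := measure_function_pushforward__canonical__measure_function_Measure leb maf.
have E : (\int[m0]_x f x = \int[mscale (NngNum l0') leb]_x f x)%E.
  by apply: eq_measure_integral => A mA _; exact: lebesgue_affine.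
rewrite ge0_integral_mscale //= in E; rewrite -E.
by rewrite ge0_integral_pushforward.
Qed.

Definition aff (c : R3 R) (l : R) (x : R3 R) : R3 R :=
  (c.1.1 + l * x.1.1, c.1.2 + l * x.1.2, c.2 + l * x.2).

Lemma affE (c : R3 R) (l : R) x : aff c l x = c + l *: x.
Proof. by case: c x => [[c1 c2] c3] [[x1 x2] x3]. Qed.

Lemma measurable_aff c l : measurable_fun [set: R3 R] (aff c l).
Proof.
rewrite /aff; do 2 ?apply: measurable_fun_pair;
apply: measurable_funD => //; apply: measurable_funM => //.
- exact: (measurableT_comp (f:=fst)(g:=fst)).
- exact: (measurableT_comp (f:=snd)(g:=fst)).
Qed.

Lemma fubini3 (f : R3 R -> \bar R) : measurable_fun setT f ->
  (forall x, 0 <= f x)%E ->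
  (\int[mu]_x f x = \int[leb]_x \int[leb]_y \int[leb]_z f (x, y, z))%E.
Proof.
move=> mf f0; rewrite /mu3 (@fubini_tonelli1 _ _ _ _ _ (sfprod leb leb) leb f mf f0).
rewrite (@fubini_tonelli1 _ _ _ _ _ leb leb (fubini_F leb f)) //.
- exact: measurable_fun_fubini_tonelli_F.
- by move=> x; apply: integral_ge0.
Qed.

Lemma ge0_integral_aff (c : R3 R) (l : R) (f : R3 R -> \bar R) : 0 < l ->
  measurable_fun setT f -> (forall x, 0 <= f x)%E ->
  (\int[mu]_y f (aff c l y) = ((l^-1) ^+ 3)%:E * \int[mu]_x f x)%E.
Proof.
move=> l0 mf f0.
rewrite fubini3 //; last by apply: measurableT_comp => //; exact: measurable_aff.
rewrite fubini3 // /aff /=.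
have mz x y : measurable_fun setT (fun z => f (x, y, z)).
  by apply: measurableT_comp => //; exact: measurable_pair1.
have mF := @measurable_fun_fubini_tonelli_F _ _ _ _ _ leb f mf f0.
have my x : measurable_fun setT (fun y => \int[leb]_z f (x, y, z))%E.
  apply: (measurableT_comp mF); exact: measurable_pair1.
have mx : measurable_fun setT (fun x => \int[leb]_y \int[leb]_z f (x, y, z))%E.
  apply: (@measurable_fun_fubini_tonelli_F _ _ _ _ _ leb (fun p => \int[leb]_z f (p, z))%E) => //.
  by move=> ?; exact: integral_ge0.
under eq_integral => x _.
  under eq_integral => y _ do rewrite (ge0_integral_affine1 c.2 l0 (mz _ _)) //.
  rewrite ge0_integralZl_EFin ?invr_ge0 ?(ltW l0)//; first last.
  - apply: (measurableT_comp (my _)); exact: measurable_affine1.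
  - by move=> ? _; exact: integral_ge0.
  rewrite (ge0_integral_affine1 c.1.2 l0 (my _)); last by move=> ?; exact: integral_ge0.
  over.
rewrite ge0_integralZl_EFin ?invr_ge0 ?(ltW l0)//; first last.
- apply: measurable_funeM; apply: (measurableT_comp mx); exact: measurable_affine1.
- by move=> ? _; rewrite mule_ge0 ?lee_fin ?invr_ge0 ?(ltW l0)//; do 2! (apply: integral_ge0 => ? ?).
rewrite ge0_integralZl_EFin ?invr_ge0 ?(ltW l0)//; first last.
- apply: (measurableT_comp mx); exact: measurable_affine1.
- by move=> ? _; do 2! (apply: integral_ge0 => ? ?).
rewrite (ge0_integral_affine1 c.1.1 l0 mx); last first.
  by move=> ? ; do 2! (apply: integral_ge0 => ? ?).
by rewrite !muleA -!EFinM !exprS expr0 mulr1 mulrA.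
Qed.

End ChangeOfVariables.

(** * Smooth functions *)

Section Smoothness.
Context {R : realType} {V : normedModType R}.
Implicit Types (f g u : V -> R) (x w : V) (k : nat).

Lemma is_derive_fD f g x w df dg : is_derive x w f df -> is_derive x w g dg ->
  is_derive x w (fun y => f y + g y) (df + dg).
Proof. exact: is_deriveD. Qed.

Lemma is_derive_fM f g x w df dg : is_derive x w f df -> is_derive x w g dg ->
  is_derive x w (fun y => f y * g y) (f x * dg + df * g x).
Proof.
move=> hf hg; have := is_deriveM hf hg.
by rewrite /GRing.scale /= [g x * df]mulrC.
Qed.

Lemma is_derive_fcst (c : R) x w : is_derive x w (fun=> c) 0.
Proof. exact: is_derive_cst. Qed.

(** Directional derivatives see only the line through x, so u is restricted to h |-> u (h w + x) and
    the one-variable chain rule applies. *)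
Lemma is_derive_chain (F : R -> R) u x w (a b : R) :
  is_derive (u x) 1 F a -> is_derive x w u b ->
  is_derive x w (fun y => F (u y)) (a * b).
Proof.
move=> hF [du uE].
have hl : is_derive (0 : R) 1 (fun h => u (h *: w + x)) b.
  apply: DeriveDef; first exact: (proj1 (derivable1P _ _ _) du).
  rewrite -uE /derive; apply: (f_equal (fun F => lim (F @ _))); apply/funext => h /=.
  by rewrite !scaler1 addr0 scale0r add0r.
have hF' : is_derive ((fun h => u (h *: w + x)) 0) 1 F a.
  by rewrite /= scale0r add0r.
have [dc dE] := is_derive1_comp hF' hl.
apply: DeriveDef; first exact: (proj2 (derivable1P _ _ _) dc).
rewrite -dE /derive; apply: (f_equal (fun F => lim (F @ _))); apply/funext => h /=.
by rewrite !scaler1 addr0 scale0r add0r.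
Qed.

Lemma Ck_cont k f : Ck k f -> continuous f.
Proof. by case: k => [[]|k []]. Qed.

Lemma Ck_is_derive k f x w : Ck k.+1 f -> is_derive x w f ('D_w f x).
Proof. by move=> [_ /(_ w)[h _]]; apply: DeriveDef. Qed.

Lemma Ck_derive k f w : Ck k.+1 f -> Ck k (fun x => 'D_w f x).
Proof. by move=> [_ /(_ w)[]]. Qed.

Lemma CkS_intro k f : continuous f ->
  (forall w, exists2 df, (forall x, is_derive x w f (df x)) & Ck k df) -> Ck k.+1 f.
Proof.
move=> cf h; split=> // w; have [df dP cdf] := h w; split=> [x|].
  by have [] := dP x.
rewrite (_ : (fun x => _) = df) //; apply/funext => x.
by have [] := dP x.
Qed.

Lemma CkW k f : Ck k.+1 f -> Ck k f.
Proof.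
elim: k f => [|k IH] f; first by case.
move=> hf; apply: CkS_intro; first exact: Ck_cont hf.
move=> w; exists (fun x => 'D_w f x) => [x|]; first exact: Ck_is_derive hf.
by apply: IH; exact: Ck_derive.
Qed.

Lemma Ck_cst k (c : R) : Ck k (fun _ : V => c).
Proof.
elim: k c => [|k IH] c; first by split=> // x; exact: cvg_cst.
apply: CkS_intro; first by move=> x; exact: cvg_cst.
by move=> w; exists (fun=> 0) => // x; exact: is_derive_fcst.
Qed.

Lemma Ck_add k f g : Ck k f -> Ck k g -> Ck k (fun x => f x + g x).
Proof.
elim: k f g => [|k IH] f g hf hg.
  by split=> // x; apply: cvgD; [apply: (Ck_cont hf)|apply: (Ck_cont hg)].
apply: CkS_intro.
  by move=> x; apply: cvgD; [apply: (Ck_cont hf)|apply: (Ck_cont hg)].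
move=> w; exists (fun x => 'D_w f x + 'D_w g x) => [x|].
  by apply: is_derive_fD; [exact: Ck_is_derive hf|exact: Ck_is_derive hg].
by apply: IH; exact: Ck_derive.
Qed.

Lemma Ck_mul k f g : Ck k f -> Ck k g -> Ck k (fun x => f x * g x).
Proof.
elim: k f g => [|k IH] f g hf hg.
  by split=> // x; apply: cvgM; [apply: (Ck_cont hf)|apply: (Ck_cont hg)].
apply: CkS_intro.
  by move=> x; apply: cvgM; [apply: (Ck_cont hf)|apply: (Ck_cont hg)].
move=> w; exists (fun x => f x * 'D_w g x + 'D_w f x * g x) => [x|].
  by apply: is_derive_fM; [exact: Ck_is_derive hf|exact: Ck_is_derive hg].
by apply: Ck_add; apply: IH; by [exact: Ck_derive|exact: CkW].
Qed.

(** Meant for extensions by zero, which near each point are either a given smooth function or 0. *)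
Lemma Ck_local k f :
  (forall x, exists2 g, Ck k g & \forall y \near x, g y = f y) -> Ck k f.
Proof.
have cont_loc f' : (forall x, exists2 g, continuous g &
    \forall y \near x, g y = f' y) -> continuous f'.
  move=> h x; have [g cg fg] := h x.
  rewrite /continuous_at -(nbhs_singleton fg).
  by apply: cvg_trans (cg x); apply: near_eq_cvg.
elim: k f => [|k IH] f hf.
  split=> //; apply: cont_loc => x; have [g /Ck_cont cg fg] := hf x.
  by exists g.
apply: CkS_intro.
  by apply: cont_loc => x; have [g /Ck_cont cg fg] := hf x; exists g.
move=> w; exists (fun x => 'D_w f x).
  move=> x; have [g hg fg] := hf x.
  rewrite -(near_eq_derive w fg).
  by apply: near_eq_is_derive fg _; exact: Ck_is_derive hg.
apply: IH => x; have [g hg fg] := hf x.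
exists (fun x => 'D_w g x); first exact: Ck_derive.
move: fg => /nbhs_interior; apply: filterS => y fgy.
exact: near_eq_derive.
Qed.

End Smoothness.

(** * Smooth functions vanishing on a half-line *)

Section FlatFunctions.
Context {R : realType}.

(* The functions x^-k exp(-1/x), extended by 0, are closed under
   differentiation up to linear combinations. *)
Definition flat (k : nat) (x : R) : R :=
  if 0 < x then x ^- k * expR (- x^-1) else 0.

Lemma flat_le0 k x : x <= 0 -> flat k x = 0.
Proof. by move=> x0; rewrite /flat ltNge x0. Qed.

Lemma flat_ge0 k x : 0 <= flat k x.
Proof.
rewrite /flat; case: ifPn => // x0.
by rewrite mulr_ge0 ?expR_ge0 // invr_ge0 exprn_ge0 // ltW.
Qed.

Lemma flat_gt0 k x : 0 < x -> 0 < flat k x.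
Proof. by move=> x0; rewrite /flat x0 mulr_gt0 ?expR_gt0 // invr_gt0 exprn_gt0. Qed.

Lemma flat0_le1 x : flat 0 x <= 1.
Proof.
rewrite /flat; case: ifPn => // x0.
by rewrite expr0 invr1 mul1r -expR0 ler_expR oppr_le0 invr_ge0 ltW.
Qed.

(** The inequality t <= exp t at t = 1 / ((k+2) x), raised to the power k+2. The two powers beyond k
    leave the factor x^2 that makes the derivative at 0 vanish. *)
Lemma flat_small k x : 0 < x -> flat k x <= k.+2%:R ^+ k.+2 * x ^+ 2.
Proof.
move=> x0; rewrite /flat x0.
have k0 : (0 : R) < k.+2%:R by [].
rewrite expRN.
have y0 : 0 < x^-1 by rewrite invr_gt0.
have : (x^-1 / k.+2%:R) ^+ k.+2 <= expR x^-1.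
  rewrite [X in expR X](_ : _ = k.+2%:R * (x^-1 / k.+2%:R)); last first.
    by rewrite mulrC divfK ?gt_eqF.
  rewrite expRM_natl.
  rewrite lerXn2r ?nnegrE ?expR_ge0//; first by rewrite divr_ge0// ltW.
  by apply: le_trans (expR_ge1Dx _); rewrite mulrC lerDr.
rewrite expr_div_n exprVn => h.
rewrite ler_pdivrMr ?expR_gt0//.
apply: le_trans (ler_wpM2l _ h); last by rewrite mulr_ge0// ?exprn_ge0// ltW.
rewrite (_ : x ^- k.+2 = x ^- k / x ^+ 2); last by rewrite -addn2 exprD invfM.
set K := k.+2%:R ^+ k.+2.
have K0 : K != 0 by rewrite gt_eqF // exprn_gt0.
have x1 : x != 0 by rewrite gt_eqF.
rewrite le_eqVlt; apply/orP; left; apply/eqP; field.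
by rewrite K0 x1 expf_neq0.
Qed.

Lemma is_derive_flat (k : nat) (x : R) :
  is_derive x 1 (flat k) (- k%:R * flat k.+1 x + flat k.+2 x).
Proof.
have [x0|x0|->] := ltgtP x 0.
- rewrite !flat_le0 ?(ltW x0)// mulr0 addr0.
  apply: (@near_eq_is_derive _ _ _ (cst 0)).
  near=> y; rewrite flat_le0//; apply: ltW; near: y; exact: lt_nbhsl.
- have dV : is_derive x 1 (fun y : R => y^-1) (- x ^- 2).
    have xn : id x != 0 by rewrite gt_eqF.
    have did : derivable (id : R -> R) x 1 by exact: derivable_id.
    apply: DeriveDef; first exact: derivableV.
    by rewrite (deriveV xn did) derive_id /GRing.scale /= mulr1.
  suff : is_derive x 1 (fun y => (y^-1) ^+ k * expR (- y^-1))
      (- k%:R * flat k.+1 x + flat k.+2 x).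
    apply: near_eq_is_derive.
    near=> y; rewrite /flat ifT ?exprVn//; near: y; exact: lt_nbhsr.
  have dN : is_derive x 1 (fun y : R => - y^-1) (x ^- 2).
    by have := is_deriveN dV; rewrite opprK.
  have dE := @is_derive_chain R R expR (fun y : R => - y^-1) x 1 _ _
    (is_derive_expR _) dN.
  have dX : is_derive x 1 (fun y : R => y^-1 ^+ k)
      (k%:R * x^-1 ^+ k.-1 * - x ^- 2).
    by have := is_deriveX k dV; rewrite exprfctE.
  have := is_derive_fM dX dE => dXE; apply: is_derive_eq dXE _.
  rewrite /flat x0 /GRing.scale /=; set E := expR _.
  have xn : x != 0 by rewrite gt_eqF.
  case: k {dX} => [|k]; first by rewrite /= !expr0; field.
  rewrite !exprS /= !exprVn; field.
  by rewrite expf_neq0 // xn.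
(* At the origin the difference quotient is 0 on the left and at most C h on the right, by
   [flat_small]. *)
- rewrite !flat_le0 // mulr0 addr0.
  suff h : h^-1 *: (flat k (h *: 1 + 0) - flat k 0) @[h --> (0:R)^'] --> (0:R).
    by apply: DeriveDef; [exact: (cvgP _ h)|exact: cvg_lim h].
  rewrite flat_le0 //.
  apply/cvgr0Pnorm_lt => e e0.
  pose C : R := k.+2%:R ^+ k.+2.
  have C0 : 0 < C by rewrite exprn_gt0.
  near=> h; have h0 : h != 0 by near: h; exact: nbhs_dnbhs_neq.
  rewrite subr0 addr0 scaler1 /GRing.scale /=.
  have [hn|hp] := leP h 0; first by rewrite flat_le0 // mulr0 normr0.
  rewrite ger0_norm ?mulr_ge0 ?flat_ge0 ?invr_ge0 ?(ltW hp)//.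
  apply: (@le_lt_trans _ _ (h^-1 * (C * h ^+ 2))).
    by rewrite ler_wpM2l ?invr_ge0 ?(ltW hp)// flat_small.
  rewrite mulrCA expr2 mulKf//.
  rewrite mulrC -ltr_pdivlMr //.
  have hh : `|h| < e / C.
    near: h; apply: nbhs_dnbhs; apply/nbhs_ballP; exists (e / C) => /=.
      by rewrite divr_gt0.
    by move=> z; rewrite /ball /= sub0r normrN.
  by rewrite gtr0_norm in hh.
Unshelve. all: by end_near. Qed.

Lemma continuous_flat k : continuous (flat k).
Proof.
move=> x; apply: differentiable_continuous; apply/derivable1_diffP.
by have [] := is_derive_flat k x.
Qed.

(** The induction on n is for all k at once, because differentiation raises k by one and by two. *)
Lemma Ck_flat (V : normedModType R) n k (u : V -> R) :
  Ck n u -> Ck n (fun x => flat k (u x)).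
Proof.
have cc k' u' : continuous u' -> continuous (fun x : V => flat k' (u' x)).
  by move=> cu x; apply: continuous_comp; [exact: cu|exact: continuous_flat].
elim: n k u => [|n IH] k u hu; first by split => //; apply/cc/(Ck_cont hu).
apply: CkS_intro; first by apply/cc/(Ck_cont hu).
move=> w.
exists (fun x => (- k%:R * flat k.+1 (u x) + flat k.+2 (u x)) * 'D_w u x).
  by move=> x; apply: is_derive_chain (is_derive_flat _ _) (Ck_is_derive _ _ hu).
apply: Ck_mul (Ck_derive w hu); apply: Ck_add.
  by apply: Ck_mul; [exact: Ck_cst|apply/IH/CkW].
by apply/IH/CkW.
Qed.

Lemma flat_cvg1 (x : R) : 0 < x -> flat 0 (n%:R * x) @[n --> \oo] --> (1 : R).
Proof.
move=> x0.
have h : expR (- (n%:R * x)^-1) @[n --> \oo] --> expR (- 0 : R).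
  apply: continuous_cvg; first exact: continuous_expR.
  apply: cvgN; apply/gtr0_cvgV0.
    by near=> n; rewrite mulr_gt0// ltr0n; near: n; exact: nbhs_infty_gt.
  have /cvgryPge xy := @cvgr_idn R; apply/cvgryPge => A.
  by apply: filterS (xy (A / x)) => n; rewrite ler_pdivrMr.
rewrite oppr0 expR0 in h; apply: cvg_trans h; apply: near_eq_cvg.
near=> n; rewrite /flat expr0 invr1 mul1r ifT// mulr_gt0// ltr0n.
by near: n; exact: nbhs_infty_gt.
Unshelve. all: by end_near. Qed.

End FlatFunctions.

(** * Coordinates, cubes and boxes *)

Section Coordinates.
Context {R : realType}.
Local Notation mu := (@mu3 R).
Implicit Types (x w : R3 R).

Definition co (i : 'I_3) x : R := vec x i 0.

Lemma co_case x i : co i x = if i == 0 then x.1.1 else if i == 1 then x.1.2 else x.2.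
Proof.
rewrite /co mxE; case: i => [[|[|[|]]]] //= h.
Qed.

Lemma co0 x : co 0 x = x.1.1. Proof. by rewrite co_case. Qed.
Lemma co1 x : co 1 x = x.1.2. Proof. by rewrite co_case. Qed.
Lemma co2 x : co 2 x = x.2. Proof. by rewrite co_case. Qed.

Lemma coD i x y : co i (x + y) = co i x + co i y.
Proof. by rewrite !co_case; do !case: ifP. Qed.

Lemma coZ i (l : R) x : co i (l *: x) = l * co i x.
Proof. by rewrite !co_case; do !case: ifP. Qed.

Lemma coB i x y : co i (x - y) = co i x - co i y.
Proof. by rewrite !co_case; do !case: ifP. Qed.

Lemma co_e i j : co i (e_ R j) = (i == j)%:R.
Proof.
have h k : delta_mx j 0 k 0 = (k == j)%:R :> R by rewrite mxE eqxx andbT.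
rewrite co_case /e_ /pt /= !h.
by case: i => [[|[|[|]]]] //= hi; case: j {h} => [[|[|[|]]]].
Qed.

Lemma continuous_co i : continuous (co i).
Proof.
move=> x; rewrite /continuous_at (_ : co i = fun x =>
  if i == 0 then x.1.1 else if i == 1 then x.1.2 else x.2); last first.
  by apply/funext => y; rewrite co_case.
by case: ifP => _; last case: ifP => _; [apply: (continuous_comp (f := fst) (g := fst));
  exact: cvg_fst|apply: (continuous_comp (f := fst) (g := snd));
  [exact: cvg_fst|exact: cvg_snd]|exact: cvg_snd].
Qed.

Lemma measurable_co i : measurable_fun [set: R3 R] (co i).
Proof. by apply: continuous_measurable3; exact: continuous_co. Qed.

Lemma is_derive_co i x w : is_derive x w (co i) (co i w).
Proof.
suff h : h^-1 *: (co i (h *: w + x) - co i x) @[h --> (0:R)^'] --> (co i w : R).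
  by apply: DeriveDef; [exact: (cvgP _ h)|exact: cvg_lim h].
apply: (@cvg_trans _ (cst (co i w) @ (0 : R)^')); last exact: cvg_cst.
apply: near_eq_cvg; near=> h.
have h0 : h != 0 by near: h; exact: nbhs_dnbhs_neq.
by rewrite coD coZ addrK /GRing.scale /= mulKf.
Unshelve. all: by end_near. Qed.

Lemma Ck_co k i : Ck k (co i).
Proof.
case: k => [|k]; first by split => //; exact: continuous_co.
apply: CkS_intro; first exact: continuous_co.
move=> w; exists (fun=> co i w); last exact: Ck_cst.
by move=> x; exact: is_derive_co.
Qed.

Definition cube (r : R) : set (R3 R) :=
  (`[- r, r]%classic `*` `[- r, r]%classic) `*` `[- r, r]%classic.

Lemma cubeP r x : cube r x <-> forall i, `|co i x| <= r.
Proof.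
rewrite /cube /=; split.
  move=> [[/=]]; rewrite !in_itv /= -!ler_norml => h0 h1 h2 i; rewrite co_case.
  by do !case: ifP.
move=> h; rewrite !in_itv /= -!ler_norml; split; first split.
- by have := h 0; rewrite co0.
- by have := h 1; rewrite co1.
- by have := h 2; rewrite co2.
Qed.

Definition box (a b : R3 R) : set (R3 R) :=
  (`[a.1.1, b.1.1]%classic `*` `[a.1.2, b.1.2]%classic) `*` `[a.2, b.2]%classic.

Lemma boxP a b x : box a b x <-> forall i, co i a <= co i x <= co i b.
Proof.
rewrite /box /=; split.
  move=> [[/=]]; rewrite !in_itv /= => h0 h1 h2 i; rewrite !co_case.
  by do !case: ifP.
move=> h; rewrite !in_itv /=; split; first split.
- by have := h 0; rewrite !co0.
- by have := h 1; rewrite !co1.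
- by have := h 2; rewrite !co2.
Qed.

Lemma compact_box a b : compact (box a b).
Proof. by do 2 ?apply: compact_setX; exact: segment_compact. Qed.

Lemma compact_cube r : compact (cube r).
Proof. by do 2 ?apply: compact_setX; exact: segment_compact. Qed.

Lemma closed_box a b : closed (box a b).
Proof. by apply: compact_closed; [exact: norm_hausdorff|exact: compact_box]. Qed.

Lemma measurable_box a b : measurable (box a b).
Proof. by apply: closed_measurable3; exact: closed_box. Qed.

Lemma measurable_cube r : measurable (cube r).
Proof. by do 2 ?apply: measurableX. Qed.

Lemma mu3X (A B C : set R) : measurable A -> measurable B -> measurable C ->
  mu ((A `*` B) `*` C) =
  (lebesgue_measure A * lebesgue_measure B * lebesgue_measure C)%E.
Proof.
move=> mA mB mC; rewrite /mu3 product_measure1E //; last exact: measurableX.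
by congr (_ * _)%E; exact: product_measure1E.
Qed.

Lemma mu3_cube_fin r : (mu (cube r) < +oo)%E.
Proof.
rewrite /cube mu3X // lebesgue_measure_itv /=.
by case: ifP; rewrite ?mule0 ?mul0e// -?EFinM ?ltry.
Qed.

Lemma cube_norm r x : `|x| <= r -> cube r x.
Proof.
move=> h; apply/cubeP => i; rewrite co_case.
have h1 : `|x.1| <= r by apply: le_trans h; rewrite prod_normE le_max lexx.
have h2 : `|x.2| <= r by apply: le_trans h; rewrite prod_normE le_max lexx orbT.
have h3 : `|x.1.1| <= r by apply: le_trans h1; rewrite prod_normE le_max lexx.
have h4 : `|x.1.2| <= r by apply: le_trans h1; rewrite prod_normE le_max lexx orbT.
by do !case: ifP.
Qed.

Lemma bounded_cube (A : set (R3 R)) : bounded_set A ->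
  exists2 r, 0 < r & A `<=` cube r.
Proof.
move=> [M [_ hM]]; exists (`|M| + 1); first by rewrite ltr_wpDl.
by move=> x Ax; apply: cube_norm; apply: (hM (`|M| + 1)) => //;
  rewrite (le_lt_trans (ler_norm M))// ltrDl.
Qed.

Lemma compact_sub_cube (A : set (R3 R)) : compact A ->
  exists2 r, 0 < r & A `<=` cube r.
Proof. by move=> /compact_bounded; exact: bounded_cube. Qed.

Lemma bounded_closure_compact (A : set (R3 R)) r : A `<=` cube r ->
  compact (closure A).
Proof.
move=> Ar; apply: (subclosed_compact _ (@compact_cube r)); first exact: closed_closure.
have -> : cube r = closure (cube r).
  by apply/closure_id; apply: compact_closed; [exact: norm_hausdorff|exact: compact_cube].
exact: closure_subset.
Qed.

End Coordinates.

(** * Compact supports and the Sobolev inequality *)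

Section CompactSupport.
Context {R : realType}.
Local Notation mu := (@mu3 R).
Local Notation leb := (@lebesgue_measure R).

Definition csupp (r : R) (f : R3 R -> R) := forall x, ~ cube r x -> f x = 0.

Lemma test_fun_out (U : set (R3 R)) phi x : test_fun U phi -> ~ U x ->
  phi x = 0 /\ forall w, 'D_w phi x = 0.
Proof.
move=> [sphi [_ csub]] nUx.
have nx : ~ closure [set x | phi x != 0] x by move=> /csub.
have near0 : \forall y \near x, cst 0 y = phi y.
  move: nx => /existsNP[A /not_implyP[nA /nonemptyPn A0]].
  apply: filterS nA => y Ay; apply/esym/eqP; apply: contrapT => /negP ny.
  by have : ([set x | phi x != 0] `&` A) y by []; rewrite A0.
split; first exact: (esym (nbhs_singleton near0)).
by move=> w; rewrite -(near_eq_derive w near0) derive_cst.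
Qed.

Lemma test_fun_Ck k (U : set (R3 R)) phi : test_fun U phi -> Ck k phi.
Proof. by move=> [h _]; exact: h. Qed.

Lemma test_fun_csupp (U : set (R3 R)) phi : test_fun U phi ->
  exists2 r, 0 < r & csupp r phi /\ forall w, csupp r (fun x => 'D_w phi x).
Proof.
move=> tphi; have [_ [cK _]] := tphi.
have tphi' : test_fun (closure [set x | phi x != 0]) phi.
  by case: tphi => s [c _]; split=> //; split.
have [r r0 Kr] := compact_sub_cube cK; exists r => //; split.
  by move=> x nx; have [] := test_fun_out (x := x) tphi' (contra_not (@Kr x) nx).
by move=> w x nx; have [_ /(_ w)] := test_fun_out (x := x) tphi' (contra_not (@Kr x) nx).
Qed.

Lemma test_funS (U U' : set (R3 R)) phi : U `<=` U' -> test_fun U phi ->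
  test_fun U' phi.
Proof. by move=> UU' [? [? h]]; split=> //; split=> //; exact: subset_trans UU'. Qed.

Lemma continuous_bounded_cube (f : R3 R -> R) r : continuous f ->
  exists2 M, 0 < M & forall x, cube r x -> `|f x| <= M.
Proof.
move=> cf.
have : compact (f @` cube r).
  apply: continuous_compact; last exact: compact_cube.
  by move=> x; apply: continuous_subspaceT.
move=> /compact_bounded[M [_ hM]]; exists (`|M| + 1); first by rewrite ltr_wpDl.
move=> x rx; apply: (hM (`|M| + 1)); last by exists x.
by rewrite (le_lt_trans (ler_norm M))// ltrDl.
Qed.

Lemma csupp_bounded (f : R3 R -> R) r : continuous f -> csupp r f ->
  exists2 M, 0 < M & forall x, `|f x| <= M.
Proof.
move=> cf sf; have [M M0 hM] := continuous_bounded_cube r cf.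
exists M => // x; have [/hM //|nx] := pselect (cube r x).
by rewrite sf // normr0 ltW.
Qed.

Lemma bounded_integrable (A : set (R3 R)) (f : R3 R -> R) M : measurable A ->
  (mu A < +oo)%E -> measurable_fun A f -> (forall x, A x -> `|f x| <= M) ->
  mu.-integrable A (EFin \o f).
Proof.
move=> mA Afin mf fM.
apply: (@le_integrable _ _ _ mu A mA _ (EFin \o cst `|M|)).
- exact/measurable_EFinP.
- move=> x Ax /=; rewrite lee_fin normr_id.
  by apply: le_trans (fM x Ax) _; exact: ler_norm.
- apply/integrableP; split; first exact/measurable_EFinP.
  by under eq_integral do rewrite /= normr_id; rewrite integral_cst // lte_mul_pinfty.
Qed.

Lemma csupp_integrable (f : R3 R -> R) r : continuous f -> csupp r f ->
  mu.-integrable setT (EFin \o f).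
Proof.
move=> cf sf; have [M M0 hM] := csupp_bounded cf sf.
have : mu.-integrable (cube r) (EFin \o f).
  apply: (@bounded_integrable _ _ M) => //.
  - exact: measurable_cube.
  - exact: mu3_cube_fin.
  - by apply: measurable_funTS; exact: continuous_measurable3.
rewrite integrable_mkcond; last exact: measurable_cube.
congr (integrable _ _ _); apply/funext => x; rewrite patchE.
case: ifPn => //; rewrite notin_setE => nx.
by rewrite /= sf.
Qed.

End CompactSupport.

(** * Integration and differentiation along coordinate lines *)

Section Lines.
Context {R : realType}.
Local Notation mu := (@mu3 R).
Local Notation leb := (@lebesgue_measure R).

(** Parametrizes by t the line of direction [e_ R j], the other two coordinates being p and q in
    order; this gives Fubini's theorem one form for all three axes. *)
Definition ins (j : 'I_3) (p q t : R) : R3 R :=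
  if j == 0 then (t, p, q) else if j == 1 then (p, t, q) else (p, q, t).

Lemma ord3P (P : 'I_3 -> Prop) : P 0 -> P 1 -> P 2 -> forall j, P j.
Proof.
move=> h0 h1 h2 [[|[|[|//]]] hj].
- by rewrite (_ : Ordinal _ = 0) //; exact: val_inj.
- by rewrite (_ : Ordinal _ = 1) //; exact: val_inj.
- by rewrite (_ : Ordinal _ = 2) //; exact: val_inj.
Qed.

Lemma tonelli_swap (g : R * R -> \bar R) : measurable_fun setT g ->
  (forall x, 0 <= g x)%E ->
  (\int[leb]_x \int[leb]_y g (x, y) = \int[leb]_y \int[leb]_x g (x, y))%E.
Proof. by move=> mg g0; exact: (@fubini_tonelli _ _ _ _ _ leb leb g mg g0). Qed.

Lemma fubini_line (j : 'I_3) (f : R3 R -> \bar R) : measurable_fun setT f ->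
  (forall x, 0 <= f x)%E ->
  (\int[mu]_x f x = \int[leb]_p \int[leb]_q \int[leb]_t f (ins j p q t))%E.
Proof.
move=> mf f0; rewrite (fubini3 mf f0).
have pair3 (g1 g2 g3 : R * R -> R) : measurable_fun setT g1 ->
    measurable_fun setT g2 -> measurable_fun setT g3 ->
    measurable_fun setT (fun p : R * R => f (g1 p, g2 p, g3 p)).
  move=> m1 m2 m3; apply: (measurableT_comp mf).
  by do 2 ?apply: measurable_fun_pair.
move: j; apply: ord3P; rewrite /ins /=; last by [].
- have mF : measurable_fun setT (fun p : R * R => \int[leb]_z f (p, z))%E.
    exact: (@measurable_fun_fubini_tonelli_F _ _ _ _ _ leb f).
  have F0 (p : R * R) : (0 <= \int[leb]_z f (p, z))%E by exact: integral_ge0.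
  etransitivity; first exact: (tonelli_swap mF F0).
  apply: eq_integral => y _.
  apply: (tonelli_swap (g := fun p => f (p.1, y, p.2))); last by move=> ?; exact: f0.
  exact: pair3.
- apply: eq_integral => x _.
  apply: (tonelli_swap (g := fun p => f (x, p.1, p.2))); last by move=> ?; exact: f0.
  exact: pair3.
Qed.

Lemma co_inj (x y : R3 R) : (forall i, co i x = co i y) -> x = y.
Proof.
move=> h; have := h 0; have := h 1; have := h 2.
by rewrite !co0 !co1 !co2; case: x y {h} => [[a b] c] [[a' b'] c'] /= -> -> ->.
Qed.

Lemma insD j (p q h t : R) : ins j p q (h + t) = h *: e_ R j + ins j p q t.
Proof.
apply: co_inj => i; rewrite coD coZ co_e; move: i; move: j; apply: ord3P; apply: ord3P;
  by rewrite ?co0 ?co1 ?co2 /= ?mulr1 ?mulr0 ?add0r.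
Qed.

Lemma is_derive_line (f : R3 R -> R) j (p q t : R) : Ck 1 f ->
  is_derive t 1 (fun s : R => f (ins j p q s)) ('D_(e_ R j) f (ins j p q t)).
Proof.
move=> hf; have [fd _] := Ck_is_derive (ins j p q t) (e_ R j) hf.
have E (h : R) : ins j p q (h *: 1 + t) = h *: e_ R j + ins j p q t.
  by rewrite scaler1 insD.
have E2 : (fun h : R => h^-1 *: (((fun s : R => f (ins j p q s)) \o shift t) (h *: 1) -
      f (ins j p q t))) =
    (fun h : R => h^-1 *: ((f \o shift (ins j p q t)) (h *: e_ R j) - f (ins j p q t))).
  by apply/funext => h /=; rewrite E.
by apply: DeriveDef; rewrite ?/derivable ?/derive E2.
Qed.

Lemma continuous_ins j p q : continuous (ins j p q).
Proof.
rewrite (_ : ins j p q = fun t => t *: e_ R j + ins j p q 0).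
  move=> t; apply: cvgD; last exact: cvg_cst.
  by apply: cvgZr_tmp; exact: cvg_id.
by apply/funext => t; rewrite -insD addr0.
Qed.

Lemma FTC_line (g g' : R -> R) a b : (forall t : R, is_derive t 1 g (g' t)) ->
  continuous g' -> a < b ->
  (\int[leb]_(t in `[a, b]) (g' t)%:E = (g b - g a)%:E)%E.
Proof.
move=> dg cg' ab; rewrite EFinB.
have cg : continuous g.
  move=> t; apply: differentiable_continuous; apply/derivable1_diffP.
  by have [] := dg t.
apply: continuous_FTC2 => //.
- exact: continuous_subspaceT.
- split.
  + by move=> t _; have [] := dg t.
  + by apply: cvg_at_right_filter; exact: cg.
  + by apply: cvg_at_left_filter; exact: cg.
- by move=> t _; rewrite derive1E; have [] := dg t.
Qed.

Lemma integral_itv_full (a b : R) (f : R -> \bar R) :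
  measurable_fun setT f ->
  (forall t, t \notin `[a, b] -> f t = 0%E) ->
  (\int[leb]_t f t = \int[leb]_(t in `[a, b]) f t)%E.
Proof.
move=> mf f0; rewrite [RHS]integral_mkcond; apply: eq_integral => t _.
rewrite patchE; case: ifPn => //; rewrite notin_setE /= => nt.
by apply: f0; apply/negP.
Qed.

End Lines.

Section CauchySchwarz.
Local Open Scope ereal_scope.
Context d (T : measurableType d) (R : realType) (m : {measure set T -> \bar R}).

(** Kept free of square roots and valid for infinite values, so that it can be iterated on inner
    integrals. The proof integrates u <= (t f + g / t) / 2 for the optimal t. *)
Lemma cauchy_schwarz_sqr (u f g : T -> \bar R) :
  measurable_fun setT u -> measurable_fun setT f -> measurable_fun setT g ->
  (forall x, 0 <= u x) -> (forall x, 0 <= f x) -> (forall x, 0 <= g x) ->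
  (forall x, u x * u x <= f x * g x) ->
  (\int[m]_x u x) * (\int[m]_x u x) <= (\int[m]_x f x) * (\int[m]_x g x).
Proof.
move=> mu mf mg u0 f0 g0 ufg.
(* If one factor has integral 0, it vanishes almost everywhere and so does u, even where the other
   factor is infinite, since 0 times infinity is 0. *)
have zero (h k : T -> \bar R) : measurable_fun setT h -> (forall x, 0 <= h x) ->
    (forall x, u x * u x <= h x * k x) -> \int[m]_x h x = 0 -> \int[m]_x u x = 0.
  move=> mh h0 uhk ih.
  have : ae_eq m setT h (cst 0).
    apply/ae_eq_integral_abs => //.
    by rewrite -[RHS]ih; apply: eq_integral => x _; rewrite gee0_abs.
  move=> ae; rewrite (@ge0_ae_eq_integral _ _ _ m setT u (cst 0)) ?integral0 //.
  apply: filterS ae => x hx Tx; have /= h'0 := hx Tx.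
  have := uhk x; rewrite h'0 mul0e => uu.
  apply/eqP; rewrite eq_le u0 andbT leNgt; apply/negP => ux.
  by have := mule_gt0 ux ux; rewrite ltNge uu.
have F0 : 0 <= \int[m]_x f x by exact: integral_ge0.
have G0 : 0 <= \int[m]_x g x by exact: integral_ge0.
have [Fz|Fz] := eqVneq (\int[m]_x f x) 0.
  by rewrite (zero f g) ?mul0e // mule_ge0.
have [Gz|Gz] := eqVneq (\int[m]_x g x) 0.
  by rewrite (zero g f) ?mul0e // ?mule_ge0// => x; rewrite [leRHS]muleC.
have Fp : 0 < \int[m]_x f x by rewrite lt0e Fz.
have Gp : 0 < \int[m]_x g x by rewrite lt0e Gz.
case EF : (\int[m]_x f x) Fp => [F| |] // Fp; last by rewrite gt0_mulye // leey.
case EG : (\int[m]_x g x) Gp => [G| |] // Gp; last by rewrite gt0_muley // leey.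
rewrite !lte_fin in Fp Gp.
(* With this choice t F = G / t, and both are the square root of F G. *)
pose t := Num.sqrt (G / F).
have t0 : (0 < t)%R by rewrite sqrtr_gt0 divr_gt0.
have tt : (t * t = G / F)%R by rewrite -expr2 sqr_sqrtr // divr_ge0 // ltW.
have upt x : u x <= (t / 2)%:E * f x + (t^-1 / 2)%:E * g x.
  have t20 : (0 < t / 2)%R by rewrite divr_gt0.
  have t21 : (0 < t^-1 / 2)%R by rewrite divr_gt0 // invr_gt0.
  have := ufg x; have := u0 x; have := g0 x; have := f0 x.
  case: (f x) => [a| |] //; last first.
    move=> _ gx _ _; rewrite gt0_muley ?lte_fin// addye ?leey//.
    by rewrite -ltNye (lt_le_trans _ (mule_ge0 _ gx))// lee_fin ltW.
  case: (g x) => [b| |] //; last first.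
    by move=> _ gx _ _; rewrite [X in _ + X]gt0_muley ?lte_fin// -EFinM addey ?leey.
  case: (u x) => [c| |] //.
  rewrite -!EFinM -EFinD !lee_fin => a0 b0 c0 ccab.
  rewrite -ler_sqr ?nnegrE //; last by rewrite addr_ge0 // mulr_ge0 // ltW.
  apply: le_trans (_ : a * b <= _)%R; first by rewrite expr2.
  rewrite -subr_ge0.
  have -> : ((t / 2 * a + t^-1 / 2 * b) ^+ 2 - a * b = (t / 2 * a - t^-1 / 2 * b) ^+ 2)%R.
    by field; rewrite gt_eqF.
  exact: sqr_ge0.
have h : \int[m]_x u x <= ((t / 2) * F + (t^-1 / 2) * G)%:E.
  apply: (@le_trans _ _ (\int[m]_x ((t / 2)%:E * f x + (t^-1 / 2)%:E * g x))).
    apply: ge0_le_integral => //.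
    by apply: emeasurable_funD; exact: measurable_funeM.
  rewrite ge0_integralD //=; first last.
  - exact: measurable_funeM.
  - by move=> x _; rewrite mule_ge0 // lee_fin divr_ge0 // invr_ge0 ltW.
  - exact: measurable_funeM.
  - by move=> x _; rewrite mule_ge0 // lee_fin divr_ge0 // ltW.
  rewrite !ge0_integralZl_EFin //; first by rewrite EF EG -!EFinM -EFinD.
  - by rewrite divr_ge0 // invr_ge0 ltW.
  - by rewrite divr_ge0 // ltW.
have tn : (t != 0)%R by rewrite gt_eqF.
have -> : (F%:E * G%:E = ((t / 2) * F + (t^-1 / 2) * G)%:E * ((t / 2) * F + (t^-1 / 2) * G)%:E).
  rewrite -!EFinM; congr EFin.
  have -> : G = (t * t * F)%R by rewrite tt divfK ?gt_eqF.
  by field.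
by apply: lee_pmul => //; exact: integral_ge0.
Qed.

End CauchySchwarz.

(** * Compactly supported functions on lines, and the Loomis-Whitney inequality *)

Section Sobolev.
Context {R : realType}.
Local Notation mu := (@mu3 R).
Local Notation leb := (@lebesgue_measure R).

Lemma csupp_line j (f : R3 R -> R) (r p q t : R) : csupp r f ->
  t \notin `[- r, r] -> f (ins j p q t) = 0.
Proof.
move=> sf nt; apply: sf => /cubeP /(_ j) h; move/negP: nt; apply.
rewrite in_itv /= -ler_norml; apply: le_trans h.
by move: j; apply: ord3P; rewrite ?co0 ?co1 ?co2.
Qed.

Lemma measurable_line (f : R3 R -> \bar R) j p q : measurable_fun setT f ->
  measurable_fun setT (fun t => f (ins j p q t)).
Proof.
move=> mf; apply: (measurableT_comp mf).
move: j; apply: ord3P; rewrite /ins /=; do 2 ?apply: measurable_fun_pair => //.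
Qed.

(** The vanishing of the integral of g' is expressed by its positive and negative parts, so that
    Tonelli's theorem for nonnegative functions suffices when lines are assembled. The second bound
    integrates g' from the left end of the support. *)
Lemma line_FTC_cases (g g' : R -> R) (r : R) : 0 < r ->
  (forall t : R, is_derive t 1 g (g' t)) -> continuous g' ->
  (forall t, t \notin `[- r, r] -> g t = 0) ->
  (forall t, t \notin `[- r, r] -> g' t = 0) ->
  (\int[leb]_t ((EFin \o g')^\+ t) = \int[leb]_t ((EFin \o g')^\- t))%E /\
  (forall t, `|g t|%:E <= \int[leb]_s `|g' s|%:E)%E.
Proof.
move=> r0 dg cg' g0 g'0.
have mg' : measurable_fun [set: R] g' by exact: continuous_measurable_fun.
have out a : r < `|a| -> a \notin `[- r, r].
  by rewrite in_itv /= -ler_norml -ltNge.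
(* The interval is enlarged by 1 because g is known to vanish only strictly outside [[- r, r]], not
   at its ends. *)
have ig : leb.-integrable `[- (r + 1), r + 1] (EFin \o g').
  apply: continuous_compact_integrable; first exact: segment_compact.
  exact: continuous_subspaceT.
split.
  have : (\int[leb]_(t in `[(- (r + 1))%R, (r + 1)%R]) (g' t)%:E = 0)%E.
    rewrite (FTC_line dg cg'); last lra.
    by rewrite !g0 ?subrr// out// ?normrN ger0_norm; lra.
  rewrite integralE => /eqP; rewrite sube_eq ?add0e; last 2 first.
  - exact: integrable_pos_fin_num.
  - by apply: fin_num_adde_defl; exact: integrable_neg_fin_num.
  have outW t : t \notin `[- (r + 1), (r + 1)%R] -> g' t = 0.
    move=> nt; apply: g'0; apply: contra nt; rewrite !in_itv /=.
    by move=> /andP[? ?]; apply/andP; split; lra.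
  have mE : measurable_fun [set: R] (EFin \o g') by exact/measurable_EFinP.
  have opos t : t \notin `[(- (r + 1))%R, (r + 1)%R] -> ((EFin \o g')^\+ t = 0)%E.
    by move=> /outW h; rewrite funepos.unlock /= h maxxx.
  have oneg t : t \notin `[(- (r + 1))%R, (r + 1)%R] -> ((EFin \o g')^\- t = 0)%E.
    by move=> /outW h; rewrite funeneg.unlock /= h oppr0 maxxx.
  rewrite -(integral_itv_full (measurable_funepos mE) opos).
  by rewrite -(integral_itv_full (measurable_funeneg mE) oneg) => /eqP.
move=> t; have mn : measurable_fun [set: R] (fun s => `|g' s|%:E).
  by apply/measurable_EFinP; exact: measurableT_comp.
have [tr|/negP tr] := boolP (t \in `[- r, r]); last first.
  rewrite g0; last exact/negP.
  by rewrite normr0; apply: integral_ge0 => s _; rewrite lee_fin.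
have tr' : - (r + 1) < t.
  by move: tr; rewrite in_itv /= => /andP[? _]; lra.
have -> : g t = fine (\int[leb]_(s in `[(- (r + 1))%R, t]) (g' s)%:E)%E.
  rewrite (FTC_line dg cg') //= (g0 (- (r + 1))) ?subr0 //.
  by apply: out; rewrite normrN ger0_norm; lra.
have ig' : leb.-integrable `[- (r + 1), t] (EFin \o g').
  apply: continuous_compact_integrable; first exact: segment_compact.
  exact: continuous_subspaceT.
rewrite EFin_normr_Rintegral //.
apply: (@le_trans _ _ (\int[leb]_(s in `[(- (r + 1))%R, t]) `|g' s|%:E)%E).
  apply: le_abse_integral => //; exact/measurable_EFinP/measurable_funTS.
by apply: ge0_subset_integral => //= s _; rewrite lee_fin.
Qed.

Lemma continuous_line j p q (f : R3 R -> R) : continuous f ->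
  continuous (fun t => f (ins j p q t)).
Proof.
by move=> cf t; apply: continuous_comp; [exact: continuous_ins|exact: cf].
Qed.

Lemma integral_partial0 j (f : R3 R -> R) r : 0 < r -> Ck 1 f -> csupp r f ->
  csupp r (fun x => 'D_(e_ R j) f x) ->
  (\int[mu]_x ('D_(e_ R j) f x)%:E = 0)%E.
Proof.
move=> r0 hf sf sdf; have cdf := Ck_cont (Ck_derive (e_ R j) hf).
have mdf : measurable_fun setT (EFin \o (fun x => 'D_(e_ R j) f x)).
  by apply/measurable_EFinP; exact: continuous_measurable3.
have idf := csupp_integrable cdf sdf.
rewrite integralE.
suff -> : (\int[mu]_x ((EFin \o (fun x => 'D_(e_ R j) f x))^\+ x) =
           \int[mu]_x ((EFin \o (fun x => 'D_(e_ R j) f x))^\- x))%E.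
  by rewrite subee //; exact: integrable_neg_fin_num.
rewrite (fubini_line j (measurable_funepos mdf)); last by move=> ?; exact: funepos_ge0.
rewrite (fubini_line j (measurable_funeneg mdf)); last by move=> ?; exact: funeneg_ge0.
apply: eq_integral => p _; apply: eq_integral => q _.
have [h _] := @line_FTC_cases (fun t => f (ins j p q t))
  (fun t => 'D_(e_ R j) f (ins j p q t)) r r0
  (fun t => is_derive_line j p q t hf) (@continuous_line j p q _ cdf)
  (fun t nt => csupp_line j p q sf nt) (fun t nt => csupp_line j p q sdf nt).
by rewrite funepos.unlock funeneg.unlock in h *; exact: h.
Qed.

(* Loomis-Whitney: u^2 is dominated by the product of three functions, each
   independent of one coordinate. *)
Lemma loomis_whitney (u a b c : R3 R -> \bar R) :
  measurable_fun setT u -> measurable_fun setT a -> measurable_fun setT b ->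
  measurable_fun setT c -> (forall x, 0 <= u x)%E -> (forall x, 0 <= a x)%E ->
  (forall x, 0 <= b x)%E -> (forall x, 0 <= c x)%E ->
  (forall x y z, u (x, y, z) * u (x, y, z) <=
    (\int[leb]_t a (t, y, z)) * (\int[leb]_t b (x, t, z)) *
    (\int[leb]_t c (x, y, t)))%E ->
  ((\int[mu]_x u x) * (\int[mu]_x u x) <=
    (\int[mu]_x a x) * (\int[mu]_x b x) * (\int[mu]_x c x))%E.
Proof.
move=> mu_ ma mb mc u0 a0 b0 c0 uabc.
pose A y z := (\int[leb]_t a (t, y, z))%E.
pose B x z := (\int[leb]_t b (x, t, z))%E.
pose C x y := (\int[leb]_t c (x, y, t))%E.
have A0 y z : (0 <= A y z)%E by exact: integral_ge0.
have B0 y z : (0 <= B y z)%E by exact: integral_ge0.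
have C0 y z : (0 <= C y z)%E by exact: integral_ge0.
have swap3 (f : R3 R -> \bar R) (g : R3 R -> R3 R) : measurable_fun setT f ->
    measurable_fun setT g -> (forall x, 0 <= f x)%E ->
    measurable_fun setT (fun p : R * R => \int[leb]_t f (g (p, t)))%E.
  move=> mf mg f0.
  apply: (@measurable_fun_fubini_tonelli_F _ _ _ _ _ leb (f \o g)).
  - exact: measurableT_comp.
  - by move=> x; exact: f0.
have mA : measurable_fun setT (fun p : R * R => A p.1 p.2).
  apply: (swap3 a (fun x => (x.2, x.1.1, x.1.2))) => //.
  by do 2 ?apply: measurable_fun_pair => //; exact: measurableT_comp.
have mB : measurable_fun setT (fun p : R * R => B p.1 p.2).
  apply: (swap3 b (fun x => (x.1.1, x.2, x.1.2))) => //.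
  by do 2 ?apply: measurable_fun_pair => //; exact: measurableT_comp.
have mC : measurable_fun setT (fun p : R * R => C p.1 p.2).
  apply: (swap3 c (fun x => (x.1.1, x.1.2, x.2))) => //.
  by do 2 ?apply: measurable_fun_pair => //; exact: measurableT_comp.
have mU : measurable_fun setT (fun p : R * R => \int[leb]_z u (p.1, p.2, z))%E.
  apply: (swap3 u (fun x => (x.1.1, x.1.2, x.2))) => //.
  by do 2 ?apply: measurable_fun_pair => //; exact: measurableT_comp.
have m1 (f : R * R -> \bar R) x : measurable_fun setT f ->
    measurable_fun setT (fun y => f (x, y)).
  by move=> mf; exact: measurableT_comp.
have m2 (f : R * R -> \bar R) y : measurable_fun setT f ->
    measurable_fun setT (fun x => f (x, y)).
  by move=> mf; exact: measurableT_comp.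
have mi1 (f : R * R -> \bar R) : measurable_fun setT f -> (forall p, 0 <= f p)%E ->
    measurable_fun setT (fun x => \int[leb]_y f (x, y))%E.
  by move=> mf f0; exact: (@measurable_fun_fubini_tonelli_F _ _ _ _ _ leb f).
(* Cauchy-Schwarz is applied in z, then in y, then in x; each time one factor does not depend on the
   variable of integration and comes out: C x y, then the z-integral of B x z, then the full
   integral of A. *)
have uz x y : ((\int[leb]_z u (x, y, z)) * (\int[leb]_z u (x, y, z)) <=
    (C x y * \int[leb]_z B x z) * \int[leb]_z A y z)%E.
  have := @cauchy_schwarz_sqr _ _ _ leb (fun z => u (x, y, z))
    (fun z => C x y * B x z)%E (fun z => A y z).
  rewrite (@ge0_integralZl _ _ _ leb _ measurableT _
    (m1 (fun p => B p.1 p.2) x mB) (C x y) (fun z _ => B0 x z) (C0 x y)).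
  apply.
  - exact: measurable_line 2 x y mu_.
  - by apply: emeasurable_funM => //; exact: (m1 (fun p => B p.1 p.2)).
  - exact: (m1 (fun p => A p.1 p.2)).
  - by move=> z; exact: u0.
  - by move=> z; rewrite mule_ge0.
  - by move=> z; exact: A0.
  - by move=> z; rewrite (le_trans (uabc x y z))// [leRHS]muleC (muleC (C x y)) muleA.
have uy x : ((\int[leb]_y \int[leb]_z u (x, y, z)) *
             (\int[leb]_y \int[leb]_z u (x, y, z)) <=
    ((\int[leb]_y C x y) * \int[leb]_z B x z) * \int[leb]_y \int[leb]_z A y z)%E.
  have := @cauchy_schwarz_sqr _ _ _ leb (fun y => \int[leb]_z u (x, y, z))%E
    (fun y => C x y * \int[leb]_z B x z)%E (fun y => \int[leb]_z A y z)%E.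
  have IB0 : (0 <= \int[leb]_z B x z)%E by exact: integral_ge0.
  rewrite (@ge0_integralZr _ _ _ leb _ measurableT _
    (m1 (fun p => C p.1 p.2) x mC) _ (fun z _ => C0 x z) IB0).
  apply.
  - exact: (m1 (fun p => \int[leb]_z u (p.1, p.2, z))%E).
  - by apply: emeasurable_funM => //; exact: (m1 (fun p => C p.1 p.2)).
  - exact: (mi1 (fun p => A p.1 p.2)).
  - by move=> y; exact: integral_ge0.
  - by move=> y; rewrite mule_ge0 //; exact: integral_ge0.
  - by move=> y; exact: integral_ge0.
  - by move=> y; exact: uz.
pose IA := (\int[leb]_y \int[leb]_z A y z)%E.
rewrite (fubini3 mu_ u0).
have -> : (\int[mu]_x a x = IA)%E.
  exact: (fubini_line 0).
have -> : (\int[mu]_x b x = \int[leb]_y \int[leb]_z B y z)%E.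
  exact: (fubini_line 1).
have -> : (\int[mu]_x c x = \int[leb]_y \int[leb]_z C y z)%E.
  exact: (fubini_line 2).
have := @cauchy_schwarz_sqr _ _ _ leb (fun x => \int[leb]_y \int[leb]_z u (x, y, z))%E
  (fun x => IA * \int[leb]_z B x z)%E (fun x => \int[leb]_y C x y)%E.
have mBi := mi1 (fun p => B p.1 p.2) mB (fun p => B0 _ _).
have mCi := mi1 (fun p => C p.1 p.2) mC (fun p => C0 _ _).
have IA0 : (0 <= IA)%E by apply: integral_ge0 => ? _; exact: integral_ge0.
have IB0 x : (0 <= \int[leb]_z B x z)%E by exact: integral_ge0.
rewrite (@ge0_integralZl _ _ _ leb _ measurableT _ mBi _ (fun x _ => IB0 x) IA0).
apply.
- apply: (mi1 (fun p => \int[leb]_z u (p.1, p.2, z))%E); first by [].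
  by move=> p; exact: integral_ge0.
- by apply: emeasurable_funM; [exact: measurable_cst|exact: mBi].
- exact: mCi.
- by move=> x; apply: integral_ge0 => ? _; exact: integral_ge0.
- by move=> x; apply: mule_ge0; [exact: IA0|exact: IB0].
- by move=> x; exact: integral_ge0.
- have e (p q r : \bar R) : (p * q * r <= r * q * p)%E.
    by rewrite [leRHS]muleC (muleC r) muleA.
  by move=> x; exact: (le_trans (uy x) (e _ _ _)).
Qed.

Definition sqint (U : set (R3 R)) (f : R3 R -> R) : \bar R :=
  (\int[mu]_(x in U) ((f x) ^+ 2)%:E)%E.

Lemma csupp_even_fin (f : R3 R -> R) r n : continuous f -> csupp r f ->
  (\int[mu]_x ((f x) ^+ n.+1)%:E)%E \is a fin_num.
Proof.
move=> cf sf; apply: integrable_fin_num => //.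
apply: (@csupp_integrable _ (fun x => f x ^+ n.+1) r).
  move=> x; apply: (@continuous_comp _ _ _ f (fun y => y ^+ n.+1)); first exact: cf.
  exact: exprn_continuous.
by move=> x nx; rewrite sf // expr0n.
Qed.

End Sobolev.

Section SobolevTest.
Context {R : realType}.
Local Notation mu := (@mu3 R).
Local Notation leb := (@lebesgue_measure R).

(** Multiplying everything, S^4 <= (a0 a1 a2)^2 <= K^3 S^3 g0 g1 g2, and S^3 is divided out. *)
Lemma sobolev_arith (K S a0 a1 a2 g0 g1 g2 : R) : 0 <= K -> 0 <= S ->
  0 <= a0 -> 0 <= a1 -> 0 <= a2 -> S * S <= a0 * a1 * a2 ->
  a0 * a0 <= K * S * g0 -> a1 * a1 <= K * S * g1 -> a2 * a2 <= K * S * g2 ->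
  0 <= g0 -> 0 <= g1 -> 0 <= g2 ->
  S <= K ^+ 3 * (g0 * g1 * g2).
Proof.
move=> K0 S0 a00 a10 a20 h h0 h1 h2 g00 g10 g20.
have [->|Sn] := eqVneq S 0; first by rewrite mulr_ge0 ?exprn_ge0// !mulr_ge0.
have Sp : 0 < S by rewrite lt0r Sn.
have hh : (S * S) * (S * S) <= (a0 * a1 * a2) * (a0 * a1 * a2).
  by apply: ler_pM => //; repeat (first [done | apply: mulr_ge0]).
have h01 : (a0 * a0) * (a1 * a1) <= (K * S * g0) * (K * S * g1).
  by apply: ler_pM => //; repeat (first [done | apply: mulr_ge0]).
have h012 : (a0 * a0) * (a1 * a1) * (a2 * a2) <= (K * S * g0) * (K * S * g1) * (K * S * g2).
  by apply: ler_pM => //; repeat (first [done | apply: mulr_ge0]).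
have S3 : 0 < S * S * S by rewrite mulr_gt0 // mulr_gt0.
rewrite -(ler_pM2l S3).
apply: le_trans (_ : a0 * a0 * (a1 * a1) * (a2 * a2) <= _).
  apply: le_trans (le_trans hh _); rewrite le_eqVlt; apply/orP; left; apply/eqP; ring.
by apply: le_trans h012 _; rewrite le_eqVlt; apply/orP; left; apply/eqP; ring.
Qed.

Lemma sobolev_arithE (K : R) (S a0 a1 a2 g0 g1 g2 : \bar R) : 0 <= K ->
  (0 <= S -> 0 <= a0 -> 0 <= a1 -> 0 <= a2 -> 0 <= g0 -> 0 <= g1 -> 0 <= g2 ->
  S \is a fin_num -> a0 \is a fin_num -> a1 \is a fin_num -> a2 \is a fin_num ->
  g0 \is a fin_num -> g1 \is a fin_num -> g2 \is a fin_num ->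
  S * S <= a0 * a1 * a2 ->
  a0 * a0 <= K%:E * S * g0 -> a1 * a1 <= K%:E * S * g1 -> a2 * a2 <= K%:E * S * g2 ->
  S <= (K ^+ 3)%:E * (g0 * g1 * g2))%E.
Proof.
move: S a0 a1 a2 g0 g1 g2.
move=> [S| |] [a0| |] [a1| |] [a2| |] // [g0| |] [g1| |] [g2| |] // K0.
rewrite -!EFinM !lee_fin => *; exact: (@sobolev_arith K S a0 a1 a2).
Qed.

Definition pd (j : 'I_3) (f : R3 R -> R) (x : R3 R) : R := 'D_(e_ R j) f x.

(* Gagliardo-Nirenberg-Sobolev with exponents 2 and 6, obtained by applying the
   Loomis-Whitney inequality to phi^4. *)
Lemma sobolev_test (U : set (R3 R)) phi : test_fun U phi ->
  (\int[mu]_x (phi x ^+ 6)%:E <= (16 ^+ 3)%:E *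
    (sqint setT (pd 0%R phi) * sqint setT (pd 1%R phi) * sqint setT (pd 2%R phi)))%E.
Proof.
move=> tphi; have [r r0 [sp sdp]] := test_fun_csupp tphi.
have h1 : Ck 1 phi by exact: test_fun_Ck tphi.
have cphi := Ck_cont h1.
have cd j := Ck_cont (Ck_derive (e_ R j) h1).
pose D j := pd j phi.
have dw j x : is_derive x (e_ R j) (fun y => phi y ^+ 4) (4 * phi x ^+ 3 * D j x).
  have d1 : is_derive x (e_ R j) phi (D j x) := Ck_is_derive x (e_ R j) h1.
  have d2 := is_derive_fM d1 d1.
  have d4 := is_derive_fM d2 d2.
  rewrite (_ : (fun y => _) = (fun y => phi y * phi y * (phi y * phi y))); last first.
    by apply/funext => y; ring.
  by apply: is_derive_eq d4 _; ring.
have w2 : Ck 1 (fun y => phi y ^+ 4).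
  rewrite (_ : (fun y => _) = (fun y => phi y * phi y * (phi y * phi y))); last first.
    by apply/funext => y; ring.
  by apply: (Ck_mul (Ck_mul h1 h1) (Ck_mul h1 h1)).
have dwE j x : 'D_(e_ R j) (fun y => phi y ^+ 4) x = 4 * phi x ^+ 3 * D j x.
  by have [] := dw j x.
have cdw j := Ck_cont (Ck_derive (e_ R j) w2).
pose a j x : \bar R := `|4 * phi x ^+ 3 * D j x|%:E.
have ma j : measurable_fun setT (a j).
  apply/measurable_EFinP; apply: measurableT_comp => //.
  rewrite (_ : (fun x => _) = (fun x => 'D_(e_ R j) (fun y => phi y ^+ 4) x)).
    exact: continuous_measurable3 (cdw j).
  by apply/funext => x; rewrite dwE.
have a0 j x : (0 <= a j x)%E by rewrite lee_fin.
have mphi : measurable_fun setT phi by exact: continuous_measurable3.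
have md j : measurable_fun setT (D j) by exact: continuous_measurable3 (cd j).
have line j p q t : ((phi (ins j p q t) ^+ 4)%:E <= \int[leb]_s a j (ins j p q s))%E.
  have [_ /(_ t) h] := @line_FTC_cases R (fun t => phi (ins j p q t) ^+ 4)
    (fun t => 'D_(e_ R j) (fun y => phi y ^+ 4) (ins j p q t)) r r0
    (fun t => is_derive_line j p q t w2) (@continuous_line R j p q _ (cdw j))
    (fun t nt => ltac:(by rewrite /= (csupp_line j p q sp nt) expr0n))
    (fun t nt => ltac:(by rewrite /= dwE (csupp_line j p q sp nt) expr0n mulr0 mul0r)).
  apply: le_trans (le_trans h _); first by rewrite lee_fin ler_norm.
  by rewrite le_eqVlt; apply/orP; left; apply/eqP; apply: eq_integral => s _; rewrite /a dwE.
have p60 x : (0 <= (phi x ^+ 6)%:E)%E by rewrite lee_fin (exprM _ 2 3) exprn_ge0 ?sqr_ge0.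
have p40 x : (0 <= (phi x ^+ 4)%:E)%E by rewrite lee_fin (exprM _ 2 2) exprn_ge0 ?sqr_ge0.
have mp n : measurable_fun setT (fun x => (phi x ^+ n)%:E).
  by apply/measurable_EFinP; exact: measurable_funX.
(* The square of phi^6 is the product of three copies of phi^4, and each copy is bounded by a line
   integral in its own direction. *)
have LW : ((\int[mu]_x (phi x ^+ 6)%:E) * (\int[mu]_x (phi x ^+ 6)%:E) <=
    (\int[mu]_x a 0%R x) * (\int[mu]_x a 1%R x) * (\int[mu]_x a 2%R x))%E.
  apply: loomis_whitney => // x y z.
  rewrite -EFinM (_ : _ * _ = phi (x, y, z) ^+ 4 * phi (x, y, z) ^+ 4 * phi (x, y, z) ^+ 4)%R; last by ring.
  rewrite !EFinM; apply: lee_pmul; [|exact: p40| |exact: (line 2 x y z)].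
    by apply: mule_ge0; exact: p40.
  apply: lee_pmul; [exact: p40|exact: p40|exact: (line 0 y z x)|exact: (line 1 x z y)].
(* The square of 4 phi^3 D_j phi is 16 phi^6 times (D_j phi)^2. Cauchy-Schwarz brings back the
   integral of phi^6 itself; it is finite for a test function, so it can be absorbed. *)
have CS j : ((\int[mu]_x a j x) * (\int[mu]_x a j x) <=
    (\int[mu]_x (16 * phi x ^+ 6)%:E) * sqint setT (D j))%E.
  rewrite /sqint; apply: (@cauchy_schwarz_sqr _ _ _ mu (a j) (fun x => (16 * phi x ^+ 6)%:E)
    (fun x => ((D j x) ^+ 2)%:E)).
  - exact: ma.
  - by apply/measurable_EFinP; apply: measurable_funM => //; exact: measurable_funX.
  - by apply/measurable_EFinP; exact: (measurable_funX 2 (md j)).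
  - by move=> x; exact: a0.
  - by move=> x; rewrite lee_fin mulr_ge0 // -lee_fin; exact: p60.
  - by move=> x; rewrite lee_fin sqr_ge0.
  - move=> x; rewrite /a -!EFinM lee_fin -expr2 -normrX ger0_norm ?sqr_ge0//.
    rewrite le_eqVlt; apply/orP; left; apply/eqP; ring.
have Sfin : (\int[mu]_x (phi x ^+ 6)%:E)%E \is a fin_num by exact: csupp_even_fin sp.
have Gfin j : sqint setT (D j) \is a fin_num.
  by apply: (csupp_even_fin _ (cd j)); exact: sdp.
have Afin j : (\int[mu]_x a j x)%E \is a fin_num.
  apply: integrable_fin_num => //.
  apply: (@csupp_integrable _ (fun x => `|4 * phi x ^+ 3 * D j x|) r).
    move=> x; apply: cvg_norm; rewrite -dwE.
    rewrite (_ : (fun x => _) = (fun x => 'D_(e_ R j) (fun y => phi y ^+ 4) x)); first exact: (cdw j).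
    by apply/funext => y; rewrite dwE.
  by move=> x nx; rewrite sp // expr0n mulr0 mul0r normr0.
have CS' j : ((\int[mu]_x a j x) * (\int[mu]_x a j x) <=
    16%:E * (\int[mu]_x (phi x ^+ 6)%:E) * sqint setT (D j))%E.
  apply: le_trans (CS j) _; under eq_integral do rewrite EFinM.
  rewrite ge0_integralZl_EFin //; exact: (mp 6).
have S0 : (0 <= \int[mu]_x (phi x ^+ 6)%:E)%E by exact: integral_ge0.
have G0 j : (0 <= sqint setT (D j))%E by apply: integral_ge0 => x _; rewrite lee_fin sqr_ge0.
have A0 j : (0 <= \int[mu]_x a j x)%E by exact: integral_ge0.
have K0 : 0 <= 16 :> R by [].
exact: (sobolev_arithE K0 S0 (A0 0) (A0 1) (A0 2) (G0 0) (G0 1) (G0 2) Sfin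
  (Afin 0) (Afin 1) (Afin 2) (Gfin 0) (Gfin 1) (Gfin 2) LW (CS' 0) (CS' 1) (CS' 2)).
Qed.

End SobolevTest.

(** * Weak partial derivatives *)

#[global] Instance ae_mu3_filter (R : realType) :
  Filter (almost_everywhere (@mu3 R)).
Proof. exact: ae_filter_ringOfSetsType. Qed.

#[global] Instance ae_mu3_nbhs_filter (R : realType) :
  Filter (nbhs (almost_everywhere (@mu3 R))).
Proof. exact: ae_filter_ringOfSetsType. Qed.

(** * The fundamental lemma of the calculus of variations *)

Section FundamentalLemma.
Context {R : realType}.
Local Notation mu := (@mu3 R).

(** These orthants form a pi-system generating the measurable sets: intersections are again
    orthants, with coordinatewise maxima as corner. *)
Definition rays (a : R3 R) : set (R3 R) := [set x | forall i, co i a < co i x].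

Lemma raysI a b : rays a `&` rays b = rays
  (Num.max a.1.1 b.1.1, Num.max a.1.2 b.1.2, Num.max a.2 b.2).
Proof.
apply/seteqP; split=> x /=.
  move=> [h1 h2] i; have := h1 i; have := h2 i; rewrite !co_case /=.
  by do !case: ifP => _; rewrite gt_max => -> ->.
move=> h; split=> i; have := h i; rewrite !co_case /=;
  by do !case: ifP => _; rewrite gt_max => /andP[].
Qed.

Lemma measurable_rays a : measurable (rays a).
Proof.
rewrite (_ : rays a = (`]a.1.1, +oo[%classic `*` `]a.1.2, +oo[%classic) `*`
    `]a.2, +oo[%classic); first by do 2 ?apply: measurableX.
apply/seteqP; split=> x /=.
  move=> h; rewrite !in_itv /= !andbT; split; first split.
  - by have := h 0; rewrite !co0.
  - by have := h 1; rewrite !co1.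
  - by have := h 2; rewrite !co2.
by rewrite !in_itv /= !andbT => -[[h0 h1] h2] i; rewrite !co_case; do !case: ifP.
Qed.

Lemma measurable_rays_generated : @measurable _ (R3 R) = <<s range rays >>.
Proof.
apply/seteqP; split; last first.
  apply: smallest_sub; first exact: sigma_algebra_measurable.
  by move=> _ [a _ <-]; exact: measurable_rays.
pose T' := g_sigma_algebraType (range rays : set (set (R3 R))).
(* The half-space a < x_i is the increasing union of the orthants with corner a in coordinate i and
   -n in the other two. *)
pose u (i : 'I_3) (a : R) n : R3 R := (if i == 0 then a else - n%:R,
  if i == 1 then a else - n%:R, if i == 2 then a else - n%:R).
have uE (i j : 'I_3) a n : co j (u i a n) = if i == j then a else - n%:R.
  by move: j; move: i; apply: ord3P; apply: ord3P; rewrite ?co0 ?co1 ?co2.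
have mco i : measurable_fun [set: T'] (fun x : T' => co i (x : R3 R)).
  apply: (measurability _ (RGenOInfty.measurableE R)).
  move=> /= _ [_ [a ->]] <-; rewrite setTI.
  rewrite (_ : _ @^-1` _ = \bigcup_n rays (u i a n)).
    apply: bigcup_measurable => n _; apply: sub_sigma_algebra.
    by exists (u i a n).
  apply/seteqP; split=> x /=.
    rewrite in_itv /= andbT => ax.
    have [n xn] : exists n, forall j, - n%:R < co j x.
      pose m := \max_(j < 3) (Num.truncn `|co j x|).+1.
      exists m => j; rewrite ltrNl; apply: le_lt_trans (ler_norm _) _; rewrite normrN.
      apply: lt_le_trans (truncnS_gt _) _; rewrite ler_nat.
      exact: (leq_bigmax (F := fun j => (Num.truncn `|co j x|).+1) j).
    by exists n => // j; rewrite uE; case: eqP => [<-|].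
  by move=> [n _ /(_ i)]; rewrite uE eqxx in_itv /= andbT.
have mid : measurable_fun [set: T'] (fun x : T' => (x : R3 R)).
  have -> : (fun x : T' => (x : R3 R)) = fun x : T' => (co 0 (x : R3 R), co 1 (x : R3 R), co 2 (x : R3 R)).
    by apply/funext => -[[p q] r]; rewrite co0 co1 co2.
  by apply: measurable_fun_pair; [apply: measurable_fun_pair|]; exact: mco.
move=> A mA; have := mid measurableT A mA.
by rewrite setTI.
Qed.

Lemma setI_closed_rays : setI_closed (range rays).
Proof. by move=> _ _ [a _ <-] [b _ <-]; rewrite raysI; eexists. Qed.

(** Dynkin's theorem: the measurable sets on which g has integral 0 are stable under disjoint
    countable unions, and under complements because the total integral is 0. *)
Lemma zero_of_rays (g : R3 R -> R) : mu.-integrable setT (EFin \o g) ->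
  (\int[mu]_x (g x)%:E = 0)%E ->
  (forall a, \int[mu]_(x in rays a) (g x)%:E = 0)%E ->
  {ae mu, forall x, g x = 0}.
Proof.
move=> ig gT0 gr0.
have mg : measurable_fun setT (EFin \o g) by exact: measurable_int ig.
suff h S : @measurable _ (R3 R) S -> (\int[mu]_(x in S) (g x)%:E = 0)%E.
  have : ae_eq mu setT (EFin \o g) (cst 0%E).
    apply: integral_ae_eq => // E _ mE.
    by rewrite integral0; exact: h.
  by apply: filterS => x /(_ Logic.I) [].
move=> mS; rewrite measurable_rays_generated in mS.
pose P (A : set (R3 R)) : Prop := (\int[mu]_(x in A) (g x)%:E = 0)%E.
suff: P S by [].
apply: (@dynkin_induction _ (R3 R) (range rays) P _ _ _ _ _ _ S mS).
- exact: measurable_rays_generated.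
- exact: setI_closed_rays.
- exact: gT0.
- by move=> _ [a _ <-]; exact: gr0.
- move=> A mA A0; have mA' := measurableC mA.
  have dA : [disjoint A & ~` A] by rewrite disj_set2E setICr.
  have := @integral_setU _ _ _ mu A (~` A) (EFin \o g) mA mA'.
  rewrite setUv => /(_ mg dA); rewrite /= gT0 A0 add0e => /esym h; exact: h.
- move=> F mF tF F0.
  have iF : mu.-integrable (\bigcup_k F k) (EFin \o g).
    apply: (integrableS _ _ _ ig); [exact: measurableT| |by []].
    exact: (bigcupT_measurable _ mF).
  rewrite /P; etransitivity; first exact: (@integral_bigcup _ _ _ mu F (EFin \o g) tF mF iF).
  by apply: eseries0 => n _ _; exact: F0.
Qed.

Definition obox (a b : R3 R) : set (R3 R) :=
  [set x | forall i, co i a < co i x < co i b].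

(** Since [flat 0 (n t)] is 0 for t <= 0 and tends to 1 for t > 0, the products are smooth functions
    with values in [0, 1] that converge pointwise to the indicator of the open box. *)
Definition bump1 (a b : R3 R) (n : nat) (i : 'I_3) (x : R3 R) : R :=
  flat 0 (n%:R * (co i x - co i a)) * flat 0 (n%:R * (co i b - co i x)).

Definition bump a b n x := bump1 a b n 0 x * bump1 a b n 1 x * bump1 a b n 2 x.

Lemma bump1_ge0 a b n i x : 0 <= bump1 a b n i x.
Proof. by rewrite mulr_ge0 ?flat_ge0. Qed.

Lemma bump1_le1 a b n i x : bump1 a b n i x <= 1.
Proof. by rewrite mulr_ile1 ?flat_ge0 ?flat0_le1. Qed.

Lemma bump_ge0 a b n x : 0 <= bump a b n x.
Proof. exact: (mulr_ge0 (mulr_ge0 (bump1_ge0 _ _ _ _ _) (bump1_ge0 _ _ _ _ _)) (bump1_ge0 _ _ _ _ _)). Qed.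

Lemma bump_le1 a b n x : bump a b n x <= 1.
Proof.
have h0 i := bump1_ge0 a b n i x; have h1 i := bump1_le1 a b n i x.
by apply: mulr_ile1 => //; [exact: mulr_ge0|apply: mulr_ile1].
Qed.

Lemma bump_out a b n x : ~ obox a b x -> bump a b n x = 0.
Proof.
move=> nx; suff [i h] : exists i, bump1 a b n i x = 0.
  by move: i h; apply: ord3P => h; rewrite /bump h ?mulr0 ?mul0r.
move: nx => /existsNP[i /negP]; rewrite negb_and -!leNgt => /orP[h|h]; exists i.
  by rewrite /bump1 flat_le0 ?mul0r// mulr_ge0_le0// subr_le0.
by rewrite /bump1 [X in _ * X]flat_le0 ?mulr0// mulr_ge0_le0// subr_le0.
Qed.

Lemma bump_cvg a b x : obox a b x -> bump a b n x @[n --> \oo] --> (1 : R).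
Proof.
move=> xab.
have h i : bump1 a b n i x @[n --> \oo] --> (1 : R).
  have /andP[h1 h2] := xab i.
  by rewrite -[1]mulr1; apply: cvgM; apply: flat_cvg1; rewrite subr_gt0.
have h3 := cvgM (cvgM (h 0) (h 1)) (h 2).
by rewrite !mulr1 in h3; exact: h3.
Qed.

Lemma smooth_bump a b n : smooth (bump a b n).
Proof.
move=> k; have h i : Ck k (bump1 a b n i).
  apply: Ck_mul; apply: Ck_flat; apply: Ck_mul => //; try exact: Ck_cst.
    by apply: Ck_add; [exact: Ck_co|exact: Ck_cst].
  apply: Ck_add; first exact: Ck_cst.
  have -> : (fun x => - co i x) = (fun x : R3 R => -1 * co i x).
    by apply/funext => x; rewrite mulN1r.
  by apply: Ck_mul; [exact: Ck_cst|exact: Ck_co].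
by apply: Ck_mul => //; exact: Ck_mul.
Qed.

Lemma test_fun_bump (U : set (R3 R)) a b n : box a b `<=` U -> test_fun U (bump a b n).
Proof.
move=> abU; split; first exact: smooth_bump.
have sub : closure [set x | bump a b n x != 0] `<=` box a b.
  rewrite [X in _ `<=` X](closure_id _).1; last exact: closed_box.
  apply: closure_subset => x /= nz; apply/boxP => i.
  have /(_ i) : obox a b x by apply: contrapT => /(bump_out n) h; rewrite h eqxx in nz.
  by move=> /andP[h1 h2]; rewrite !ltW.
split; last exact: subset_trans abU.
by apply: subclosed_compact sub; [exact: closed_closure|exact: compact_box].
Qed.

Lemma obox_sub_box a b : obox a b `<=` box a b.
Proof. by move=> x h; apply/boxP => i; have /andP[? ?] := h i; rewrite !ltW. Qed.

Lemma measurable_obox a b : measurable (obox a b).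
Proof.
rewrite (_ : obox a b = (`]a.1.1, b.1.1[%classic `*` `]a.1.2, b.1.2[%classic) `*`
    `]a.2, b.2[%classic); first by do 2 ?apply: measurableX.
apply/seteqP; split=> x /=.
  move=> h; rewrite !in_itv /=; split; first split.
  - by have := h 0; rewrite !co0.
  - by have := h 1; rewrite !co1.
  - by have := h 2; rewrite !co2.
by rewrite !in_itv /= => -[[h0 h1] h2] i; rewrite !co_case; do !case: ifP.
Qed.

Lemma integral_sub_support (U K : set (R3 R)) (f : R3 R -> \bar R) :
  K `<=` U -> (forall x, U x -> ~ K x -> f x = 0%E) ->
  (\int[mu]_(x in U) f x = \int[mu]_(x in K) f x)%E.
Proof.
move=> KU f0; rewrite integral_mkcond [RHS]integral_mkcond.
apply: eq_integral => x _; rewrite !patchE.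
have [xK|nK] := boolP (x \in K); first by rewrite mem_set //; apply/KU/set_mem.
by rewrite notin_setE in nK; case: ifPn => // /set_mem xU; exact: f0.
Qed.

Section Vanishing.
Variables (U : set (R3 R)) (g : R3 R -> R).
Hypothesis oU : open U.
Hypothesis lg : loc_integrable U g.
Hypothesis g0 : forall phi, test_fun U phi -> \int[mu]_(x in U) (g x * phi x) = 0.

(** Dominated convergence along [bump a b n]; the dominating function |g| is integrable on the
    closed box because that box is a compact subset of U. *)
Lemma integral_obox0 a b : box a b `<=` U -> (\int[mu]_(x in obox a b) (g x)%:E = 0)%E.
Proof.
move=> abU.
have mU : measurable U by exact: open_measurable3.
have mb : measurable (box a b) by exact: measurable_box.
have ig : mu.-integrable (box a b) (EFin \o g) by case: lg => _; apply => //; exact: compact_box.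
have mg : measurable_fun (box a b) g by apply/measurable_EFinP; exact: measurable_int ig.
have mbump n : measurable_fun (box a b) (bump a b n).
  apply: measurable_funTS; apply: continuous_measurable3.
  by have := @smooth_bump a b n 0%N => -[].
have ign n : mu.-integrable (box a b) (EFin \o (fun x => g x * bump a b n x)).
  apply: (@le_integrable _ _ _ mu (box a b) mb _ (EFin \o g)) => //.
    by apply/measurable_EFinP; exact: (measurable_funM mg (mbump n)).
  move=> x _ /=; rewrite lee_fin normrM -[leRHS]mulr1 ler_wpM2l // ger0_norm ?bump_ge0//.
  exact: bump_le1.
have zero n : (\int[mu]_(x in box a b) (g x * bump a b n x)%:E = 0)%E.
  have := g0 (@test_fun_bump U a b n abU).
  rewrite /Rintegral (@integral_sub_support U (box a b)) //.
    by move=> h; rewrite -[LHS](fineK (@integrable_fin_num _ _ _ mu _ mb _ (ign n))) /= h.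
  move=> x _ nx; rewrite bump_out ?mulr0 //.
  by apply: contra_not nx; exact: obox_sub_box.
have mob : measurable_fun (box a b) (fun x => g x * (x \in obox a b)%:R).
  apply: measurable_funM => //; apply: measurable_funTS.
  exact: measurable_indic (measurable_obox a b).
have [_ _] : [/\ mu.-integrable (box a b) (fun x => (g x * (x \in obox a b)%:R)%:E),
    (\int[mu]_(x in box a b) `|(g x * bump a b n x)%:E - (g x * (x \in obox a b)%:R)%:E|)%E
       @[n --> \oo] --> 0%E &
    (\int[mu]_(x in box a b) (g x * bump a b n x)%:E)%E @[n --> \oo] -->
    (\int[mu]_(x in box a b) (g x * (x \in obox a b)%:R)%:E)%E].
  apply: (@dominated_convergence _ _ _ mu (box a b) mb
    (fun n x => (g x * bump a b n x)%:E)
    (fun x => (g x * (x \in obox a b)%:R)%:E) (fun x => `|(g x)%:E|%E)).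
  - by move=> n; exact: measurable_int (ign n).
  - exact/measurable_EFinP.
  - apply: nearW => x bx; apply: cvg_EFin; first exact: nearW.
    apply: cvgM; first exact: cvg_cst.
    have [xo|xo] := boolP (x \in obox a b).
      by apply: bump_cvg; exact: set_mem.
    rewrite (_ : (fun n => _) = cst 0); first exact: cvg_cst.
    by apply/funext => n; apply: bump_out; rewrite notin_setE in xo.
  - exact: integrable_abse.
  - apply: nearW => x n bx; rewrite /= lee_fin normrM -[leRHS]mulr1 ler_wpM2l //.
    by rewrite ger0_norm ?bump_ge0 ?bump_le1.
rewrite (_ : (fun n => _) = cst 0%E); last by apply/funext => n; exact: zero.
move=> /cvg_lim h.
transitivity (\int[mu]_(x in box a b) (g x * (x \in obox a b)%:R)%:E)%E; last first.
  by rewrite -h // lim_cst.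
rewrite [RHS](@integral_sub_support (box a b) (obox a b)).
- by apply: eq_integral => x xo; rewrite xo mulr1.
- exact: obox_sub_box.
- by move=> x _ nx; rewrite memNset // mulr0.
Qed.

Lemma ae_zero_obox a b : box a b `<=` U ->
  {ae mu, forall x, obox a b x -> g x = 0}.
Proof.
move=> abU.
have mb : measurable (box a b) by exact: measurable_box.
have mo : measurable (obox a b) by exact: measurable_obox.
have ig : mu.-integrable (box a b) (EFin \o g).
  by case: lg => _; apply => //; exact: compact_box.
have igo : mu.-integrable (obox a b) (EFin \o g).
  by apply: (@integrableS _ _ _ mu _ _ _ mb mo _ ig); exact: obox_sub_box.
(* An open box meets an orthant in an open box, so all integrals of G over orthants are instances of
   [integral_obox0]. *)
pose G x := if x \in obox a b then g x else 0.
have GE : EFin \o G = (EFin \o g) \_ (obox a b).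
  by apply/funext => x; rewrite patchE /G /=; case: ifPn.
have iG : mu.-integrable setT (EFin \o G).
  by rewrite GE -integrable_mkcond.
have GI (A : set (R3 R)) : (\int[mu]_(x in A) (G x)%:E = \int[mu]_(x in obox a b `&` A) (g x)%:E)%E.
  rewrite setIC [RHS]integral_mkcondr; apply: eq_integral => x _.
  by rewrite patchE /G; case: ifPn.
have G0 : {ae mu, forall x, G x = 0}.
  apply: zero_of_rays => //; first by rewrite GI setIT; exact: integral_obox0.
  move=> c; rewrite GI.
  pose a' : R3 R := (Num.max a.1.1 c.1.1, Num.max a.1.2 c.1.2, Num.max a.2 c.2).
  have -> : obox a b `&` rays c = obox a' b.
    have coa i : co i a' = Num.max (co i a) (co i c).
      by move: i; apply: ord3P; rewrite ?co0 ?co1 ?co2.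
    apply/seteqP; split=> x /=.
      by move=> [h1 h2] i; rewrite coa gt_max h2; have /andP[-> ->] := h1 i.
    move=> h; split=> i; have := h i; rewrite coa gt_max => /andP[/andP[h1 h2] h3];
      by rewrite ?h1 ?h2 ?h3.
  apply: integral_obox0; apply: subset_trans abU => x /boxP h; apply/boxP => i.
  have := h i; have : co i a <= co i a'.
    by move: {h} i; apply: ord3P; rewrite ?co0 ?co1 ?co2 /= le_max lexx.
  by move=> aa' /andP[a'x ->]; rewrite (le_trans aa').
by apply: filterS G0 => x; rewrite /G => + xo; rewrite mem_set.
Qed.

(* A locally integrable function vanishes a.e. as soon as it is orthogonal to
   all test functions. *)
Lemma ae_zero_of_test : {ae mu, forall x, U x -> g x = 0}.
Proof.
(* U is exhausted by the countably many boxes with rational centre and half-side 1 / (n+1) that it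
   contains; indices coding no box impose the trivial condition. *)
pose I := (rat * rat * rat * nat)%type.
pose c (i : I) : R3 R := (ratr i.1.1.1, ratr i.1.1.2, ratr i.1.2).
pose d (i : I) : R3 R := (i.2.+1%:R^-1, i.2.+1%:R^-1, i.2.+1%:R^-1).
pose P (n : nat) x := if unpickle n is Some i then
  box (c i - d i) (c i + d i) `<=` U -> obox (c i - d i) (c i + d i) x -> g x = 0 else True.
have PP n : \forall x \ae mu, P n x.
  rewrite /P; case: (unpickle n) => [i|]; last by apply: nearW.
  have [h|h] := pselect (box (c i - d i) (c i + d i) `<=` U).
    by apply: filterS (ae_zero_obox h) => x + _.
  by apply: nearW => x.
apply: filterS (ae_foralln PP) => x Px Ux.
have /nbhs_ballP[e /= e0 xeU] : nbhs x U by exact: open_nbhs_nbhs.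
have [n ne] : exists n, n.+1%:R^-1 < e / 2.
  have e20 : 0 < e / 2 by rewrite divr_gt0.
  have [n _ nP] := near_infty_natSinv_lt (PosNum e20).
  by exists n; apply: (nP n) => /=.
set r := n.+1%:R^-1 in ne.
have r0 : 0 < r by rewrite invr_gt0.
have rd (y : R) : exists q : rat, `|ratr q - y| < r.
  have : y - r < y + r by lra.
  move=> /rat_in_itvoo[q]; rewrite in_itv /= => /andP[h1 h2].
  by exists q; rewrite ltr_distl h1 h2.
have [c1 h1] := rd (co 0 x); have [c2 h2] := rd (co 1 x); have [c3 h3] := rd (co 2 x).
pose i : I := (c1, c2, c3, n).
have dE k : co k (d i) = r by move: k; apply: ord3P; rewrite ?co0 ?co1 ?co2.
have cE k : `|co k (c i) - co k x| < r.
  by move: k; apply: ord3P; rewrite ?[co _ (c i)]co0 ?[co _ (c i)]co1 ?[co _ (c i)]co2.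
have := Px (pickle i); rewrite /P pickleK; apply.
  move=> y /boxP yb; apply: xeU.
  have yx k : `|co k x - co k y| < e.
    have := yb k; rewrite coB coD dE => /andP[y1 y2].
    have := cE k; rewrite ltr_norml => /andP[z1 z2].
    by rewrite ltr_norml; apply/andP; split; lra.
  by split; [split|]; [have := yx 0|have := yx 1|have := yx 2]; rewrite ?co0 ?co1 ?co2.
move=> k; rewrite coB coD dE.
have := cE k; rewrite ltr_norml => /andP[z1 z2].
by apply/andP; split; lra.
Qed.

End Vanishing.
End FundamentalLemma.

(** * Linearity and uniqueness of weak partial derivatives *)

Section WeakPartials.
Context {R : realType}.
Local Notation mu := (@mu3 R).

(** The integral of a nonnegative function is a supremum over the simple functions below it, so
    monotonicity holds for arbitrary functions. *)
Lemma ge0_le_integral_nomeas d (T : measurableType d) (m : {measure set T -> \bar R})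
    (D : set T) (f g : T -> \bar R) :
  (forall x, D x -> 0 <= f x)%E -> (forall x, D x -> f x <= g x)%E ->
  (\int[m]_(x in D) f x <= \int[m]_(x in D) g x)%E.
Proof.
move=> f0 fg.
have g0 x : D x -> (0 <= g x)%E by move=> Dx; exact: le_trans (f0 _ Dx) (fg _ Dx).
rewrite !ge0_integralE //; apply: le_ereal_sup => _ [h hf <-].
exists h => //= x; apply: le_trans (hf x) _.
by rewrite !patchE; case: ifPn => // /set_mem; exact: fg.
Qed.

Lemma continuous_integrable_mul (U K : set (R3 R)) (g f : R3 R -> R) :
  measurable U -> compact K -> K `<=` U -> loc_integrable U g ->
  continuous f -> (forall x, ~ K x -> f x = 0) ->
  mu.-integrable U (EFin \o (fun x => g x * f x)).
Proof.
move=> mU cK KU [mg ig] cf f0.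
have mK : measurable K.
  by apply: closed_measurable3; apply: compact_closed cK; exact: norm_hausdorff.
have [r r0 Kr] := compact_sub_cube cK.
have [M M0 fM] := continuous_bounded_cube r cf.
have mf : measurable_fun setT f by exact: continuous_measurable3.
have iK : mu.-integrable K (EFin \o (fun x => g x * f x)).
  apply: (@le_integrable _ _ _ mu K mK _ (fun x => M%:E * (g x)%:E)%E).
  - apply/measurable_EFinP; apply: measurable_funM; last exact: measurable_funTS.
    exact: measurable_funS mU KU mg.
  - move=> x Kx /=; rewrite lee_fin !normrM mulrC ler_wpM2r // (gtr0_norm M0).
    exact/fM/Kr.
  - by apply: integrableZl => //; exact: ig.
have -> : EFin \o (fun x => g x * f x) = (EFin \o (fun x => g x * f x)) \_ K.
  apply/funext => x; rewrite patchE; case: ifPn => //; rewrite notin_setE /= => nK.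
  by rewrite f0 // mulr0.
have := iK; rewrite (@integrable_mkcond _ _ _ mu _ _ mK) => h.
exact: (@integrableS _ _ _ mu setT U _ measurableT mU (@subsetT _ U) h).
Qed.

Lemma continuous_pd (U : set (R3 R)) phi j : test_fun U phi -> continuous (pd j phi).
Proof. by move=> /(test_fun_Ck 1) h; exact: Ck_cont (Ck_derive (e_ R j) h). Qed.

Lemma test_fun_continuous (U : set (R3 R)) phi : test_fun U phi -> continuous phi.
Proof. by move=> /(test_fun_Ck 0); exact: Ck_cont. Qed.

Lemma test_integrable (U : set (R3 R)) (g : R3 R -> R) phi : measurable U ->
  loc_integrable U g -> test_fun U phi ->
  mu.-integrable U (EFin \o (fun x => g x * phi x)) /\
  forall j, mu.-integrable U (EFin \o (fun x => g x * pd j phi x)).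
Proof.
move=> mU lg tphi; have [sphi [cK KU]] := tphi.
have tphi' : test_fun (closure [set x | phi x != 0]) phi by split=> //; split.
split=> [|j]; apply: (continuous_integrable_mul mU cK KU lg).
- exact: test_fun_continuous tphi.
- by move=> x nx; have [] := test_fun_out tphi' nx.
- exact: continuous_pd tphi.
- by move=> x nx; have [_ /(_ (e_ R j))] := test_fun_out tphi' nx.
Qed.

Lemma continuous_loc_integrable (U : set (R3 R)) (f : R3 R -> R) : continuous f ->
  loc_integrable U f.
Proof.
move=> cf; split; first by apply: measurable_funTS; exact: continuous_measurable3.
move=> K cK _.
have mK : measurable K.
  by apply: closed_measurable3; apply: compact_closed cK; exact: norm_hausdorff.
have [r r0 Kr] := compact_sub_cube cK.
have [M M0 fM] := continuous_bounded_cube r cf.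
apply: (@bounded_integrable _ _ _ M mK).
- apply: le_lt_trans (mu3_cube_fin r).
  by apply: le_measure => //; rewrite ?inE //; exact: measurable_cube.
- by apply: measurable_funTS; exact: continuous_measurable3.
- by move=> x /Kr; exact: fM.
Qed.

Lemma loc_integrableB (U : set (R3 R)) (f g : R3 R -> R) :
  loc_integrable U f -> loc_integrable U g ->
  loc_integrable U (fun x => f x - g x).
Proof.
move=> [mf lf] [mg lg]; split; first exact: measurable_funB.
move=> K cK KU; have mK : measurable K.
  by apply: closed_measurable3; apply: compact_closed cK; exact: norm_hausdorff.
by apply: (@integrableB _ _ _ mu K mK _ _ (lf K cK KU) (lg K cK KU)).
Qed.

Lemma is_weak_partialB (U : set (R3 R)) j u1 g1 u2 g2 : open U ->
  is_weak_partial U j u1 g1 -> is_weak_partial U j u2 g2 ->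
  is_weak_partial U j (fun x => u1 x - u2 x) (fun x => g1 x - g2 x).
Proof.
move=> oU [lu1 lg1 h1] [lu2 lg2 h2]; have mU := open_measurable3 oU.
split; [exact: loc_integrableB|exact: loc_integrableB|].
move=> phi tphi.
have [i1 j1] := test_integrable mU lu1 tphi; have [i2 j2] := test_integrable mU lu2 tphi.
have [i3 _] := test_integrable mU lg1 tphi; have [i4 _] := test_integrable mU lg2 tphi.
transitivity (\int[mu]_(x in U) (u1 x * pd j phi x - u2 x * pd j phi x)).
  by apply: eq_Rintegral => x _; rewrite mulrBl.
rewrite (@RintegralB _ _ _ mu U _ _ mU (j1 j) (j2 j)) h1 // h2 //.
transitivity (- \int[mu]_(x in U) (g1 x * phi x - g2 x * phi x)); last first.
  by congr (- _); apply: eq_Rintegral => x _; rewrite mulrBl.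
by rewrite (@RintegralB _ _ _ mu U _ _ mU i3 i4) opprB opprK addrC.
Qed.

Lemma integral_pd_mul (U : set (R3 R)) j (f phi : R3 R -> R) : Ck 1 f ->
  test_fun U phi ->
  (\int[mu]_x (pd j (fun y => f y * phi y) x)%:E = 0)%E.
Proof.
move=> hf tphi; have [r r0 [sp sdp]] := test_fun_csupp tphi.
have h1 := test_fun_Ck 1 tphi.
apply: (@integral_partial0 _ j (fun y => f y * phi y) r r0).
- exact: Ck_mul.
- by move=> x nx; rewrite sp // mulr0.
- move=> x nx.
  have [_ ->] := is_derive_fM (Ck_is_derive x (e_ R j) hf) (Ck_is_derive x (e_ R j) h1).
  by rewrite sp // sdp // !mulr0 addr0.
Qed.

Lemma is_weak_partial_smooth (U : set (R3 R)) j f : open U -> Ck 1 f ->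
  is_weak_partial U j f (pd j f).
Proof.
move=> oU hf; have mU := open_measurable3 oU.
have cf := Ck_cont hf; have cdf : continuous (pd j f) := Ck_cont (Ck_derive (e_ R j) hf).
have lf := continuous_loc_integrable U cf.
have ldf := continuous_loc_integrable U cdf.
split=> // phi tphi.
have [i1 j1] := test_integrable mU lf tphi; have [i2 _] := test_integrable mU ldf tphi.
apply/eqP; rewrite -subr_eq0 opprK.
have h1 := test_fun_Ck 1 tphi.
have E x : f x * pd j phi x + pd j f x * phi x = pd j (fun y => f y * phi y) x.
  have [_ e] := is_derive_fM (Ck_is_derive x (e_ R j) hf) (Ck_is_derive x (e_ R j) h1).
  by rewrite /pd e.
rewrite -(@RintegralD _ _ _ mu U _ _ mU (j1 j) i2) /Rintegral.
under eq_integral do rewrite E.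
rewrite -(@integral_sub_support _ setT U) //.
  by rewrite (integral_pd_mul j hf tphi).
move=> x _ nU; rewrite -E; have [-> /(_ (e_ R j))] := test_fun_out tphi nU.
by rewrite /pd => ->; rewrite !mulr0 addr0.
Qed.

(** The difference g1 - g2 is a weak derivative of u - u = 0, hence orthogonal to all test
    functions. *)
Lemma is_weak_partial_unique (U : set (R3 R)) j u g1 g2 : open U ->
  is_weak_partial U j u g1 -> is_weak_partial U j u g2 ->
  {ae mu, forall x, U x -> g1 x = g2 x}.
Proof.
move=> oU h1 h2; have [lg1 lg2] : loc_integrable U g1 /\ loc_integrable U g2.
  by case: h1 => _ ? _; case: h2 => _ ? _.
have [_ _ h] := is_weak_partialB oU h1 h2.
have z phi : test_fun U phi -> \int[mu]_(x in U) ((g1 x - g2 x) * phi x) = 0.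
  move=> tphi; have := h phi tphi.
  under eq_Rintegral do rewrite subrr mul0r.
  rewrite Rintegral_cst ?mul0r; last exact: open_measurable3.
  by move/esym/eqP; rewrite oppr_eq0 => /eqP.
have := ae_zero_of_test oU (loc_integrableB lg1 lg2) z.
by apply: filterS => x + Ux => /(_ Ux) /eqP; rewrite subr_eq0 => /eqP.
Qed.

Lemma weak_partialP (U : set (R3 R)) j u :
  (exists g, is_weak_partial U j u g) ->
  is_weak_partial U j u (weak_partial U j u).
Proof. by move=> [g hg]; apply: getPex; exists g. Qed.

End WeakPartials.

(** * Limits of test functions *)

Section Norms.
Context {R : realType}.
Local Notation mu := (@mu3 R).

Lemma ddot_sqr m n (A : 'M[R]_(m, n)) : ddot A A = \sum_i \sum_j (A i j) ^+ 2.
Proof. by apply: eq_bigr => i _; apply: eq_bigr => j _; rewrite expr2. Qed.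

Lemma ddot_ge0 m n (A : 'M[R]_(m, n)) : 0 <= ddot A A.
Proof. by rewrite ddot_sqr; do 2 (apply: sumr_ge0 => ? _); exact: sqr_ge0. Qed.

Lemma frob_ge0 m n (A : 'M[R]_(m, n)) : 0 <= frob A.
Proof. exact: sqrtr_ge0. Qed.

Lemma frob_sqr m n (A : 'M[R]_(m, n)) : frob A ^+ 2 = \sum_i \sum_j (A i j) ^+ 2.
Proof. by rewrite sqr_sqrtr ?ddot_ge0 // ddot_sqr. Qed.

Lemma entry_le_frob m n (A : 'M[R]_(m, n)) i j : (A i j) ^+ 2 <= frob A ^+ 2.
Proof.
rewrite frob_sqr (bigD1 i) //= (bigD1 j) //= -addrA lerDl addr_ge0 //.
  by apply: sumr_ge0 => *; exact: sqr_ge0.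
by do 2 (apply: sumr_ge0 => ? _); exact: sqr_ge0.
Qed.

Lemma abs_entry_le_frob m n (A : 'M[R]_(m, n)) i j : `|A i j| <= frob A.
Proof.
rewrite -(ler_pXn2r (n := 2)) ?nnegrE ?frob_ge0 //.
by rewrite real_normK ?num_real // entry_le_frob.
Qed.

Lemma LN_natE k U m n (u : R3 R -> 'M[R]_(m, n)) :
  LN (k.+1%:R)%:E U u =
  ((\int[mu]_(x in U) (frob (u x) ^+ k.+1)%:E) `^ (k.+1%:R)^-1)%E.
Proof.
rewrite /LN unlock; congr (_ `^ _)%E.
rewrite [RHS]integral_mkcond; apply: eq_integral => x _.
rewrite patchE /=; case: ifPn => _; last by rewrite normr0 powR0.
by rewrite ger0_norm ?frob_ge0 // powR_mulrn // frob_ge0.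
Qed.

Lemma LN_nat_le k U m n (u : R3 R -> 'M[R]_(m, n)) (c : R) : 0 <= c ->
  (LN (k.+1%:R)%:E U u <= c%:E)%E <->
  (\int[mu]_(x in U) (frob (u x) ^+ k.+1)%:E <= (c ^+ k.+1)%:E)%E.
Proof.
move=> c0; rewrite LN_natE.
have : (0 <= \int[mu]_(x in U) (frob (u x) ^+ k.+1)%:E)%E.
  by apply: integral_ge0 => x _; rewrite lee_fin exprn_ge0 // frob_ge0.
case: (\int[mu]_(x in U) _)%E => [r| |] // r0.
  rewrite poweR_EFin !lee_fin in r0 *.
  have k0 : k.+1%:R != 0 :> R by [].
  have rE : r = (r `^ (k.+1%:R)^-1) ^+ k.+1.
    by rewrite -powR_mulrn ?powR_ge0 // -powRrM mulVf // powRr1.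
  split=> h; first by rewrite rE ler_pXn2r ?nnegrE // ?powR_ge0.
  by rewrite -(ler_pXn2r (n := k.+1)) ?nnegrE ?powR_ge0 // -rE.
by rewrite poweRyr ?invr_eq0 //; split.
Qed.

Definition L2 (U : set (R3 R)) (f : R3 R -> R) :=
  measurable_fun U f /\ (sqint U f < +oo)%E.

Lemma sqint_entry U m n (u : R3 R -> 'M[R]_(m, n)) i j :
  (sqint U (fun x => u x i j) <= \int[mu]_(x in U) (frob (u x) ^+ 2)%:E)%E.
Proof.
apply: ge0_le_integral_nomeas => x _; rewrite lee_fin ?sqr_ge0 //.
exact: entry_le_frob.
Qed.

Lemma inLp2_L2 (U : set (R3 R)) m n (u : R3 R -> 'M[R]_(m, n)) i j : inLp 2%:E U u ->
  L2 U (fun x => u x i j).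
Proof.
move=> [mu_ fu]; split; first exact: mu_.
apply: le_lt_trans (sqint_entry U u i j) _.
move: fu; rewrite (LN_natE 1) ltNge leye_eq => h.
by rewrite ltey; apply: contraNneq h => ->; rewrite poweRyr ?eqxx // invr_eq0.
Qed.

Lemma sqint_ge0 U f : (0 <= @sqint R U f)%E.
Proof. by apply: integral_ge0 => x _; rewrite lee_fin sqr_ge0. Qed.

Lemma sqint_ae (U : set (R3 R)) (f g : R3 R -> R) : measurable U ->
  measurable_fun U f -> measurable_fun U g ->
  {ae mu, forall x, U x -> f x = g x} -> sqint U f = sqint U g.
Proof.
move=> mU mf mg fg; apply: (@ae_eq_integral _ _ _ mu U _ _ mU).
- by apply/measurable_EFinP; exact: measurable_funX.
- by apply/measurable_EFinP; exact: measurable_funX.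
- by apply: filterS fg => x h Ux; rewrite /= h.
Qed.

(* Limits of test functions for the norm of H^1, with gradient g. *)
Definition H10s (U : set (R3 R)) (u : R3 R -> R) (g : 'I_3 -> R3 R -> R) :=
  [/\ measurable_fun U u, forall j, measurable_fun U (g j) &
   forall d, 0 < d -> exists phi, [/\ test_fun U phi,
     (sqint U (fun x => (u x - phi x)%R) <= d%:E)%E &
     forall j, (sqint U (fun x => (g j x - pd j phi x)%R) <= d%:E)%E]].

(** [H1norm] involves the gradient of z - phi selected by [weak_partial]; by uniqueness it agrees
    almost everywhere with g - grad phi for any weak gradient g of z. The freedom in g is used when
    z is a difference whose gradient is given by an explicit formula. *)
Lemma inH10_H10s_gen (U : set (R3 R)) (z : R3 R -> 'cV[R]_3) (i : 'I_3)
    (g : 'I_3 -> R3 R -> R) : open U ->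
  inH10 U z -> (forall j, is_weak_partial U j (fun x => z x i 0) (g j)) ->
  H10s U (fun x => z x i 0) g.
Proof.
move=> oU [[[mz _] wz _] hz] hg; have mU := open_measurable3 oU.
split; first exact: mz.
  by move=> j; have [_ [? _] _] := hg j.
move=> d d0; have s0 : 0 < Num.sqrt d by rewrite sqrtr_gt0.
have [phi tphi hphi] := hz _ s0.
have sd : Num.sqrt d ^+ 2 = d by rewrite sqr_sqrtr // ltW.
exists (fun x => phi x i 0); split; first exact: tphi.
- have : (LN 2%:E U (fun x => (z x - phi x)%R) <= (Num.sqrt d)%:E)%E.
    by apply: le_trans (ltW hphi); rewrite /H1norm leeDl // Lnorm_ge0.
  move=> /(LN_nat_le 1 _ _ (ltW s0)) h; rewrite sd in h.
  apply: le_trans (le_trans (sqint_entry U (fun x => z x - phi x) i 0) h).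
  by rewrite /sqint le_eqVlt; apply/orP; left; apply/eqP; apply: eq_integral => x _; rewrite !mxE.
- move=> j.
  have : (LN 2%:E U (wgrad U (fun x => (z x - phi x)%R)) <= (Num.sqrt d)%:E)%E.
    by apply: le_trans (ltW hphi); rewrite /H1norm leeDr // Lnorm_ge0.
  move=> /(LN_nat_le 1 _ _ (ltW s0)) h; rewrite sd in h.
  apply: le_trans (le_trans (sqint_entry U (wgrad U (fun x => z x - phi x)) i j) h).
  have c1 : Ck 1 (fun x => phi x i 0) by exact: test_fun_Ck (tphi i).
  have w1 := is_weak_partialB oU (hg j) (is_weak_partial_smooth j oU c1).
  have w2 : is_weak_partial U j (fun x => z x i 0 - phi x i 0)
    (weak_partial U j (fun x => (z x - phi x) i 0)).
    rewrite (_ : (fun x => (z x - phi x) i 0) = fun x => z x i 0 - phi x i 0).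
      by apply: weak_partialP; exists (fun x => g j x - pd j (fun y => phi y i 0) x).
    by apply/funext => x; rewrite !mxE.
  rewrite le_eqVlt; apply/orP; left; apply/eqP.
  apply: sqint_ae => //.
  - by case: w1 => _ [].
  - have [_ [mw _] _] := w2; apply: eq_measurable_fun mw => x _.
    by rewrite mxE.
  - have := is_weak_partial_unique oU w1 w2; apply: filterS => x e Ux.
    by rewrite e // mxE.
Qed.

Lemma inH10_H10s (U : set (R3 R)) (z : R3 R -> 'cV[R]_3) i : open U ->
  inH10 U z -> H10s U (fun x => z x i 0) (fun j x => wgrad U z x i j).
Proof.
move=> oU hz; apply: inH10_H10s_gen => // j.
have [[_ wz _] _] := hz; have := weak_partialP (wz i j).
by congr is_weak_partial; apply/funext => x; rewrite mxE.
Qed.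

End Norms.

Section Limits.
Context {R : realType}.
Local Notation mu := (@mu3 R).
Implicit Types (U : set (R3 R)) (f g u a b : R3 R -> R).

Lemma sum3 (V : nmodType) (F : 'I_3 -> V) : \sum_(j < 3) F j = F 0 + F 1 + F 2.
Proof.
rewrite !big_ord_recl big_ord0 addr0 addrA.
by congr (_ + F _ + F _); exact: val_inj.
Qed.

Lemma measurable_sqr U f : measurable_fun U f ->
  measurable_fun U (fun x => ((f x) ^+ 2)%:E).
Proof. by move=> mf; apply/measurable_EFinP; exact: measurable_funX. Qed.

Lemma sqintD U f g : measurable U -> measurable_fun U f -> measurable_fun U g ->
  (sqint U (fun x => (f x + g x)%R) <= 2%:E * sqint U f + 2%:E * sqint U g)%E.
Proof.
move=> mU mf mg.
rewrite -(@ge0_integralZl_EFin _ _ _ mu U mU) //; first last.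
- exact: measurable_sqr.
- by move=> x _; rewrite lee_fin sqr_ge0.
rewrite -(@ge0_integralZl_EFin _ _ _ mu U mU) //; first last.
- exact: measurable_sqr.
- by move=> x _; rewrite lee_fin sqr_ge0.
rewrite -(@ge0_integralD _ _ _ mu U mU) //; first last.
- by apply: measurable_funeM; exact: measurable_sqr.
- by move=> x _; rewrite -EFinM lee_fin mulr_ge0 // sqr_ge0.
- by apply: measurable_funeM; exact: measurable_sqr.
- by move=> x _; rewrite -EFinM lee_fin mulr_ge0 // sqr_ge0.
apply: ge0_le_integral_nomeas => x _; first by rewrite lee_fin sqr_ge0.
rewrite -!EFinM -EFinD lee_fin -subr_ge0.
by rewrite (_ : _ - _ = (f x - g x) ^+ 2) ?sqr_ge0 //; ring.
Qed.

Lemma sqintN U f : sqint U (fun x => - f x) = sqint U f.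
Proof. by apply: eq_integral => x _; rewrite sqrrN. Qed.

Lemma L2D U f g : measurable U -> L2 U f -> L2 U g -> L2 U (fun x => f x + g x).
Proof.
move=> mU [mf lf] [mg lg]; split; first exact: measurable_funD.
apply: le_lt_trans (sqintD mU mf mg) _.
by rewrite lte_add_pinfty // lte_mul_pinfty // ?lee_fin.
Qed.

Lemma L2N U f : measurable U -> L2 U f -> L2 U (fun x => - f x).
Proof.
move=> mU [mf lf]; split; last by rewrite sqintN.
by apply: measurableT_comp.
Qed.

Lemma L2B U f g : measurable U -> L2 U f -> L2 U g -> L2 U (fun x => f x - g x).
Proof. by move=> mU lf lg; apply: L2D => //; exact: L2N. Qed.

Lemma L2_subset U U' f : measurable U -> measurable U' -> U' `<=` U -> L2 U f -> L2 U' f.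
Proof.
move=> mU mU' sU [mf lf]; split; first exact: measurable_funS mU sU mf.
apply: le_lt_trans lf; apply: (@ge0_subset_integral _ _ _ mu) => //.
- exact: measurable_sqr.
- by move=> x _; rewrite lee_fin sqr_ge0.
Qed.

Lemma csupp_L2 U f r : measurable U -> continuous f -> csupp r f -> L2 U f.
Proof.
move=> mU cf sf; apply: (@L2_subset setT) => //.
split; first exact: continuous_measurable3.
by have := csupp_even_fin 1 cf sf; rewrite ge0_fin_numE ?sqint_ge0.
Qed.

Lemma test_fun_L2 U U' phi : measurable U -> test_fun U' phi ->
  L2 U phi /\ forall j, L2 U (pd j phi).
Proof.
move=> mU tphi; have [r r0 [sp sdp]] := test_fun_csupp tphi.
split=> [|j]; first by apply: (csupp_L2 mU _ sp); exact: test_fun_continuous tphi.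
by apply: (@csupp_L2 _ _ r mU); [exact: continuous_pd tphi|exact: sdp].
Qed.

Lemma L2_mul_integrable U f g : measurable U -> L2 U f -> L2 U g ->
  mu.-integrable U (EFin \o (fun x => f x * g x)).
Proof.
move=> mU [mf lf] [mg lg].
have isq h : measurable_fun U h -> (sqint U h < +oo)%E ->
    mu.-integrable U (fun x => ((h x) ^+ 2)%:E).
  move=> mh lh; apply/integrableP; split; first exact: measurable_sqr.
  apply: le_lt_trans lh; apply: ge0_le_integral_nomeas => // x _.
  by rewrite /= ger0_norm ?sqr_ge0.
have i2 := @integrableD _ _ _ mu U mU _ _ (isq f mf lf) (isq g mg lg).
apply: (@le_integrable _ _ _ mu U mU _ _ _ _ i2).
  by apply/measurable_EFinP; exact: measurable_funM.
move=> x _; rewrite /= lee_fin [leRHS]ger0_norm ?addr_ge0 ?sqr_ge0 // normrM.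
rewrite -(real_normK (num_real (f x))) -(real_normK (num_real (g x))).
have h0 : 0 <= `|f x| by []; have h1 : 0 <= `|g x| by [].
nra.
Qed.

Lemma H10s_L2 U u (g : 'I_3 -> R3 R -> R) : measurable U -> H10s U u g -> L2 U u /\ forall j, L2 U (g j).
Proof.
move=> mU [mu_ mg h]; have [phi [tphi hu hg]] := h 1 ltr01.
have [lp lpd] := test_fun_L2 mU tphi.
have lt1 f : measurable_fun U f -> (sqint U f <= 1%:E)%E -> L2 U f.
  by move=> mf lf; split=> //; apply: le_lt_trans lf _; rewrite ltry.
split=> [|j].
  have := L2D mU (lt1 _ (measurable_funB mu_ lp.1) hu) lp.
  by congr (L2 _ _); apply/funext => x; rewrite subrK.
have := L2D mU (lt1 _ (measurable_funB (mg j) (lpd j).1) (hg j)) (lpd j).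
by congr (L2 _ _); apply/funext => x; rewrite subrK.
Qed.

Lemma L2_sum_integrable U (a b : 'I_3 -> R3 R -> R) : measurable U ->
  (forall j, L2 U (a j)) -> (forall j, L2 U (b j)) ->
  mu.-integrable U (EFin \o (fun x => \sum_(j < 3) a j x * b j x)).
Proof.
move=> mU la lb.
have h j := L2_mul_integrable mU (la j) (lb j).
have := @integrableD _ _ _ mu U mU _ _ (@integrableD _ _ _ mu U mU _ _ (h 0) (h 1)) (h 2).
congr (integrable _ _ _); apply/funext => x; rewrite /= -!EFinD; congr EFin.
by rewrite sum3.
Qed.

(* A continuous linear functional vanishing on test functions vanishes on their
   limits. *)
Lemma H10s_lim U u a (g b : 'I_3 -> R3 R -> R) : measurable U -> H10s U u g ->
  L2 U a -> (forall j, L2 U (b j)) ->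
  (forall phi, test_fun U phi ->
    \int[mu]_(x in U) (a x * phi x + \sum_(j < 3) b j x * pd j phi x) = 0) ->
  \int[mu]_(x in U) (a x * u x + \sum_(j < 3) b j x * g j x) = 0.
Proof.
move=> mU hug la lb h0; have [lu lg] := H10s_L2 mU hug.
have [_ _ h] := hug.
set I := Rintegral _ _ _.
pose A := fine (sqint U a) + \sum_(j < 3) fine (sqint U (b j)).
have A0 : 0 <= A.
  by rewrite addr_ge0 ?fine_ge0 ?sqint_ge0 // sumr_ge0 // => j _; rewrite fine_ge0 ?sqint_ge0.
(* A sums the squared norms of a and of the three b j; the 4 covers the four approximation
   errors. *)
suff key e : 0 < e -> `|I| <= e * (A + 4).
  apply/eqP; rewrite -normr_le0; apply/ler_addgt0Pr => e e0; rewrite add0r.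
  have A4 : 0 < A + 4 by rewrite ltr_wpDl.
  by have := key (e / (A + 4)); rewrite divfK ?gt_eqF // => -> //; rewrite divr_gt0.
move=> e0; have e20 : 0 < e ^+ 2 by rewrite exprn_gt0.
have [phi [tphi hu hg]] := h _ e20.
have [lp lpd] := test_fun_L2 mU tphi.
have i1 := @integrableD _ _ _ mu U mU _ _ (L2_mul_integrable mU la lu)
  (L2_sum_integrable mU lb lg).
have i2 := @integrableD _ _ _ mu U mU _ _ (L2_mul_integrable mU la lp)
  (L2_sum_integrable mU lb lpd).
have IE : I = \int[mu]_(x in U) ((a x * u x + \sum_(j < 3) b j x * g j x) -
    (a x * phi x + \sum_(j < 3) b j x * pd j phi x)).
  by rewrite (@RintegralB _ _ _ mu U _ _ mU i1 i2) h0 // subr0.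
have i3 := @integrableB _ _ _ mu U mU _ _ i1 i2.
rewrite IE; apply: le_trans (@le_normr_Rintegral _ _ _ mu U _ mU i3) _.
rewrite -lee_fin /Rintegral fineK; last first.
  by apply: (@integrable_fin_num _ _ _ mu U mU); exact: integrable_norm.
(* Young's inequality with weight e. The four squared errors integrate to at most e^2 each, so the
   second half contributes at most 2 e. *)
pose F x := e / 2 * ((a x) ^+ 2 + \sum_(j < 3) (b j x) ^+ 2) +
  e^-1 / 2 * ((u x - phi x) ^+ 2 + \sum_(j < 3) (g j x - pd j phi x) ^+ 2).
apply: (@le_trans _ _ (\int[mu]_(x in U) (F x)%:E)%E).
  apply: ge0_le_integral_nomeas => x _; first by rewrite lee_fin.
  rewrite lee_fin /F.
  have amgm (p q : R) : `|p * q| <= e / 2 * p ^+ 2 + e^-1 / 2 * q ^+ 2.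
    rewrite normrM -(real_normK (num_real p)) -(real_normK (num_real q)) -subr_ge0.
    set P := `|p|; set Q := `|q|.
    have -> : e / 2 * P ^+ 2 + e^-1 / 2 * Q ^+ 2 - P * Q = e / 2 * (P - e^-1 * Q) ^+ 2.
      by field; rewrite gt_eqF.
    by rewrite mulr_ge0 ?sqr_ge0 // divr_ge0 // ltW.
  rewrite (_ : _ - _ = a x * (u x - phi x) +
      \sum_(j < 3) b j x * (g j x - pd j phi x)); last first.
    rewrite [in RHS](eq_bigr (fun j => b j x * g j x - b j x * pd j phi x)).
      by rewrite sumrB mulrBr opprD addrACA.
    by move=> j _; rewrite mulrBr.
  apply: le_trans (ler_normD _ _) _.
  rewrite [leRHS](_ : _ = (e / 2 * a x ^+ 2 + e^-1 / 2 * (u x - phi x) ^+ 2) +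
    \sum_(j < 3) (e / 2 * b j x ^+ 2 + e^-1 / 2 * (g j x - pd j phi x) ^+ 2)); last first.
    by rewrite big_split /= -!mulr_sumr !mulrDr addrACA.
  apply: lerD; first exact: amgm.
  by apply: le_trans (ler_norm_sum _ _ _) _; apply: ler_sum => j _; exact: amgm.
have sq1 f : L2 U f -> (\int[mu]_(x in U) ((f x) ^+ 2)%:E <= (fine (sqint U f))%:E)%E.
  by move=> [mf lf]; rewrite fineK // ge0_fin_numE ?sqint_ge0.
have msum (c : 'I_3 -> R3 R -> R) : (forall j, measurable_fun U (c j)) ->
    measurable_fun U (fun x => \sum_(j < 3) (c j x) ^+ 2).
  move=> mc; rewrite (_ : (fun x => _) = (fun x => (c 0 x) ^+ 2 + (c 1 x) ^+ 2 + (c 2 x) ^+ 2)).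
    by do 2 ?apply: measurable_funD; exact: measurable_funX.
  by apply/funext => x; rewrite sum3.
have half f (c : 'I_3 -> R3 R -> R) k (B : R) : 0 <= k -> measurable_fun U f ->
    (forall j, measurable_fun U (c j)) ->
    (sqint U f + \sum_(j < 3) sqint U (c j) <= B%:E)%E ->
    (\int[mu]_(x in U) (k * ((f x) ^+ 2 + \sum_(j < 3) (c j x) ^+ 2))%:E <= (k * B)%:E)%E.
  move=> k0 mf mc hB.
  rewrite (_ : \int[mu]_(x in U) _ = k%:E * (sqint U f + \sum_(j < 3) sqint U (c j)))%E.
    by rewrite EFinM; apply: lee_wpmul2l => //; rewrite lee_fin.
  under eq_integral do rewrite EFinM.
  rewrite (@ge0_integralZl_EFin _ _ _ mu U mU) //; first last.
  - by apply/measurable_EFinP; apply: measurable_funD; [exact: measurable_funX|exact: msum].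
  - by move=> x _; rewrite lee_fin addr_ge0 ?sqr_ge0 // sumr_ge0 // => j _; exact: sqr_ge0.
  congr (_ * _)%E; under eq_integral do rewrite EFinD -sumEFin.
  rewrite (@ge0_integralD _ _ _ mu U mU) //; first last.
  - by apply: emeasurable_sum => j; exact: measurable_sqr.
  - by move=> x _; apply: sume_ge0 => j _; rewrite lee_fin sqr_ge0.
  - exact: measurable_sqr.
  - by move=> x _; rewrite lee_fin sqr_ge0.
  congr (_ + _)%E; rewrite (@ge0_integral_sum _ _ _ mu U mU) // => [j|j x _].
    exact: measurable_sqr.
  by rewrite lee_fin sqr_ge0.
have e2 : 0 <= e / 2 by rewrite divr_ge0 // ltW.
have e3 : 0 <= e^-1 / 2 by rewrite divr_ge0 // invr_ge0 ltW.
have mdu : measurable_fun U (fun x => u x - phi x) by apply: measurable_funB; [exact: lu.1|exact: lp.1].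
have mdg j : measurable_fun U (fun x => g j x - pd j phi x).
  by apply: measurable_funB; [exact: (lg j).1|exact: (lpd j).1].
have fD (p q : R3 R -> R) : measurable_fun U p -> measurable_fun U q ->
    (forall x, 0 <= p x) -> (forall x, 0 <= q x) ->
    (\int[mu]_(x in U) (p x + q x)%:E = \int[mu]_(x in U) (p x)%:E + \int[mu]_(x in U) (q x)%:E)%E.
  move=> mp mq p0 q0; under eq_integral do rewrite EFinD.
  rewrite (@ge0_integralD _ _ _ mu U mU) //; try by move=> x _; rewrite lee_fin.
  - exact/measurable_EFinP.
  - exact/measurable_EFinP.
have ssq0 (c : 'I_3 -> R3 R -> R) (w : R3 R -> R) x : 0 <= (w x) ^+ 2 + \sum_(j < 3) (c j x) ^+ 2.
  by rewrite addr_ge0 ?sqr_ge0 // sumr_ge0 // => j _; exact: sqr_ge0.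
rewrite /F fD; first last.
- by move=> x; apply: mulr_ge0 => //; exact: (ssq0 (fun j x => g j x - pd j phi x) (fun x => u x - phi x)).
- by move=> x; apply: mulr_ge0.
- apply: measurable_funM => //; apply: measurable_funD; first exact: measurable_funX.
  exact: (msum (fun j x => g j x - pd j phi x)).
- apply: measurable_funM => //; apply: measurable_funD; first exact: (measurable_funX 2 la.1).
  by apply: msum => j; exact: (lb j).1.
apply: (@le_trans _ _ ((e / 2 * A)%:E + (e^-1 / 2 * (4 * e ^+ 2))%:E)%E).
  apply: leeD; apply: half => //.
  - exact: la.1.
  - by move=> j; exact: (lb j).1.
  - rewrite /A EFinD -sumEFin; apply: leeD; first exact: sq1.
    by apply: lee_sum => j _; exact: sq1.
  - rewrite (_ : 4 * e ^+ 2 = e ^+ 2 + \sum_(j < 3) e ^+ 2); last first.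
      by rewrite sumr_const card_ord -mulr_natl; ring.
    rewrite EFinD -sumEFin; apply: leeD => //.
    by apply: lee_sum => j _.
rewrite -EFinD lee_fin.
have -> : e^-1 / 2 * (4 * e ^+ 2) = 2 * e by field; rewrite gt_eqF.
have eA : 0 <= e * A by rewrite mulr_ge0 // ltW.
lra.
Qed.

End Limits.

Section SobolevLimit.
Context {R : realType}.
Local Notation mu := (@mu3 R).
Implicit Types (U : set (R3 R)).

(** The constant is 32 = 2^3 * 4: the square of the sum costs a factor 2, which is then cubed, and
    the cube of a sum of squares costs 4. *)
Lemma pow6_add (a b : R) : 0 <= a -> 0 <= b -> (a + b) ^+ 6 <= 32 * (a ^+ 6 + b ^+ 6).
Proof.
move=> a0 b0.
have h2 : (a + b) ^+ 2 <= 2 * (a ^+ 2 + b ^+ 2).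
  by rewrite -subr_ge0 (_ : _ - _ = (a - b) ^+ 2) ?sqr_ge0 //; ring.
have h3 (p q : R) : 0 <= p -> 0 <= q -> (p + q) ^+ 3 <= 4 * (p ^+ 3 + q ^+ 3).
  move=> p0 q0; rewrite -subr_ge0 (_ : _ - _ = 3 * ((p + q) * (p - q) ^+ 2)); last ring.
  by apply: mulr_ge0 => //; apply: mulr_ge0; [exact: addr_ge0|exact: sqr_ge0].
rewrite (exprM _ 2 3); apply: (@le_trans _ _ ((2 * (a ^+ 2 + b ^+ 2)) ^+ 3)).
  by rewrite ler_pXn2r ?nnegrE ?sqr_ge0 // mulr_ge0 // addr_ge0 ?sqr_ge0.
have h := h3 (a ^+ 2) (b ^+ 2) (sqr_ge0 _) (sqr_ge0 _).
rewrite -!exprM in h; rewrite exprMn.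
apply: (@le_trans _ _ (2 ^+ 3 * (4 * (a ^+ 6 + b ^+ 6)))).
  by apply: ler_wpM2l => //; rewrite exprn_ge0.
by rewrite le_eqVlt; apply/orP; left; apply/eqP; ring.
Qed.

(** Truncation lets a quadratic error control a sixth power: min(t, m)^6 <= m^4 t^2. It is combined
    with min(|a|, m) <= |b| + min(|a - b|, m). *)
Lemma pow6_trunc (a b m : R) : 0 <= m ->
  Num.min `|a| m ^+ 6 <= 32 * (b ^+ 6 + m ^+ 4 * (a - b) ^+ 2).
Proof.
move=> m0; have w0 : 0 <= Num.min `|a - b| m by rewrite le_min m0 normr_ge0.
have h1 : Num.min `|a| m <= `|b| + Num.min `|a - b| m.
  have tri : `|a| <= `|b| + `|a - b|.
    by rewrite -{1}(subrK b a) addrC; exact: ler_normD.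
  have b0 : 0 <= `|b| by [].
  by rewrite [Num.min `|a - b| m]minEle; case: ifP => _; rewrite ge_min ?tri // lerDr b0 orbT.
have h2 : Num.min `|a - b| m ^+ 6 <= m ^+ 4 * (a - b) ^+ 2.
  rewrite (exprD _ 4 2); apply: ler_pM; rewrite ?exprn_ge0 //.
    by rewrite ler_pXn2r ?nnegrE // ge_min lexx orbT.
  by rewrite -(real_normK (num_real (a - b))) ler_pXn2r ?nnegrE // ge_min lexx.
apply: (@le_trans _ _ ((`|b| + Num.min `|a - b| m) ^+ 6)).
  rewrite ler_pXn2r ?nnegrE ?addr_ge0 // le_min normr_ge0 //.
apply: le_trans (pow6_add _ w0) _ => //.
rewrite ler_wpM2l // lerD // (exprM `|b| 2 3) real_normK ?num_real // -exprM //.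
Qed.

Lemma sqint_pd_test U phi j : test_fun U phi -> sqint U (pd j phi) = sqint setT (pd j phi).
Proof.
move=> tphi; rewrite /sqint [RHS](@integral_sub_support _ setT U) //.
by move=> x _ nx; have [_ /(_ (e_ R j))] := test_fun_out tphi nx; rewrite /pd => ->; rewrite expr0n.
Qed.

(** Approximation in L^2 gives no control on sixth powers, so u is first truncated at level n, with
    an approximant depending on n, and n is then sent to infinity by monotone convergence. In the
    constant, 16^3 comes from the inequality for test functions and 4^3 from bounding their squared
    gradients by 4 K. *)
Lemma H10s_sobolev : exists2 C : R, 0 < C & forall U u g K, measurable U ->
  H10s U u g -> 0 < K -> (forall j, (sqint U (g j) <= K%:E)%E) ->
  (\int[mu]_(x in U) (u x ^+ 6)%:E <= (C * K ^+ 3)%:E)%E.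
Proof.
exists (32 * (16 ^+ 3 * 4 ^+ 3 + 1)).
  by rewrite mulr_gt0 // addr_gt0 // mulr_gt0 // exprn_gt0.
move=> U u g K mU hug K0 hgK; have [mu_ mg h] := hug.
have trunc (n : nat) : (\int[mu]_(x in U) (Num.min `|u x| n%:R ^+ 6)%:E <=
    (32 * (16 ^+ 3 * 4 ^+ 3 + 1) * K ^+ 3)%:E)%E.
  (* The first bound keeps the squared gradient norms below 2 K + 2 d <= 4 K; the second makes n^4
     d, the price of the truncation, at most K^3. *)
  pose d := Num.min K (K ^+ 3 / n.+1%:R ^+ 4).
  have n40 : 0 < (n.+1%:R : R) ^+ 4 by rewrite exprn_gt0.
  have d0 : 0 < d by rewrite lt_min K0 divr_gt0 // exprn_gt0.
  have [phi [tphi hu hgp]] := h d d0.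
  have [lp lpd] := test_fun_L2 mU tphi.
  have gp j : (sqint setT (pd j phi) <= (4 * K)%:E)%E.
    rewrite -(sqint_pd_test j tphi).
    rewrite (_ : pd j phi = fun x => g j x + - (g j x - pd j phi x)); last first.
      by apply/funext => x; rewrite opprB addrC subrK.
    apply: le_trans (@sqintD _ U _ _ mU (mg j) _) _.
      by apply: measurableT_comp => //; apply: measurable_funB => //; exact: (lpd j).1.
    rewrite sqintN; apply: (@le_trans _ _ (2%:E * K%:E + 2%:E * K%:E)%E).
      apply: leeD; apply: lee_wpmul2l; rewrite ?lee_fin //.
      by apply: le_trans (hgp j) _; rewrite lee_fin ge_min lexx.
    by rewrite -EFinM -EFinD lee_fin; lra.
  have p6 : (\int[mu]_(x in U) (phi x ^+ 6)%:E <= (16 ^+ 3 * (4 * K) ^+ 3)%:E)%E.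
    apply: (@le_trans _ _ (\int[mu]_x (phi x ^+ 6)%:E)%E).
      rewrite [leRHS](@integral_sub_support _ setT U) //.
      by move=> x _ nx; have [-> _] := test_fun_out tphi nx; rewrite expr0n.
    apply: le_trans (sobolev_test tphi) _.
    rewrite [leRHS](EFinM (16 ^+ 3)); apply: lee_wpmul2l; first by rewrite lee_fin exprn_ge0.
    rewrite (_ : (4 * K) ^+ 3 = 4 * K * (4 * K) * (4 * K)); last by ring.
    rewrite (EFinM (4 * K * (4 * K))) (EFinM (4 * K)).
    apply: lee_pmul; [|exact: sqint_ge0| |exact: gp].
      by apply: mule_ge0; exact: sqint_ge0.
    by apply: lee_pmul; [exact: sqint_ge0|exact: sqint_ge0|exact: gp|exact: gp].
  have m4 : n%:R ^+ 4 * d <= K ^+ 3.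
    apply: (@le_trans _ _ (n.+1%:R ^+ 4 * d)).
      by rewrite ler_wpM2r ?(ltW d0) // ler_pXn2r ?nnegrE ?ler0n // ler_nat.
    by rewrite mulrC -ler_pdivlMr // ge_min lexx orbT.
  apply: (@le_trans _ _ (\int[mu]_(x in U) (32%:E * ((phi x ^+ 6)%:E +
      (n%:R ^+ 4)%:E * ((u x - phi x) ^+ 2)%:E)))%E).
    apply: ge0_le_integral_nomeas => x _.
      by rewrite lee_fin exprn_ge0 // le_min normr_ge0 ler0n.
    by rewrite -!EFinM lee_fin pow6_trunc.
  have p60 x : 0 <= phi x ^+ 6 by rewrite (exprM _ 2 3) exprn_ge0 ?sqr_ge0.
  have n0 : 0 <= (n%:R : R) ^+ 4 by rewrite exprn_ge0.
  have mw : measurable_fun U (fun x => ((u x - phi x) ^+ 2)%:E).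
    by apply: measurable_sqr; apply: measurable_funB => //; exact: lp.1.
  have mp : measurable_fun U (fun x => (phi x ^+ 6)%:E).
    by apply/measurable_EFinP; exact: measurable_funX lp.1.
  rewrite (@ge0_integralZl_EFin _ _ _ mu U mU) //; first last.
  - by apply: emeasurable_funD => //; exact: measurable_funeM.
  - by move=> x _; apply: adde_ge0; [|apply: mule_ge0]; rewrite lee_fin ?sqr_ge0.
  rewrite (@ge0_integralD _ _ _ mu U mU) //; first last.
  - exact: measurable_funeM.
  - by move=> x _; apply: mule_ge0; rewrite lee_fin ?sqr_ge0.
  - by move=> x _; rewrite lee_fin.
  rewrite (@ge0_integralZl_EFin _ _ _ mu U mU) //; last first.
    by move=> x _; rewrite lee_fin sqr_ge0.
  rewrite -(mulrA 32) [leRHS](EFinM 32); apply: lee_wpmul2l; first by rewrite lee_fin.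
  rewrite (mulrDl _ 1) mul1r EFinD; apply: leeD.
    by apply: le_trans p6 _; rewrite lee_fin exprMn mulrA.
  apply: (@le_trans _ _ ((n%:R ^+ 4)%:E * d%:E)%E).
    by apply: lee_wpmul2l; rewrite ?lee_fin.
  by rewrite -EFinM lee_fin.
pose F n x := (Num.min `|u x| n%:R ^+ 6)%:E.
have mF n : measurable_fun U (F n).
  apply/measurable_EFinP; apply: measurable_funX; apply: measurable_minr => //.
  exact: measurableT_comp.
have F0 n x : U x -> (0 <= F n x)%E.
  by move=> _; rewrite lee_fin exprn_ge0 // le_min normr_ge0 ler0n.
have ndF x : U x -> nondecreasing_seq (F^~ x).
  move=> _ n m nm; rewrite lee_fin ler_pXn2r ?nnegrE ?le_min ?normr_ge0 ?ler0n //.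
  by rewrite ge_min lexx /= ge_min ler_nat nm orbT.
have := @cvg_monotone_convergence _ _ _ mu U mU F mF F0 ndF.
rewrite (_ : (\int[mu]_(x in U) _)%E = (\int[mu]_(x in U) (u x ^+ 6)%:E)%E); last first.
  apply: eq_integral => x _; apply/cvg_lim => //.
  apply: cvg_near_cst; near=> n; rewrite /F min_l.
    by rewrite (exprM `|u x| 2 3) real_normK ?num_real // -exprM.
  by near: n; exact: nbhs_infty_ger.
move=> cv; apply: (cvge_to_le cv); apply: nearW => n.
exact: trunc.
Unshelve. all: by end_near. Qed.

End SobolevLimit.

(** * Lipschitz estimates *)

Section Lipschitz.
Context {R : realType}.
Local Notation mu := (@mu3 R).
Local Notation leb := (@lebesgue_measure R).

Lemma measurable_shift (c : R3 R) : measurable_fun [set: R3 R] (fun x => x + c).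
Proof.
rewrite (_ : (fun x => x + c) = aff c 1); first exact: measurable_aff.
by apply/funext => x; rewrite affE scale1r addrC.
Qed.

Lemma ge0_integral_shift (c : R3 R) (f : R3 R -> \bar R) :
  measurable_fun setT f -> (forall x, 0 <= f x)%E ->
  (\int[mu]_y f (y + c)%R = \int[mu]_x f x)%E.
Proof.
move=> mf f0; have := ge0_integral_aff c (l := 1) ltr01 mf f0.
rewrite invr1 expr1n mul1e => <-; apply: eq_integral => x _.
by rewrite affE scale1r addrC.
Qed.

Lemma mu3_shift (c : R3 R) (A : set (R3 R)) : measurable A ->
  mu [set x | A (x + c)] = mu A.
Proof.
move=> mA.
have mA' : measurable [set x | A (x + c)].
  by have := @measurable_shift c measurableT A mA; rewrite setTI.
have e B : measurable B -> (\int[mu]_x (\1_B x)%:E = mu B)%E.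
  by move=> mB; have := @integral_indic _ _ _ mu _ measurableT B mB; rewrite setIT; exact.
rewrite -(e _ mA') -(e _ mA) -(@ge0_integral_shift c (fun x => (\1_A x)%:E)) //.
by apply/measurable_EFinP; exact: measurable_indic.
Qed.

Lemma ae_shift (P : R3 R -> Prop) (c : R3 R) : {ae mu, forall x, P x} ->
  {ae mu, forall x, P (x + c)}.
Proof.
move=> [N [mN N0 PN]]; exists [set x | N (x + c)]; split.
- by have := @measurable_shift c measurableT N mN; rewrite setTI.
- by rewrite mu3_shift.
- by move=> x /= nP; apply: PN.
Qed.

Lemma is_derive_ray (f : R3 R -> R) (y w : R3 R) (s : R) : Ck 1 f ->
  is_derive s 1 (fun s : R => f (s *: w + y)) ('D_w f (s *: w + y)).
Proof.
move=> hf; have [fd _] := Ck_is_derive (s *: w + y) w hf.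
have E2 : (fun h : R => h^-1 *: (((fun s : R => f (s *: w + y)) \o shift s) (h *: 1) -
      f (s *: w + y))) =
    (fun h : R => h^-1 *: ((f \o shift (s *: w + y)) (h *: w) - f (s *: w + y))).
  by apply/funext => h /=; rewrite scaler1 scalerDl addrA.
by apply: DeriveDef; rewrite ?/derivable ?/derive E2.
Qed.

(** An approximant need not inherit the bound M on the gradient, so the excess of its derivative
    over M is kept as an integral along the segment and shown to be small on average later. *)
Lemma increment_bound (phi : R3 R -> R) (w y : R3 R) (t M : R) : Ck 1 phi -> 0 < t ->
  (`|phi (t *: w + y) - phi y|%:E <=
   (t * M)%:E + \int[leb]_(s in `[0%R, t]) (Num.max (`|'D_w phi (s *: w + y)| - M) 0)%:E)%E.
Proof.
move=> hphi t0.
have cd : continuous (fun s : R => 'D_w phi (s *: w + y)).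
  move=> s; apply: (@continuous_comp _ _ _ (fun s : R => s *: w + y) (fun x => 'D_w phi x));
    last exact: (Ck_cont (Ck_derive w hphi)).
  by apply: cvgD; [apply: cvgZr_tmp; exact: cvg_id|exact: cvg_cst].
have md : measurable_fun [set: R] (fun s : R => 'D_w phi (s *: w + y)).
  exact: continuous_measurable_fun.
have -> : phi (t *: w + y) - phi y = fine (\int[leb]_(s in `[0%R, t]) ('D_w phi (s *: w + y))%:E)%E.
  rewrite (FTC_line (fun s : R => is_derive_ray y w s hphi) cd t0) /=.
  by rewrite scale0r add0r.
have ig : leb.-integrable `[0%R, t] (EFin \o (fun s : R => 'D_w phi (s *: w + y))).
  apply: continuous_compact_integrable; first exact: segment_compact.
  exact: continuous_subspaceT.
rewrite EFin_normr_Rintegral //.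
apply: (@le_trans _ _ (\int[leb]_(s in `[0%R, t]) `|'D_w phi (s *: w + y)|%:E)%E).
  by apply: le_abse_integral => //; exact/measurable_EFinP/measurable_funTS.
have mmax : measurable_fun `[0%R, t] (fun s : R => Num.max (`|'D_w phi (s *: w + y)| - M) 0).
  apply: measurable_maxr => //; apply: measurable_funB => //.
  by apply: measurableT_comp => //; exact: measurable_funTS.
have tM : (t * M)%:E = (\int[leb]_(s in `[0%R, t]) M%:E)%E.
  have L : leb `[0%R, t]%classic = t%:E.
    by rewrite lebesgue_measure_itv /= lte_fin t0 oppr0 adde0.
  apply: esym; etransitivity; first exact: (@integral_cst _ _ _ leb).
  by etransitivity; [exact: (congr1 (fun z => M%:E * z)%E L)|rewrite -EFinM mulrC].
rewrite tM.
have iM : leb.-integrable `[0%R, t] (fun=> M%:E).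
  apply: continuous_compact_integrable; first exact: segment_compact.
  by apply: continuous_subspaceT => x; exact: cvg_cst.
have imax : leb.-integrable `[0%R, t]
    (EFin \o (fun s : R => Num.max (`|'D_w phi (s *: w + y)| - M) 0)).
  apply: continuous_compact_integrable; first exact: segment_compact.
  have c1 : continuous (fun s : R => `|'D_w phi (s *: w + y)| - M : R^o).
    by move=> s; apply: cvgB; [apply: cvg_norm; exact: cd|exact: cvg_cst].
  have c0 : continuous ((fun _ : R => 0 : R^o) : R -> R^o) by move=> s; exact: cvg_cst.
  by apply: continuous_subspaceT => s; exact: (continuous_max (c1 s) (c0 s)).
rewrite -(@integralD _ _ _ leb _ _ _ _ iM imax) //.
apply: (@le_integral _ _ _ leb) => //.
- exact: integrable_abse ig.
- exact: (@integrableD _ _ _ leb _ _ _ _ iM imax).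
move=> s _; rewrite /= -EFinD lee_fin -lerBlDl le_max lexx //.
Qed.

Section OneDirection.
Variables (U : set (R3 R)) (u : R3 R -> R) (g : 'I_3 -> R3 R -> R) (M : R).
Hypotheses (mU : measurable U) (finU : (mu U < +oo)%E) (M0 : 0 <= M).
Hypothesis hug : H10s U u g.
Hypothesis hgM : forall j, {ae mu, forall x, U x -> `|g j x| <= M}.

Definition zext (V : set (R3 R)) (v : R3 R -> R) (x : R3 R) : R :=
  if x \in V then v x else 0.

Lemma measurable_zext (V : set (R3 R)) v : measurable V -> measurable_fun V v ->
  measurable_fun setT (zext V v).
Proof. by move=> mV mv; have := (measurable_restrictT v mV).1 mv. Qed.

(** Integrate |f| <= e + f^2 / e: on a set of finite measure, smallness in L^2 becomes smallness in
    L^1. *)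
Lemma absint_le (f : R3 R -> R) (e : R) : measurable_fun U f -> 0 < e ->
  (sqint U f <= (e ^+ 2)%:E)%E ->
  (\int[mu]_(x in U) `|f x|%:E <= (e * (fine (mu U) + 1))%:E)%E.
Proof.
move=> mf e0 fe.
apply: (@le_trans _ _ (\int[mu]_(x in U) (e%:E + (e^-1)%:E * ((f x) ^+ 2)%:E))%E).
  apply: ge0_le_integral_nomeas => x _; first by rewrite lee_fin.
  rewrite -EFinM -EFinD lee_fin -(real_normK (num_real (f x))).
  have := sqr_ge0 (`|f x| - e); set w := `|f x| => h.
  rewrite -(ler_pM2l e0) mulrDr mulrA divff ?gt_eqF // mul1r.
  have w0 : 0 <= w by exact: normr_ge0.
  nra.
have ei : 0 <= e^-1 by rewrite invr_ge0 ltW.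
rewrite (@ge0_integralD _ _ _ mu U mU) //; first last.
- by apply: measurable_funeM; exact: measurable_sqr.
- by move=> x _; apply: mule_ge0; rewrite lee_fin ?sqr_ge0.
- by move=> x _; rewrite lee_fin ltW.
rewrite (@ge0_integralZl_EFin _ _ _ mu U mU) //; first last.
- exact: measurable_sqr.
- by move=> x _; rewrite lee_fin sqr_ge0.
have Icst : (\int[mu]_(x in U) e%:E = e%:E * (fine (mu U))%:E)%E.
  by rewrite fineK ?ge0_fin_numE //; exact: (@integral_cst _ _ _ mu U mU).
rewrite Icst.
apply: (@le_trans _ _ (e%:E * (fine (mu U))%:E + (e^-1)%:E * (e ^+ 2)%:E)%E).
  by apply: leeD; [exact: lexx|apply: lee_wpmul2l; [rewrite lee_fin|exact: fe]].
rewrite -!EFinM -EFinD lee_fin expr2 mulrA mulVf ?gt_eqF // mul1r.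
by rewrite mulrDr mulr1.
Qed.

(** The positive part F of the excess over t M is shown to have integral 0. It is compared with the
    increment of an approximant phi, smooth across the boundary of U: the two values of v - phi and
    the excess of the derivative of phi are all of order e in L^1. *)
Lemma zext_increment_pos (j : 'I_3) (t : R) : 0 < t ->
  {ae mu, forall y, `|zext U u (t *: e_ R j + y) - zext U u y| <= t * M}.
Proof.
move=> t0; set w := e_ R j; set v := zext U u.
have [mu_ mg happ] := hug.
have mv : measurable_fun setT v by exact: measurable_zext.
have mshift c : measurable_fun [set: R3 R] (fun y => c + y).
  by have := measurable_shift c; apply: eq_measurable_fun => x _; rewrite addrC.
pose F y := Num.max (`|v (t *: w + y) - v y| - t * M) 0.
have mF : measurable_fun setT (EFin \o F).
  apply/measurable_EFinP; apply: measurable_maxr => //; apply: measurable_funB => //.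
  apply: measurableT_comp => //; apply: measurable_funB => //.
  exact: (measurableT_comp mv (mshift _)).
have F0 y : (0 <= (F y)%:E)%E by rewrite lee_fin le_max lexx orbT.
suff IF : (\int[mu]_y (F y)%:E = 0)%E.
  have : ae_eq mu setT (EFin \o F) (cst 0%E).
    apply/(@ae_eq_integral_abs _ _ _ mu setT measurableT _ mF).
    by rewrite -[RHS]IF; apply: eq_integral => x _; exact: (gee0_abs (F0 x)).
  apply: filterS => y /(_ Logic.I) [] /eqP; rewrite eq_le => /andP[+ _].
  by rewrite ge_max lexx andbT subr_le0.
pose m := fine (mu U) + 1.
have m0 : 0 < m by rewrite ltr_wpDl // fine_ge0.
suff key e : 0 < e -> (\int[mu]_y (F y)%:E <= (e * (m * (2 + t)))%:E)%E.
  apply/eqP; rewrite eq_le integral_ge0 // andbT; apply/lee_addgt0Pr => e e0.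
  have mt0 : 0 < m * (2 + t) by rewrite mulr_gt0 // addr_gt0.
  by have := key (e / (m * (2 + t))); rewrite divfK ?gt_eqF // add0e => -> //; rewrite divr_gt0.
move=> e0; have e20 : 0 < e ^+ 2 by rewrite exprn_gt0.
have [phi [tphi hu hg]] := happ _ e20.
have cphi := test_fun_continuous tphi; have cpd := continuous_pd (j := j) tphi.
have mphi := continuous_measurable3 cphi.
have mpd := continuous_measurable3 cpd.
have h1 := test_fun_Ck 1 tphi.
pose D1 y := `|v y - phi y|.
(* Because |g j| <= M almost everywhere, this excess is at most |g j - pd j phi| there, hence small
   in L^1; outside U it is 0. *)
pose rr y := Num.max (`|pd j phi y| - M) 0.
have mD1 : measurable_fun setT (EFin \o D1).
  by apply/measurable_EFinP; apply: measurableT_comp => //; exact: measurable_funB.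
have mrr : measurable_fun setT rr.
  apply: measurable_maxr => //; apply: measurable_funB => //.
  exact: measurableT_comp.
have rr0 y : 0 <= rr y by rewrite le_max lexx orbT.
have D10 y : 0 <= D1 y by exact: normr_ge0.
have ID1 : (\int[mu]_y (D1 y)%:E <= (e * m)%:E)%E.
  rewrite (@integral_sub_support _ setT U) //; last first.
    move=> x _ nU; rewrite /D1 /v /zext memNset //.
    by have [-> _] := test_fun_out tphi nU; rewrite subrr normr0.
  rewrite (_ : (\int[mu]_(x in U) _)%E = (\int[mu]_(x in U) `|u x - phi x|%:E)%E).
    by apply: absint_le => //; apply: measurable_funB => //; exact: measurable_funTS.
  by apply: eq_integral => x xU; rewrite /D1 /v /zext xU.
have Irr : (\int[mu]_y (rr y)%:E <= (e * m)%:E)%E.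
  rewrite (@integral_sub_support _ setT U) //; last first.
    move=> x _ nU; rewrite /rr; have [_ /(_ w)] := test_fun_out tphi nU.
    by rewrite /pd -/w => ->; rewrite normr0 sub0r max_r // oppr_le0.
  have mgpd : measurable_fun U (fun x => g j x - pd j phi x).
    by apply: measurable_funB => //; exact: measurable_funTS.
  apply: le_trans (absint_le mgpd e0 (hg j)).
  apply: (@ae_ge0_le_integral _ _ _ mu U mU).
  - by move=> x _; rewrite lee_fin.
  - by apply/measurable_EFinP; exact: measurable_funTS.
  - by move=> x _; rewrite lee_fin.
  - by apply/measurable_EFinP; exact: measurableT_comp.
  apply: filterS (hgM j) => x h Ux; have := h Ux; rewrite lee_fin /rr ge_max normr_ge0 andbT.
  move=> gM; rewrite lerBlDl; apply: le_trans (lerD gM (lexx _)).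
  by have := ler_normB (g j x) (g j x - pd j phi x); rewrite subKr.
pose J y := (\int[leb]_(s in `[0%R, t]) (rr (s *: w + y))%:E)%E.
pose H (z : R3 R * R) := (rr (z.2 *: w + z.1) * \1_(`[0%R, t]%classic) z.2)%:E.
have mline : measurable_fun setT (fun z : R3 R * R => z.2 *: w + z.1).
  rewrite (_ : (fun z => _) = fun z : R3 R * R => (z.2 * co 0 w + co 0 z.1,
      z.2 * co 1 w + co 1 z.1, z.2 * co 2 w + co 2 z.1)); last first.
    by apply/funext => -[[[a b] c] s]; rewrite !co0 !co1 !co2; case: (w) => [[]].
  by do 2 ?apply: measurable_fun_pair; apply: measurable_funD;
    [exact: measurable_funM|apply: (measurableT_comp (@measurable_co R _))|
     exact: measurable_funM|apply: (measurableT_comp (@measurable_co R _))|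
     exact: measurable_funM|apply: (measurableT_comp (@measurable_co R _))].
have mH : measurable_fun setT H.
  apply/measurable_EFinP; apply: measurable_funM; first exact: measurableT_comp.
  have m1 : measurable_fun [set: R] (\1_(`[0%R, t]%classic) : R -> R).
    exact: measurable_indic.
  exact: (measurableT_comp m1 (@measurable_snd _ _ _ _)).
have H0 z : (0 <= H z)%E by rewrite lee_fin mulr_ge0 // indicE.
have JH y : J y = (\int[leb]_s H (y, s))%E.
  rewrite /J integral_mkcond; apply: eq_integral => s _.
  by rewrite patchE /H /= indicE; case: ifPn => _; rewrite ?mulr1 ?mulr0.
have mJ : measurable_fun setT J.
  rewrite (_ : J = fun y => \int[leb]_s H (y, s))%E; last exact/funext.
  exact: (@measurable_fun_fubini_tonelli_F _ _ _ _ _ leb H).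
have J0 y : (0 <= J y)%E by apply: integral_ge0 => s _; rewrite lee_fin.
(* Tonelli exchanges the point y and the position s on the segment; every translate of rr has the
   same integral, and the segment has length t. *)
have IJ : (\int[mu]_y J y = t%:E * \int[mu]_y (rr y)%:E)%E.
  under eq_integral do rewrite JH.
  etransitivity.
    exact: (@fubini_tonelli _ _ _ _ _ (sfprod (sfprod leb leb) leb) leb H mH H0).
  transitivity (\int[leb]_s ((\1_(`[0%R, t]%classic) s)%:E * \int[mu]_y (rr y)%:E))%E.
    apply: eq_integral => s _; rewrite /fubini_G /H /=.
    transitivity (\int[mu]_y ((\1_(`[0%R, t]%classic) s)%:E * (rr (s *: w + y))%:E))%E.
      by apply: eq_integral => y _; rewrite -EFinM mulrC.
    etransitivity.
      apply: (@ge0_integralZl_EFin _ _ _ mu setT measurableT).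
      - by move=> y _; rewrite lee_fin.
      - apply/measurable_EFinP; exact: (measurableT_comp mrr (mshift _)).
      - by rewrite indicE.
    apply: (congr1 (fun z => (\1_(`[0%R, t]%classic) s)%:E * z)%E).
    have mrrE : measurable_fun setT (EFin \o rr) by exact/measurable_EFinP.
    have rrE0 y : (0 <= (EFin \o rr) y)%E by rewrite lee_fin.
    etransitivity; last exact: (ge0_integral_shift (s *: w) mrrE rrE0).
    by apply: eq_integral => y _; rewrite /= addrC.
  have i0 : (0 <= \int[mu]_y (rr y)%:E)%E by apply: integral_ge0 => y _; rewrite lee_fin.
  have L : (\int[leb]_s (\1_(`[0%R, t]%classic) s)%:E = t%:E)%E.
    etransitivity; first exact: (@integral_indic _ _ _ leb _ measurableT _ (@measurable_itv _ `[0%R, t])).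
    have L0 : leb `[0%R, t]%classic = t%:E.
      by rewrite lebesgue_measure_itv /= lte_fin t0 oppr0 adde0.
    by rewrite setIT; exact: L0.
  etransitivity; last exact: (congr1 (fun z => z * \int[mu]_y (rr y)%:E)%E L).
  apply: (@ge0_integralZr _ _ _ leb _ measurableT).
  - by apply/measurable_EFinP; exact: measurable_indic.
  - by move=> s _; rewrite lee_fin indicE.
  - exact: i0.
have D1E0 y : (0 <= (EFin \o D1) y)%E by rewrite lee_fin.
have mD1s : measurable_fun setT (fun y => (D1 (t *: w + y))%:E).
  exact: (measurableT_comp mD1 (mshift _)).
apply: (@le_trans _ _ (\int[mu]_y ((D1 (t *: w + y))%:E + ((D1 y)%:E + J y)))%E).
  apply: ge0_le_integral_nomeas => y _ //.
  have := increment_bound w y M h1 t0; rewrite -/(J y).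
  case: (J y) (J0 y) => [r| |] //; last by rewrite !addey ?leey // ltNye.
  rewrite -?EFinD ?lee_fin => r0 hinc; rewrite -?EFinD ?lee_fin.
  rewrite /F ge_max; apply/andP; split; last by rewrite !addr_ge0.
  rewrite lerBlDr.
  have : `|v (t *: w + y) - v y| <= D1 (t *: w + y) + D1 y + `|phi (t *: w + y) - phi y|.
    rewrite /D1 (distrC (v y)).
    rewrite (_ : v _ - v y = (v (t *: w + y) - phi (t *: w + y)) + (phi y - v y) +
       (phi (t *: w + y) - phi y)); last by ring.
    by apply: le_trans (ler_normD _ _) _; rewrite lerD2r; exact: ler_normD.
  lra.
rewrite (@ge0_integralD _ _ _ mu setT measurableT) //; first last.
- exact: emeasurable_funD.
- by move=> y _; rewrite adde_ge0 // lee_fin.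
- by move=> y _; rewrite lee_fin.
rewrite (@ge0_integralD _ _ _ mu setT measurableT) //; last by move=> y _; rewrite lee_fin.
rewrite IJ (_ : (\int[mu]_y (D1 (t *: w + y))%:E = \int[mu]_y (D1 y)%:E)%E); last first.
  etransitivity; last exact: (ge0_integral_shift (t *: w) mD1 D1E0).
  by apply: eq_integral => y _; rewrite /= addrC.
apply: (@le_trans _ _ ((e * m)%:E + ((e * m)%:E + t%:E * (e * m)%:E))%E).
  apply: leeD => //; apply: leeD => //; apply: lee_wpmul2l => //.
  by rewrite lee_fin ltW.
by rewrite -EFinM -!EFinD lee_fin /m; lra.
Qed.

End OneDirection.

End Lipschitz.

(** * Lipschitz bounds in all directions and comparison of averages *)

Section Comparison.
Context {R : realType}.
Local Notation mu := (@mu3 R).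

Definition l1 (h : R3 R) : R := `|co 0 h| + `|co 1 h| + `|co 2 h|.

(** The shift h is decomposed into three moves along the axes; a move by a negative t is a positive
    one read from the shifted point. *)
Lemma zext_lipschitz (U : set (R3 R)) u g (M : R) (h : R3 R) : measurable U ->
  (mu U < +oo)%E -> 0 <= M -> H10s U u g ->
  (forall j, {ae mu, forall x, U x -> `|g j x| <= M}) ->
  {ae mu, forall y, `|zext U u (h + y) - zext U u y| <= M * l1 h}.
Proof.
move=> mU fU M0 hug hg.
have one (j : 'I_3) (t : R) :
    {ae mu, forall y, `|zext U u (t *: e_ R j + y) - zext U u y| <= `|t| * M}.
  have [t0|t0|->] := ltgtP t 0; last first.
  - by apply: nearW => y; rewrite scale0r add0r subrr !normr0 mul0r.
  - by rewrite gtr0_norm //; exact: (zext_increment_pos mU fU M0 hug hg j t0).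
  - have t0' : 0 < - t by rewrite oppr_gt0.
    have := ae_shift (t *: e_ R j) (zext_increment_pos mU fU M0 hug hg j t0').
    apply: filterS => y; rewrite distrC (ltr0_norm t0).
    rewrite (_ : - t *: e_ R j + (y + t *: e_ R j) = y); last by rewrite scaleNr addrC addrK.
    by rewrite (addrC y).
have hE : h = co 0 h *: e_ R 0 + (co 1 h *: e_ R 1 + co 2 h *: e_ R 2).
  apply: co_inj => i; rewrite !coD !coZ !co_e.
  by move: i; apply: ord3P; rewrite /= ?mulr1 ?mulr0 ?addr0 ?add0r.
have a2 := one 2 (co 2 h).
have a1 := ae_shift (co 2 h *: e_ R 2) (one 1 (co 1 h)).
have a0 := ae_shift (co 1 h *: e_ R 1 + co 2 h *: e_ R 2) (one 0 (co 0 h)).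
apply: filterS3 a0 a1 a2 => y b0 b1 b2.
rewrite {1}hE; set y1 := co 2 h *: e_ R 2 + y in b2 *.
set y2 := co 1 h *: e_ R 1 + y1.
rewrite (_ : y + co 2 h *: e_ R 2 = y1) in b1; last by rewrite addrC.
rewrite (_ : y + (_ + _) = y2) in b0; last by rewrite addrC -addrA.
rewrite -!addrA -/y1 -/y2.
rewrite (_ : _ - _ = (zext U u (co 0 h *: e_ R 0 + y2) - zext U u y2) +
  (zext U u y2 - zext U u y1) + (zext U u y1 - zext U u y)); last by ring.
rewrite /l1 mulrDr mulrDr ![M * _]mulrC.
apply: le_trans (ler_normD _ _) (lerD _ b2).
by apply: le_trans (ler_normD _ _) (lerD b0 b1).
Qed.

(** The constant is 162 = 6 * 27: the sums S and S' of squares differ by at most 3 * 2 B D, and S^2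
    + S S' + S'^2 is at most 3 (3 B^2)^2 = 27 B^4. It is applied to |v|^6. *)
Lemma sumsq3_cube_lipschitz (B D : R) (a b : 'I_3 -> R) : 0 <= B ->
  (forall i, `|a i| <= B) -> (forall i, `|b i| <= B) ->
  (forall i, `|a i - b i| <= D) ->
  `|(\sum_i (a i) ^+ 2) ^+ 3 - (\sum_i (b i) ^+ 2) ^+ 3| <= 162 * B ^+ 5 * D.
Proof.
move=> B0 ha hb hab.
set S := \sum_i (a i) ^+ 2; set S' := \sum_i (b i) ^+ 2.
have sq (c : 'I_3 -> R) : (forall i, `|c i| <= B) ->
    0 <= \sum_i (c i) ^+ 2 <= 3 * B ^+ 2.
  move=> hc; apply/andP; split; first by apply: sumr_ge0 => i _; exact: sqr_ge0.
  have -> : 3 * B ^+ 2 = \sum_(i < 3) B ^+ 2.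
    by rewrite sumr_const card_ord mulr_natl.
  apply: ler_sum => i _; rewrite -(real_normK (num_real (c i))).
  by rewrite ler_pXn2r ?nnegrE.
have /andP[S0 S1] := sq a ha; have /andP[S0' S1'] := sq b hb.
have dS : `|S - S'| <= 6 * B * D.
  rewrite -sumrB; apply: le_trans (ler_norm_sum _ _ _) _.
  have -> : 6 * B * D = \sum_(i < 3) D * (2 * B).
    by rewrite sumr_const card_ord -[RHS]mulr_natl; ring.
  apply: ler_sum => i _; rewrite subr_sqr normrM; apply: ler_pM => //.
  by apply: le_trans (ler_normD _ _) _; rewrite mulr2n mulrDl mul1r; exact: lerD.
have -> : S ^+ 3 - S' ^+ 3 = (S - S') * (S ^+ 2 + S * S' + S' ^+ 2) by ring.
rewrite normrM.
have -> : 162 * B ^+ 5 * D = 6 * B * D * (3 * (3 * B ^+ 2) ^+ 2) by ring.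
apply: ler_pM => //.
rewrite ger0_norm; last by rewrite !addr_ge0 ?sqr_ge0 ?mulr_ge0.
set C := 3 * B ^+ 2 in S1 S1' *.
have C0 : 0 <= C by exact: le_trans S0 S1.
have q1 : S ^+ 2 <= C ^+ 2 by rewrite ler_pXn2r ?nnegrE.
have q2 : S' ^+ 2 <= C ^+ 2 by rewrite ler_pXn2r ?nnegrE.
have q3 : S * S' <= C ^+ 2 by rewrite expr2; exact: ler_pM.
lra.
Qed.

Lemma mu_indic (A : set (R3 R)) : measurable A ->
  (\int[mu]_x (\1_A x)%:E = mu A)%E.
Proof. by move=> mA; have := @integral_indic _ _ _ mu _ measurableT A mA; rewrite setIT; exact. Qed.

(* Integrating p (h + y) - p y over y in T and h + y in Q, first in y, the bound
   is only needed for almost every y at each fixed h. *)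
Lemma average_comparison (p : R3 R -> R) (L d : R) (T Q : set (R3 R)) :
  measurable_fun setT p -> (forall x, 0 <= p x) -> 0 <= L * d ->
  (forall h, {ae mu, forall y, `|p (h + y) - p y| <= L * l1 h}) -> 0 <= L ->
  measurable T -> measurable Q ->
  (forall x y, Q x -> T y -> l1 (x - y) <= d) ->
  (mu T * \int[mu]_(x in Q) (p x)%:E <=
   mu Q * \int[mu]_(x in T) (p x)%:E + (L * d)%:E * (mu T * mu Q))%E.
Proof.
move=> mp p0 Ld0 lip L0 mT mQ dTQ.
pose m3 := sfprod (sfprod (@lebesgue_measure R) (@lebesgue_measure R)) (@lebesgue_measure R).
have swap (H : R3 R * R3 R -> \bar R) : measurable_fun setT H -> (forall z, 0 <= H z)%E ->
    (\int[mu]_y \int[mu]_h H (y, h) = \int[mu]_h \int[mu]_y H (y, h))%E.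
  by move=> mH H0; exact: (@fubini_tonelli _ _ _ _ _ m3 m3 H mH H0).
have meas1 (H : R3 R * R3 R -> \bar R) : measurable_fun setT H -> (forall z, 0 <= H z)%E ->
    measurable_fun setT (fun y => \int[mu]_h H (y, h))%E.
  by move=> mH H0; exact: (@measurable_fun_fubini_tonelli_F _ _ _ _ _ m3 H mH H0).
have madd : measurable_fun setT (fun z : R3 R * R3 R => z.2 + z.1).
  rewrite (_ : (fun z => _) = fun z : R3 R * R3 R => (co 0 z.2 + co 0 z.1,
      co 1 z.2 + co 1 z.1, co 2 z.2 + co 2 z.1)); last first.
    by apply/funext => -[[[a b] c] [[a' b'] c']]; rewrite !co0 !co1 !co2.
  have mc i : measurable_fun setT (fun z : R3 R * R3 R => co i z.2 + co i z.1).
    by apply: measurable_funD; [exact: (measurableT_comp (@measurable_co R i) (@measurable_snd _ _ _ _))|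
      exact: (measurableT_comp (@measurable_co R i) (@measurable_fst _ _ _ _))].
  by apply: measurable_fun_pair; [apply: measurable_fun_pair|].
have m1T : measurable_fun setT (fun z : R3 R * R3 R => \1_T z.1 : R).
  exact: (measurableT_comp (measurable_indic mT) (@measurable_fst _ _ _ _)).
have m1Q : measurable_fun setT (fun z : R3 R * R3 R => \1_Q (z.2 + z.1) : R).
  exact: (measurableT_comp (measurable_indic mQ) madd).
have mp1 : measurable_fun setT (fun z : R3 R * R3 R => p z.1).
  exact: (measurableT_comp mp (@measurable_fst _ _ _ _)).
have mp2 : measurable_fun setT (fun z : R3 R * R3 R => p (z.2 + z.1)).
  exact: (measurableT_comp mp madd).
pose W (z : R3 R * R3 R) : R := \1_T z.1 * \1_Q (z.2 + z.1).
have W0 z : 0 <= W z by rewrite mulr_ge0 // indicE.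
have mW : measurable_fun setT W by exact: measurable_funM.
(* Pointwise H1 <= H2 + H3. The bound H3 <= H4 is available only at fixed h for almost every y, so
   these two are compared with y integrated first, and the orders are exchanged around that step. *)
pose H1 z := (W z * p (z.2 + z.1))%:E.
pose H2 z := (W z * p z.1)%:E.
pose H3 z := (W z * Num.max (p (z.2 + z.1) - p z.1) 0)%:E.
pose H4 z := (W z * (L * d))%:E.
have mH1 : measurable_fun setT H1 by apply/measurable_EFinP; exact: measurable_funM.
have mH2 : measurable_fun setT H2 by apply/measurable_EFinP; exact: measurable_funM.
have mH3 : measurable_fun setT H3.
  apply/measurable_EFinP; apply: measurable_funM => //; apply: measurable_maxr => //.
  exact: measurable_funB.
have mH4 : measurable_fun setT H4 by apply/measurable_EFinP; exact: measurable_funM.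
have H10 z : (0 <= H1 z)%E by rewrite lee_fin mulr_ge0.
have H20 z : (0 <= H2 z)%E by rewrite lee_fin mulr_ge0.
have H30 z : (0 <= H3 z)%E by rewrite lee_fin mulr_ge0 // le_max lexx orbT.
have H40 z : (0 <= H4 z)%E by rewrite lee_fin mulr_ge0.
have line (f : R3 R -> R) (k : R) y : measurable_fun setT f -> (forall x, 0 <= f x) ->
    0 <= k -> (\int[mu]_h (k * f (h + y))%:E = k%:E * \int[mu]_h (f h)%:E)%E.
  move=> mf f0 k0; under eq_integral do rewrite EFinM.
  etransitivity.
    apply: (@ge0_integralZl_EFin _ _ _ mu setT measurableT) => //.
    - by move=> x _; rewrite lee_fin.
    - apply/measurable_EFinP; exact: (measurableT_comp mf (measurable_shift y)).
  apply: (congr1 (fun z => k%:E * z)%E).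
  apply: (ge0_integral_shift y (f := EFin \o f)); first exact/measurable_EFinP.
  by move=> x; rewrite lee_fin.
have mi (A : set (R3 R)) : measurable A -> measurable_fun setT (\1_A : R3 R -> R).
  exact: measurable_indic.
have i0 (A : set (R3 R)) (x : R3 R) : 0 <= \1_A x :> R by rewrite indicE.
have mkc (A : set (R3 R)) : measurable A ->
    (\int[mu]_(x in A) (p x)%:E = \int[mu]_x (\1_A x * p x)%:E)%E.
  move=> mA; rewrite integral_mkcond; apply: eq_integral => x _.
  by rewrite patchE indicE; case: ifP => _; rewrite ?mul1r ?mul0r.
have IH1 : (\int[mu]_y \int[mu]_h H1 (y, h) = mu T * \int[mu]_(x in Q) (p x)%:E)%E.
  rewrite mkc //; set I := (\int[mu]_x (\1_Q x * p x)%:E)%E.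
  have I_ge0 : (0 <= I)%E by apply: integral_ge0 => x _; rewrite lee_fin mulr_ge0.
  transitivity (\int[mu]_y (I * (\1_T y)%:E))%E.
    apply: eq_integral => y _; rewrite muleC.
    etransitivity; last apply: (line (fun x => \1_Q x * p x) (\1_T y) y).
    - by apply: eq_integral => h _; rewrite /H1 /W /= mulrA.
    - exact: measurable_funM.
    - by move=> x; exact: mulr_ge0.
    - exact: i0.
  etransitivity; first apply: (@ge0_integralZl _ _ _ mu setT measurableT) => //.
  - by apply/measurable_EFinP; exact: mi.
  - by rewrite mu_indic // muleC.
have IH2 : (\int[mu]_y \int[mu]_h H2 (y, h) = mu Q * \int[mu]_(x in T) (p x)%:E)%E.
  rewrite mkc //.
  transitivity (\int[mu]_y (mu Q * (\1_T y * p y)%:E))%E.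
    apply: eq_integral => y _; rewrite muleC -(mu_indic mQ).
    etransitivity; last apply: (line \1_Q (\1_T y * p y) y).
    - by apply: eq_integral => h _; rewrite /H2 /W /= mulrAC.
    - exact: mi.
    - exact: i0.
    - exact: mulr_ge0.
  apply: (@ge0_integralZl _ _ _ mu setT measurableT) => //.
  - by apply/measurable_EFinP; apply: measurable_funM => //; exact: mi.
  - by move=> x _; rewrite lee_fin mulr_ge0.
have IH4 : (\int[mu]_y \int[mu]_h H4 (y, h) = (L * d)%:E * (mu T * mu Q))%E.
  transitivity (\int[mu]_y (((L * d)%:E * mu Q) * (\1_T y)%:E))%E.
    apply: eq_integral => y _; rewrite -(mu_indic mQ) muleAC -EFinM.
    etransitivity; last apply: (line \1_Q (L * d * \1_T y) y).
    - by apply: eq_integral => h _; rewrite /H4 /W /= mulrC mulrA.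
    - exact: mi.
    - exact: i0.
    - exact: mulr_ge0.
  etransitivity; first apply: (@ge0_integralZl _ _ _ mu setT measurableT) => //.
  - by apply/measurable_EFinP; exact: mi.
  - by rewrite mule_ge0.
  - by rewrite mu_indic // -muleA (muleC (mu Q)).
have IH3 : (\int[mu]_y \int[mu]_h H3 (y, h) <= (L * d)%:E * (mu T * mu Q))%E.
  rewrite -IH4 (swap H3 mH3 H30) (swap H4 mH4 H40).
  apply: ge0_le_integral_nomeas => // h _; first by apply: integral_ge0 => y _.
  have mh (H : R3 R * R3 R -> \bar R) : measurable_fun setT H -> measurable_fun setT (fun y => H (y, h)).
    by move=> mH; exact: (measurableT_comp mH (measurable_pair2 h)).
  apply: (@ae_ge0_le_integral _ _ _ mu setT measurableT); [by move=> y _; exact: H30|exact: (mh H3)|by move=> y _; exact: H40|exact: (mh H4)|].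
  apply: filterS (lip h) => y hy _; rewrite lee_fin /W /=.
  have [yT|yT] := boolP (y \in T); last by rewrite !indicE (negbTE yT) !mul0r.
  have [yQ|yQ] := boolP (h + y \in Q); last by rewrite !indicE (negbTE yQ) !mulr0 !mul0r.
  apply: ler_wpM2l; first exact: (W0 (y, h)).
  rewrite ge_max Ld0 andbT; apply: le_trans (ler_norm _) (le_trans hy _).
  apply: ler_wpM2l => //; have := dTQ (h + y) y (set_mem yQ) (set_mem yT).
  by rewrite addrK.
rewrite -IH1 -IH2; apply: le_trans (leeD (lexx _) IH3).
have add : (\int[mu]_y \int[mu]_h H2 (y, h) + \int[mu]_y \int[mu]_h H3 (y, h) =
   \int[mu]_y (\int[mu]_h H2 (y, h) + \int[mu]_h H3 (y, h)))%E.
  apply/esym; apply: (@ge0_integralD _ _ _ mu setT measurableT).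
  - by move=> y _; apply: integral_ge0 => h _.
  - exact: meas1.
  - by move=> y _; apply: integral_ge0 => h _.
  - exact: meas1.
rewrite add.
apply: ge0_le_integral_nomeas => // y _; first by apply: integral_ge0 => h _.
have my (H : R3 R * R3 R -> \bar R) : measurable_fun setT H -> measurable_fun setT (fun h => H (y, h)).
  by move=> mH; exact: (measurableT_comp mH (measurable_pair1 y)).
have -> : (\int[mu]_h H2 (y, h) + \int[mu]_h H3 (y, h) = \int[mu]_h (H2 (y, h) + H3 (y, h)))%E.
  by apply/esym; apply: (@ge0_integralD _ _ _ mu setT measurableT); [move=> h _; exact: H20|exact: (my H2)|move=> h _; exact: H30|exact: (my H3)].
apply: ge0_le_integral_nomeas => // h _.
rewrite lee_fin /= -mulrDr; apply: ler_wpM2l => //.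
by rewrite -lerBlDl le_max lexx.
Qed.
End Comparison.

(** * Cells and the lower bound *)

Section Cells.
Context {R : realType}.
Local Notation mu := (@mu3 R).
Implicit Types (A U : set (R3 R)) (c x y : R3 R) (k : 'cV[int]_3).

Lemma norm_cube (r : R) x : (forall i, `|co i x| <= r) -> `|x| <= r.
Proof.
move=> h; rewrite !prod_normE !ge_max.
by rewrite -co0 -co1 -co2 !h.
Qed.

(** For l > 0 this is c + l A, written as a preimage so that measurability and the change of
    variables come from an affine map. *)
Definition scaled c (l : R) A : set (R3 R) := [set x | A (l^-1 *: (x - c))].

Lemma scaledE c l A : scaled c l A = aff (- (l^-1 *: c)) l^-1 @^-1` A.
Proof.
by apply/seteqP; split=> x; rewrite /scaled /= affE scalerBr addrC.
Qed.

Lemma measurable_scaled c l A : measurable A -> measurable (scaled c l A).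
Proof.
by move=> mA; rewrite scaledE -[_ @^-1` _]setTI; exact: (measurable_aff _ _ measurableT).
Qed.

Lemma integral_scaled c (l : R) A (f : R3 R -> \bar R) : 0 < l -> measurable A ->
  measurable_fun A f -> (forall x, 0 <= f x)%E ->
  (\int[mu]_(x in scaled c l A) f (l^-1 *: (x - c)) = (l ^+ 3)%:E * \int[mu]_(x in A) f x)%E.
Proof.
move=> l0 mA mf f0; rewrite integral_mkcond [in RHS]integral_mkcond.
rewrite -[in RHS](invrK l).
have l'0 : 0 < l^-1 by rewrite invr_gt0.
rewrite -(@ge0_integral_aff _ (- (l^-1 *: c)) _ _ l'0); last 2 first.
- exact/(measurable_restrictT f).
- by move=> x; rewrite patchE; case: ifP.
apply: eq_integral => x _.
have e : aff (- (l^-1 *: c)) l^-1 x = l^-1 *: (x - c) by rewrite affE scalerBr addrC.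
rewrite e !patchE; congr (if _ then _ else _).
Qed.

Lemma mu_scaled c (l : R) A : 0 < l -> measurable A -> mu (scaled c l A) = ((l ^+ 3)%:E * mu A)%E.
Proof.
move=> l0 mA; have := @integral_scaled c l A (cst 1%E) l0 mA (measurable_cst _) (fun _ => lee01).
have /= -> := @integral_cst _ _ _ mu (scaled c l A) (measurable_scaled c l mA) 1%E.
by have /= -> := @integral_cst _ _ _ mu A mA 1%E; rewrite !mul1e.
Qed.

Lemma holeE (T : set (R3 R)) (eps : R) k : 0 < eps ->
  hole T eps k = scaled (eps *: lattice R k) (eps ^+ 3) T.
Proof.
move=> e0; have e3 : eps ^+ 3 != 0 by rewrite expf_neq0 // gt_eqF.
apply/seteqP; split=> [x [y Ty <-]|x Tx]; rewrite /scaled /=.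
  by rewrite addrC addKr scalerA mulVf // scale1r.
by exists ((eps ^+ 3)^-1 *: (x - eps *: lattice R k)) => //; rewrite scalerA mulfV // scale1r addrC subrK.
Qed.

Lemma continuous_scaled_arg c (l : R) : continuous (fun x => l *: (x - c)).
Proof. by move=> x; apply: cvgZl_tmp; apply: cvgB; [exact: cvg_id|exact: cvg_cst]. Qed.

Lemma closure_scaled c (l : R) A : 0 < l -> closure (scaled c l A) = scaled c l (closure A).
Proof.
move=> l0; have ln0 : l != 0 by rewrite gt_eqF.
apply/seteqP; split.
  rewrite (_ : scaled c l (closure A) = closure (scaled c l (closure A))).
    by apply: closure_subset => x; move=> Ax; exact: (@subset_closure _ A).
  apply/closure_id; apply: closed_comp; last exact: closed_closure.
  by move=> x _; exact: continuous_scaled_arg.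
move=> x hx B Bx.
have e z : l *: (l^-1 *: (z - c) - (- (l^-1 *: c))) = z.
  by rewrite opprK -scalerDr subrK scalerA mulfV // scale1r.
have nB : nbhs (l^-1 *: (x - c)) ((fun y => l *: (y - (- (l^-1 *: c)))) @^-1` B).
  by apply: continuous_scaled_arg; rewrite e.
have [y [Ay By]] := hx _ nB.
exists (l *: (y - (- (l^-1 *: c)))); split => //.
by rewrite /scaled /= opprK (scalerDr l) (scalerA l) mulfV // scale1r addrK scalerA mulVf // scale1r.
Qed.

Lemma co_lattice i k : co i (lattice R k) = (k i 0)%:~R.
Proof.
rewrite co_case /lattice /pt !mxE.
by move: i; apply: ord3P.
Qed.

(** Half-open cubes tile the space exactly; they are used for counting in place of the open unit
    cell, whose translates miss the faces. *)
Definition halfopen_cell : set (R3 R) := [set x | forall i, - (1/2) <= co i x < 1/2].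

Lemma halfopen_cellE :
  halfopen_cell = (`[- (1/2), 1/2[%classic `*` `[- (1/2), 1/2[%classic) `*` `[- (1/2), 1/2[%classic.
Proof.
apply/seteqP; split => [x h|x [[/= h0 h1] h2]].
  have := h 0; have := h 1; have := h 2; rewrite co0 co1 co2 => ? ? ?.
  by split; [split|]; rewrite /= in_itv.
move: h0 h1 h2; rewrite !in_itv -co0 -co1 -co2 => h0 h1 h2.
by apply: ord3P.
Qed.

Lemma measurable_halfopen_cell : measurable halfopen_cell.
Proof. by rewrite halfopen_cellE; apply: measurableX => //; exact: measurableX. Qed.

Lemma mu_halfopen_cell : mu halfopen_cell = 1%E.
Proof.
rewrite halfopen_cellE mu3X // !lebesgue_measure_itv /= !lte_fin.
rewrite ifT; last by lra.
by rewrite -EFinB -!EFinM; congr (_%:E); lra.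
Qed.

Definition qcell (eps : R) k := scaled (eps *: lattice R k) eps halfopen_cell.

Lemma measurable_qcell eps k : measurable (qcell eps k).
Proof. by apply: measurable_scaled; exact: measurable_halfopen_cell. Qed.

Lemma mu_qcell (eps : R) k : 0 < eps -> mu (qcell eps k) = (eps ^+ 3)%:E.
Proof.
by move=> e0; rewrite mu_scaled ?mu_halfopen_cell ?mule1 //; exact: measurable_halfopen_cell.
Qed.

Lemma qcellP (eps : R) k x : 0 < eps -> qcell eps k x <->
  forall i, - (1/2) <= eps^-1 * co i x - (k i 0)%:~R < 1/2.
Proof.
move=> e0; have e i : co i (eps^-1 *: (x - eps *: lattice R k)) = eps^-1 * co i x - (k i 0)%:~R.
  by rewrite coZ coB coZ co_lattice mulrBr mulKf // gt_eqF.
by split=> h i; move: (h i); rewrite e.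
Qed.

Lemma qcell_inj (eps : R) k k' x : 0 < eps -> qcell eps k x -> qcell eps k' x -> k = k'.
Proof.
move=> e0 /(qcellP _ _ e0) h /(qcellP _ _ e0) h'.
apply/matrixP => i j; rewrite ord1.
have /andP[a b] := h i; have /andP[a' b'] := h' i.
have l1 : ((k i 0)%:~R : R) < (k' i 0 + 1)%:~R by rewrite intrD; lra.
have l2 : ((k' i 0)%:~R : R) < (k i 0 + 1)%:~R by rewrite intrD; lra.
move: l1 l2; rewrite !ltr_int !ltzD1 => l1 l2.
by apply/eqP; rewrite eq_le l1 l2.
Qed.

Lemma trivIset_qcell (eps : R) (D : set 'cV[int]_3) : 0 < eps -> trivIset D (qcell eps).
Proof. by move=> e0; apply/trivIsetP => i j _ _ ij; rewrite -subset0 => x [xi xj]; rewrite (qcell_inj e0 xi xj) eqxx in ij. Qed.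

Lemma qcell_cover (eps : R) x : 0 < eps -> exists k, qcell eps k x.
Proof.
move=> e0; exists (\col_i Num.floor (eps^-1 * co i x + 1/2)).
apply/(qcellP _ _ e0) => i; rewrite mxE.
have := floor_le_tmp (eps^-1 * co i x + 1/2); have := lt_succ_floor (eps^-1 * co i x + 1/2).
by rewrite intrD => ? ?; lra.
Qed.

Lemma scaled_small_qcell (eps : R) k A : 0 < eps -> eps <= 1 -> A `<=` eball 0 (1/8) ->
  scaled (eps *: lattice R k) (eps ^+ 3) A `<=` qcell eps k.
Proof.
move=> e0 e1 sA x /sA; rewrite /eball /= subr0 => h; apply/(qcellP _ _ e0) => i.
have ln0 : eps != 0 by rewrite gt_eqF.
have := le_lt_trans (abs_entry_le_frob (vec _) i 0) h.
rewrite -/(co i _) coZ coB coZ co_lattice.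
set t := eps^-1 * co i x - _.
have -> : (eps ^+ 3)^-1 * (co i x - eps * (k i 0)%:~R) = (eps ^+ 2)^-1 * t.
  by rewrite /t; field.
have e2 : 0 < (eps ^+ 2)^-1 by rewrite invr_gt0 exprn_gt0.
have e21 : 1 <= (eps ^+ 2)^-1 by rewrite invf_ge1 ?exprn_gt0 // expr_le1 // ltW.
rewrite normrM gtr0_norm // => h2.
have : `|t| < 1/8 by apply: le_lt_trans h2; rewrite ler_peMl.
by rewrite ltr_norml => /andP[? ?]; apply/andP; split; lra.
Qed.

(** The point y is the limit of t y as t increases to 1, and these points lie in the open cell. *)
Lemma closure_unit_cell_ge (y : R3 R) : (forall i, `|co i y| <= 1/2) -> closure (@unit_cell R) y.
Proof.
move=> h B By.
have cy : (fun t : R => t *: y) @ (1 : R)^'- --> y.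
  rewrite -[X in _ --> X]scale1r; apply: cvg_at_left_filter.
  by apply: cvgZr_tmp; exact: cvg_id.
have : \forall t \near (1 : R)^'-, unit_cell (t *: y) /\ B (t *: y).
  near=> t; split; last by near: t; exact: cy.
  move=> i; rewrite -/(co i _) coZ normrM.
  have t0 : 0 < t by near: t; apply: nbhs_left_gt.
  have t1 : t < 1 by near: t; apply: nbhs_left_lt.
  rewrite gtr0_norm //; have := h i; have := normr_ge0 (co i y); nra.
by move=> /filter_ex[t [? ?]]; exists (t *: y).
Unshelve. all: by end_near. Qed.

Lemma closure_unit_cell_le (y : R3 R) : closure (@unit_cell R) y -> forall i, `|co i y| <= 1/2.
Proof.
have cl : closed (cube (1/2 : R)).
  by apply: compact_closed; [exact: norm_hausdorff|exact: compact_cube].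
move=> h; apply/cubeP; rewrite ((closure_id _).1 cl).
apply: closure_subset h => x hx; apply/cubeP => i; exact: ltW (hx i).
Qed.

Lemma qcell_sub U (eps : R) k : 0 < eps -> cells U eps k -> qcell eps k `<=` U.
Proof.
move=> e0 [_ sU] x hx; apply: sU; apply: subset_closure => /=.
exists (eps^-1 *: (x - eps *: lattice R k)).
  apply: closure_unit_cell_ge => i; have /andP[? ?] := hx i.
  by rewrite ler_norml; apply/andP; split => //; exact: ltW.
by rewrite scalerDr scalerA mulfV ?gt_eqF // scale1r addrC subrK.
Qed.

(** In the sup norm, a closed cell of side eps lies within distance eps of each of its points. *)
Lemma qcell_cells U (eps r : R) k x : 0 < eps -> eps < r -> ball x r `<=` U ->
  qcell eps k x -> cells U eps k.
Proof.
move=> e0 er sU hx.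
pose f (y : R3 R) := eps *: (lattice R k + y).
have cf : continuous f.
  by move=> y; apply: cvgZl_tmp; apply: cvgD; [exact: cvg_cst|exact: cvg_id].
have cpt : compact (closure (@unit_cell R)).
  apply: (@bounded_closure_compact _ _ (1/2)) => z hz.
  by apply/cubeP => i; exact: ltW (hz i).
have cI : compact (f @` closure (@unit_cell R)).
  apply: continuous_compact => //; exact: continuous_subspaceT.
have clI : closed (f @` closure (@unit_cell R)).
  by apply: compact_closed => //; exact: norm_hausdorff.
rewrite /cells /= /compactly_included -((closure_id _).1 clI); split=> //.
move=> _ [y hy <-]; apply: sU; rewrite -ball_normE /=.
apply: le_lt_trans er; apply: norm_cube => i.
have hyi := closure_unit_cell_le hy i.
have /andP[a b] := (qcellP _ _ e0).1 hx i.
rewrite coB coZ coD co_lattice.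
have -> : co i x - eps * ((k i 0)%:~R + co i y) = eps * ((eps^-1 * co i x - (k i 0)%:~R) - co i y).
  by field; rewrite gt_eqF.
rewrite normrM gtr0_norm // -[leRHS]mulr1 ler_pM2l //.
move: hyi; rewrite !ler_norml => /andP[? ?]; apply/andP; split; lra.
Qed.

Lemma qcell_diam (eps : R) k x y : 0 < eps -> qcell eps k x -> qcell eps k y ->
  l1 (x - y) <= 3 * eps.
Proof.
move=> e0 /(qcellP _ _ e0) hx /(qcellP _ _ e0) hy.
have hi i : `|co i (x - y)| <= eps.
  have /andP[a b] := hx i; have /andP[a' b'] := hy i.
  have -> : co i (x - y) = eps * ((eps^-1 * co i x - (k i 0)%:~R) - (eps^-1 * co i y - (k i 0)%:~R)).
    by rewrite coB; field; rewrite gt_eqF.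
  rewrite normrM gtr0_norm // -[leRHS]mulr1 ler_pM2l // ler_norml; apply/andP; split; lra.
by have := hi 0; have := hi 1; have := hi 2; rewrite /l1 => ? ? ?; lra.
Qed.

Lemma finite_cells U (eps : R) : bounded_set U -> 0 < eps -> finite_set (cells U eps).
Proof.
move=> bU e0; have [r r0 sr] := bounded_cube bU.
pose N := (Num.truncn (eps^-1 * r)).+1.
have hN : eps^-1 * r < N%:R by exact: truncnS_gt.
have hk k : cells U eps k -> forall i, (`|k i 0%R| < N)%N.
  move=> ck i.
  have qk : qcell eps k (eps *: lattice R k).
    apply/(qcellP _ _ e0) => a; rewrite coZ co_lattice mulKf ?gt_eqF // subrr.
    by apply/andP; split; lra.
  have /cubeP/(_ i) := sr _ (qcell_sub e0 ck qk).
  rewrite coZ co_lattice normrM gtr0_norm // -ler_pdivlMl // => h.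
  have := le_lt_trans h hN; rewrite -intr_norm -abszE -[N%:R]/(N%:Z%:~R).
  by rewrite ltr_int.
(* An integer vector with entries of absolute value below N is coded by these absolute values and
   the signs, which leaves finitely many. *)
pose g (t : {ffun 'I_3 -> 'I_N * bool}) : 'cV[int]_3 :=
  \col_i (if (t i).2 then (nat_of_ord (t i).1)%:Z else - (nat_of_ord (t i).1)%:Z).
apply: (@sub_finite_set _ _ (range g)); last exact/finite_image/finite_finset.
move=> k /hk h; exists [ffun i => (Ordinal (h i), 0 <= k i 0)] => //.
apply/matrixP => i j; rewrite ord1 mxE ffunE /= abszE.
by case: ifPn => [k0|]; [rewrite ger0_norm|rewrite -ltNge => k0; rewrite ltr0_norm // opprK].
Qed.

End Cells.

Section LowerBound.
Context {R : realType}.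
Local Notation mu := (@mu3 R).
Implicit Types (U K T : set (R3 R)).

Lemma open_mu_gt0 U x : open U -> U x -> (0 < mu U)%E.
Proof.
move=> oU Ux; have /nbhs_ballP[r /= r0 sU] : nbhs x U by exact: open_nbhs_nbhs.
apply: (@lt_le_trans _ _ (mu (scaled x r halfopen_cell))).
  rewrite mu_scaled //; last exact: measurable_halfopen_cell.
  by rewrite mu_halfopen_cell mule1 lte_fin exprn_gt0.
apply: (@le_measure _ _ _ mu).
- by rewrite inE; apply: measurable_scaled; exact: measurable_halfopen_cell.
- by rewrite inE; exact: open_measurable3.
move=> y hy; apply: sU; rewrite -ball_normE /=.
apply: (@le_lt_trans _ _ (r * (1/2))); last by lra.
apply: norm_cube => i; have /andP[a b] := hy i.
have -> : co i (x - y) = r * - co i (r^-1 *: (y - x)).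
  by rewrite coZ !coB; field; rewrite gt_eqF.
rewrite normrM gtr0_norm // normrN ler_pM2l // ler_norml; apply/andP; split => //.
exact: ltW.
Qed.

Lemma bounded_mu_fin U : measurable U -> bounded_set U -> (mu U < +oo)%E.
Proof.
move=> mU /bounded_cube[r r0 sU]; apply: le_lt_trans (mu3_cube_fin r).
by apply: (@le_measure _ _ _ mu); rewrite ?inE //; exact: measurable_cube.
Qed.

Lemma inLp_oo_bounded U m n (u : R3 R -> 'M[R]_(m, n)) : inLp +oo%E U u ->
  exists2 M, 0 <= M & {ae mu, forall x, U x -> frob (u x) <= M}.
Proof.
move=> [_]; rewrite /LN Lnorm.unlock; case: ifPn => [_|m0 _]; last first.
  (* The essential supremum norm takes a default value when the whole space is null; every property
     then holds almost everywhere. *)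
  have mT0 : mu setT = 0%E by apply/eqP; rewrite eq_le measure_ge0 andbT leNgt.
  exists 0 => //; exists setT; split => //; exact: measurableT.
set f := abse \o _ => hf; set e := ess_sup _ _ in hf.
exists `|fine e|; first by [].
have := ess_sup_ge mu f; apply: filterS => x; rewrite -/e /f /= => hx Ux.
rewrite mem_set // ger0_norm ?frob_ge0 // in hx.
move: e hf hx => [r| |] //= _; rewrite lee_fin => h; exact: le_trans h (ler_norm _).
Qed.

Lemma inX_bounds U (v : R3 R -> 'cV[R]_3) : open U -> inX U v ->
  exists M, [/\ 0 <= M, forall i, H10s U (fun x => v x i 0) (fun j x => wgrad U v x i j),
    forall i, {ae mu, forall x, U x -> `|v x i 0| <= M} &
    forall i j, {ae mu, forall x, U x -> `|wgrad U v x i j| <= M}].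
Proof.
move=> oU [[hv _ hg] [h10 _]].
have [M1 M10 h1] := inLp_oo_bounded hv; have [M2 M20 h2] := inLp_oo_bounded hg.
exists (Num.max M1 M2); split.
- by rewrite le_max M10.
- by move=> i; exact: inH10_H10s.
- move=> i; apply: filterS h1 => x hx Ux; rewrite le_max.
  by rewrite (le_trans (abs_entry_le_frob _ _ _) (hx Ux)).
- move=> i j; apply: filterS h2 => x hx Ux; rewrite le_max.
  by rewrite (le_trans (abs_entry_le_frob _ _ _) (hx Ux)) orbT.
Qed.

(** The function |v|^6 extended by 0, as a polynomial in the components: the root in the Euclidean
    norm disappears from measurability and Lipschitz arguments. *)
Definition pow6 U (v : R3 R -> 'cV[R]_3) (x : R3 R) : R :=
  (\sum_i (zext U (fun y => v y i 0) x) ^+ 2) ^+ 3.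

Lemma pow6_ge0 U v x : 0 <= pow6 U v x.
Proof. by apply: exprn_ge0; apply: sumr_ge0 => i _; exact: sqr_ge0. Qed.

Lemma pow6E U v x : U x -> pow6 U v x = frob (v x) ^+ 6.
Proof.
move=> Ux; rewrite /pow6 (_ : 6 = 2 * 3)%N // exprM frob_sqr; congr (_ ^+ 3).
by apply: eq_bigr => i _; rewrite big_ord1 /zext mem_set.
Qed.

Lemma measurable_pow6 U (v : R3 R -> 'cV[R]_3) : measurable U -> (forall i, measurable_fun U (fun x => v x i 0)) ->
  measurable_fun setT (pow6 U v).
Proof.
move=> mU mv; apply: measurable_funX; rewrite /=.
apply: measurable_sum => i; apply: measurable_funX; exact: measurable_zext.
Qed.

Lemma pow6_lipschitz U (v : R3 R -> 'cV[R]_3) : open U -> (mu U < +oo)%E -> inX U v ->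
  exists2 L, 0 <= L & forall h, {ae mu, forall y, `|pow6 U v (h + y) - pow6 U v y| <= L * l1 h}.
Proof.
move=> oU fU hv; have mU := open_measurable3 oU.
have [M [M0 h10 hb hg]] := inX_bounds oU hv.
exists (162 * M ^+ 5 * M); first by rewrite mulr_ge0 // mulr_ge0 // exprn_ge0.
move=> h.
have bz i : {ae mu, forall x, `|zext U (fun y => v y i 0) x| <= M}.
  apply: filterS (hb i) => x hx; rewrite /zext; case: ifPn => [/set_mem /hx //|_].
  by rewrite normr0.
have all3 (P : 'I_3 -> R3 R -> Prop) : (forall i, {ae mu, forall x, P i x}) ->
    {ae mu, forall x, forall i, P i x}.
  move=> hP; apply: filterS3 (hP 0) (hP 1) (hP 2) => x a b c i; move: i; exact: (ord3P a b c).
have b0 := all3 _ bz.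
have b1 := ae_shift h b0.
have b2 := all3 _ (fun i => zext_lipschitz h mU fU M0 (h10 i) (hg i)).
apply: filterS3 b0 b1 b2 => y b0 b1 b2.
rewrite -mulrA; apply: sumsq3_cube_lipschitz => // i.
by rewrite addrC.
Qed.

Lemma sum_integral_le (I : choiceType) (s : seq I) (A : I -> set (R3 R)) U (f : R3 R -> \bar R) :
  uniq s -> (forall k, measurable (A k)) -> trivIset [set` s] A -> measurable U ->
  (forall k, k \in s -> A k `<=` U) -> measurable_fun U f -> (forall x, 0 <= f x)%E ->
  (\sum_(k <- s) \int[mu]_(x in A k) f x <= \int[mu]_(x in U) f x)%E.
Proof.
move=> us mA tA mU sAU mf f0.
have sU : \big[setU/set0]_(k <- s) A k `<=` U.
  by rewrite -bigcup_seq => x [k /= ks Ax]; exact: sAU Ax.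
have mD : measurable (\big[setU/set0]_(k <- s) A k) by exact: bigsetU_measurable.
rewrite -(@ge0_integral_bigsetU _ _ _ mu _ A f s mA us tA) //; last first.
  exact: measurable_funS sU mf.
exact: (@ge0_subset_integral _ _ _ mu _ U mD mU).
Qed.

Lemma integral_le_sum (I : choiceType) (s : seq I) (A : I -> set (R3 R)) K (f : R3 R -> \bar R) :
  uniq s -> (forall k, measurable (A k)) -> trivIset [set` s] A -> measurable K ->
  K `<=` \bigcup_(k in [set` s]) A k -> measurable_fun setT f -> (forall x, 0 <= f x)%E ->
  (\int[mu]_(x in K) f x <= \sum_(k <- s) \int[mu]_(x in A k) f x)%E.
Proof.
move=> us mA tA mK; rewrite bigcup_seq => sK mf f0.
have mD : measurable (\big[setU/set0]_(k <- s) A k) by exact: bigsetU_measurable.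
rewrite -(@ge0_integral_bigsetU _ _ _ mu _ A f s mA us tA) //; last exact: measurable_funTS.
apply: (@ge0_subset_integral _ _ _ mu K _ mK mD) => //; exact: measurable_funTS.
Qed.

Lemma cells_seq U (eps : R) : bounded_set U -> 0 < eps ->
  exists2 s : seq 'cV[int]_3, uniq s & cells U eps = [set` s].
Proof.
move=> bU e0; have /finite_seqP[s hs] := finite_cells bU e0.
exists (undup s); first exact: undup_uniq.
by rewrite hs; apply/seteqP; split => x /=; rewrite mem_undup.
Qed.

(** The error eps^10 of one cell is written as eps^7 times the volume of the cell, so that summing
    the disjoint cells costs at most eps^7 mu U. Points of K are farther than eps from the
    complement of U, so K is covered by cells that do carry a hole. *)
Lemma cells_lower_bound U K T (p w : R3 R -> R) (L r eps tau : R) :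
  open U -> bounded_set U -> measurable K -> (forall x, K x -> ball x r `<=` U) ->
  measurable T -> T `<=` eball 0 (1/8) -> mu T = tau%:E -> 0 <= L -> 0 <= tau ->
  measurable_fun setT p -> (forall x, 0 <= p x) ->
  (forall h, {ae mu, forall y, `|p (h + y) - p y| <= L * l1 h}) ->
  measurable_fun U w -> (forall x, 0 <= w x) ->
  0 < eps -> eps < r -> eps <= 1 ->
  (forall k, cells U eps k -> {ae mu, forall x, hole T eps k x -> w x = p x}) ->
  ((eps ^+ 6 * tau)%:E * \int[mu]_(x in K) (p x)%:E <=
   \int[mu]_(x in U) (w x)%:E + (3 * L * tau * eps ^+ 7)%:E * mu U)%E.
Proof.
move=> oU bU mK hK mT sT muT L0 tau0 mp p0 lip mw w0 e0 er e1 hw.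
have mU := open_measurable3 oU.
have [s us hs] := cells_seq bU e0.
have e30 : 0 < eps ^+ 3 by rewrite exprn_gt0.
pose Tk k := scaled (eps *: lattice R k) (eps ^+ 3) T.
have mTk k : measurable (Tk k) by exact: measurable_scaled.
have TQ k : Tk k `<=` qcell eps k by exact: scaled_small_qcell.
have QU k : k \in s -> qcell eps k `<=` U.
  by move=> ks; apply: (qcell_sub e0); rewrite hs.
have tQ : trivIset [set` s] (qcell eps) by exact: trivIset_qcell.
have tT : trivIset [set` s] Tk.
  by move=> i j si sj [x [xi xj]]; apply: tQ => //; exists x; split; exact: TQ.
have KQ : K `<=` \bigcup_(k in [set` s]) qcell eps k.
  move=> x Kx; have [k kx] := qcell_cover x e0; exists k => //.
  by rewrite -hs; exact: (qcell_cells e0 er (hK x Kx) kx).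
have mpE : measurable_fun setT (EFin \o p) by exact/measurable_EFinP.
have c1 := integral_le_sum us (@measurable_qcell _ eps) tQ mK KQ mpE (fun x => p0 x).
have c2 := sum_integral_le us mTk tT mU (fun k ks => subset_trans (TQ k) (QU k ks)).
have c3 := sum_integral_le us (@measurable_qcell _ eps) tQ mU QU (measurable_cst 1%E) (fun x => lee01).
have {}c2 := c2 (EFin \o w) ((measurable_EFinP _ _).2 mw) (fun x => w0 x).
have cc0 : 0 <= 3 * L * tau * eps ^+ 7.
  by apply: mulr_ge0; [apply: mulr_ge0 => //; apply: mulr_ge0|apply: exprn_ge0; exact: ltW].
have cell k : k \in s ->
    ((eps ^+ 6 * tau)%:E * \int[mu]_(x in qcell eps k) (p x)%:E <=
     \int[mu]_(x in Tk k) (w x)%:E +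
     (3 * L * tau * eps ^+ 7)%:E * \int[mu]_(x in qcell eps k) 1)%E.
  move=> ks.
  have -> : (\int[mu]_(x in qcell eps k) 1 = (eps ^+ 3)%:E)%E.
    have /= -> := @integral_cst _ _ _ mu _ (measurable_qcell eps k) 1%E.
    by rewrite mul1e; exact: mu_qcell.
  have -> : (\int[mu]_(x in Tk k) (w x)%:E = \int[mu]_(x in Tk k) (p x)%:E)%E.
    apply: (@ae_eq_integral _ _ _ mu _ _ _ (mTk k)).
    - apply/measurable_EFinP; apply: measurable_funS mw => //.
      exact: (subset_trans (TQ k) (QU k ks)).
    - by apply/measurable_EFinP; exact: measurable_funTS.
    - have kc : cells U eps k by rewrite hs.
      by apply: filterS (hw k kc) => x; rewrite holeE // => h Tx; rewrite h.
  have d0 : 0 <= L * (3 * eps) by rewrite mulr_ge0 // mulr_ge0 // ltW.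
  have := @average_comparison _ p L (3 * eps) (Tk k) (qcell eps k) mp p0 d0 lip L0
    (mTk k) (measurable_qcell eps k).
  have muTk : mu (Tk k) = (eps ^+ 9 * tau)%:E.
    by rewrite mu_scaled // muT -EFinM -exprM.
  rewrite muTk mu_qcell // => /(_ _)/wrap[].
    by move=> x y Qx Ty; apply: (qcell_diam e0 Qx); exact: TQ.
  set A := (\int[mu]_(x in qcell eps k) (p x)%:E)%E; set B := (\int[mu]_(x in Tk k) (p x)%:E)%E.
  (* The comparison of averages carries the cell volume eps^3 in front of the hole integral; the
     claim is multiplied by it. *)
  move=> h; rewrite -(@lee_pmul2l _ (eps ^+ 3)%:E) ?lte_fin //.
  have B0 : (0 <= B)%E by apply: integral_ge0 => x _; rewrite lee_fin.
  clearbody A B; rewrite -[(_ * (eps ^+ 3)%:E)%E]EFinM.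
  have C0 : (0 <= (3 * L * tau * eps ^+ 7 * eps ^+ 3)%:E)%E.
    by rewrite lee_fin; apply: mulr_ge0; [exact: cc0|exact: ltW].
  rewrite (ge0_muleDr _ B0 C0).
  rewrite muleA -!EFinM.
  have -> : eps ^+ 3 * (eps ^+ 6 * tau) = eps ^+ 9 * tau by ring.
  have -> : eps ^+ 3 * (3 * L * tau * eps ^+ 7 * eps ^+ 3) =
     L * (3 * eps) * (eps ^+ 9 * tau * eps ^+ 3) by ring.
  by rewrite !EFinM in h *.
have et0 : 0 <= eps ^+ 6 * tau by rewrite mulr_ge0 // exprn_ge0 // ltW.
apply: (@le_trans _ _ ((eps ^+ 6 * tau)%:E * \sum_(k <- s) \int[mu]_(x in qcell eps k) (p x)%:E)%E).
  exact: lee_wpmul2l.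
rewrite ge0_sume_distrr; last by move=> k _; apply: integral_ge0 => x _; rewrite lee_fin.
apply: (@le_trans _ _ (\sum_(k <- s) (\int[mu]_(x in Tk k) (w x)%:E +
     (3 * L * tau * eps ^+ 7)%:E * \int[mu]_(x in qcell eps k) 1))%E).
  by rewrite big_seq [leRHS]big_seq; apply: lee_sum => k; exact: cell.
rewrite big_split /= -ge0_sume_distrr; last by move=> k _; exact: integral_ge0.
apply: leeD => //; apply: lee_wpmul2l => //.
by apply: le_trans c3 _; have /= -> := @integral_cst _ _ _ mu U mU 1%E; rewrite mul1e.
Qed.
End LowerBound.

Section LiminfBound.
Context {R : realType}.
Local Notation mu := (@mu3 R).
Implicit Types (U K T : set (R3 R)).

Lemma frobN m n (A : 'M[R]_(m, n)) : frob (- A) = frob A.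
Proof.
by rewrite /frob !ddot_sqr; congr Num.sqrt; apply: eq_bigr => i _; apply: eq_bigr => j _; rewrite mxE sqrrN.
Qed.

Lemma LN_nat_ge k U m n (u : R3 R -> 'M[R]_(m, n)) (c : R) : 0 <= c ->
  ((c ^+ k.+1)%:E <= \int[mu]_(x in U) (frob (u x) ^+ k.+1)%:E)%E ->
  (c%:E <= LN (k.+1%:R)%:E U u)%E.
Proof.
move=> c0; rewrite leNgt => /negP h; rewrite leNgt; apply/negP => h2; apply: h.
have : (0 <= LN (k.+1%:R)%:E U u)%E by rewrite /LN Lnorm_ge0.
have := @LN_nat_le R k U m n u.
case: (LN _ U u) h2 => [r| |] //; rewrite lte_fin => rc hr r0.
have r1 : 0 <= r by rewrite -lee_fin.
apply: le_lt_trans ((hr r r1).1 (lexx _)) _.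
by rewrite lte_fin ltrXn2r.
Qed.

Definition inner_part U n : set (R3 R) := [set x | ball x (n.+1%:R^-1 : R) `<=` U].

Lemma measurable_inner_part U n : measurable (inner_part U n).
Proof.
apply: closed_measurable3; rewrite -openC.
rewrite (_ : ~` _ = \bigcup_(z in ~` U) ball z (n.+1%:R^-1 : R)).
  by apply: bigcup_open => z _; apply: ball_open; rewrite invr_gt0.
apply/seteqP; split=> [x /= hx|x [z Uz zx] hx].
  apply: contrapT => h; apply: hx => z xz; apply: contrapT => Uz.
  by apply: h; exists z => //; exact: ball_sym.
by apply: Uz; apply: hx; exact: ball_sym.
Qed.

Lemma bigcup_inner_part U : open U -> \bigcup_n inner_part U n = U.
Proof.
move=> oU; apply/seteqP; split=> [x [n _ hx]|x Ux].
  by apply: hx; apply: ballxx; rewrite invr_gt0.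
have /nbhs_ballP[r /= r0 sU] : nbhs x U by exact: open_nbhs_nbhs.
have [n _ /(_ n (leqnn n))/= hn] := near_infty_natSinv_lt (PosNum r0).
by exists n => // y xy; apply: sU; apply: le_ball xy; exact: ltW.
Qed.

Lemma nondecreasing_inner_part U : nondecreasing_seq (inner_part U).
Proof.
move=> m n mn; apply/subsetPset => x hx y xy; apply: hx; apply: le_ball xy.
by rewrite lef_pV2 ?posrE // ler_nat.
Qed.

(** The threshold on eps depends on v and [Lr] but not on u, so one statement serves both an
    arbitrary family and the restriction operator. The strict inequality in the hypothesis leaves
    room for the inner part of U and for the eps^7 error. *)
Lemma near_lower_bound U T (v : R3 R -> 'cV[R]_3) (Lr tau : R) :
  open U -> bounded_set U -> measurable T -> T `<=` eball 0 (1/8) -> mu T = tau%:E ->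
  0 < tau -> inX U v -> 0 <= Lr ->
  ((Lr ^+ 6)%:E < tau%:E * \int[mu]_(x in U) (frob (v x) ^+ 6)%:E)%E ->
  \forall eps \near 0^'+, forall u : R3 R -> 'cV[R]_3,
    (forall i, measurable_fun U (fun x => u x i 0)) ->
    {ae mu, forall x, holes U T eps x -> u x = 0} ->
    ((Lr * eps)%:E <= LN 6%:E U (fun x => (u x - v x)%R))%E.
Proof.
move=> oU bU mT sT muT tau0 hv Lr0 hLr; have mU := open_measurable3 oU.
have fU := bounded_mu_fin mU bU.
have mv i : measurable_fun U (fun x => v x i 0) by have [[[]]] := hv.
have [L L0 lip] := pow6_lipschitz oU fU hv.
have mp := measurable_pow6 mU mv.
have eI : (\int[mu]_(x in U) (frob (v x) ^+ 6)%:E = \int[mu]_(x in U) (pow6 U v x)%:E)%E.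
  by apply: eq_integral => x /set_mem Ux; rewrite pow6E.
have [n hn] : exists n, ((Lr ^+ 6)%:E < tau%:E * \int[mu]_(x in inner_part U n) (pow6 U v x)%:E)%E.
  apply/not_existsP => h.
  have : (\int[mu]_(x in U) (pow6 U v x)%:E <= (Lr ^+ 6 / tau)%:E)%E.
    have cv : (\int[mu]_(x in inner_part U n) (pow6 U v x)%:E @[n --> \oo] -->
        \int[mu]_(x in \bigcup_n inner_part U n) (pow6 U v x)%:E)%E.
      apply: ge0_nondecreasing_set_cvg_integral.
      - exact: nondecreasing_inner_part.
      - exact: measurable_inner_part.
      - by move=> i; apply/measurable_EFinP; exact: measurable_funTS.
      - by move=> i x _; rewrite lee_fin pow6_ge0.
    rewrite bigcup_inner_part // in cv.
    apply: cvge_le cv; apply: nearW => n.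
    have /negP := h n; rewrite -leNgt => hn.
    rewrite -(@lee_pmul2l _ tau%:E) ?lte_fin // -EFinM.
    by rewrite (_ : tau * _ = Lr ^+ 6) //; field; rewrite gt_eqF.
  rewrite leNgt => /negP; apply; rewrite -(@lte_pmul2l _ tau%:E) ?lte_fin // -eI -EFinM.
  by rewrite (_ : tau * _ = Lr ^+ 6) //; field; rewrite gt_eqF.
(* A real number j stands for the integral in the remaining real arithmetic, since finiteness of the
   integral has not been established here. *)
have [j j1 j2] : exists2 j, Lr ^+ 6 < tau * j & (j%:E <= \int[mu]_(x in inner_part U n) (pow6 U v x)%:E)%E.
  have J0 : (0 <= \int[mu]_(x in inner_part U n) (pow6 U v x)%:E)%E.
    by apply: integral_ge0 => x _; rewrite lee_fin pow6_ge0.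
  move: hn J0; case: (\int[mu]_(x in _) _)%E => [r| |] // hr _; first by exists r.
  exists (Lr ^+ 6 / tau + 1); last by rewrite leey.
  have -> : tau * (Lr ^+ 6 / tau + 1) = Lr ^+ 6 + tau by field; rewrite gt_eqF.
  by rewrite ltrDl.
have [m m0 muU] : exists2 m, 0 <= m & mu U = m%:E.
  exists (fine (mu U)); first by rewrite fine_ge0.
  by rewrite fineK // ge0_fin_numE.
pose c := 3 * L * tau * m.
have c0 : 0 <= c by rewrite !mulr_ge0 // ltW.
(* Below this threshold c eps is less than tau j - Lr^6, which absorbs the error; adding 1 to c
   avoids a zero denominator. *)
have dc : 0 < (tau * j - Lr ^+ 6) / (c + 1) by rewrite divr_gt0 ?subr_gt0 // ltr_wpDl.
near=> eps => u mu_ hu.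
have e0 : 0 < eps by near: eps; exact: nbhs_right_gt.
have e1 : eps <= 1 by near: eps; exact: nbhs_right_le.
have er : eps < n.+1%:R^-1 by near: eps; apply: nbhs_right_lt; rewrite invr_gt0.
have ed : eps < (tau * j - Lr ^+ 6) / (c + 1) by near: eps; exact: nbhs_right_lt.
pose w x := frob (u x - v x) ^+ 6.
have wE x : w x = (\sum_i (u x i 0 - v x i 0) ^+ 2) ^+ 3.
  rewrite /w (_ : 6 = 2 * 3)%N // exprM frob_sqr; congr (_ ^+ 3).
  by apply: eq_bigr => i _; rewrite big_ord1 !mxE.
have mw : measurable_fun U w.
  apply: (eq_measurable_fun (fun x => (\sum_i (u x i 0 - v x i 0) ^+ 2) ^+ 3)).
    by move=> x _; rewrite wE.
  apply: measurable_funX; apply: measurable_sum => i; apply: measurable_funX.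
  exact: measurable_funB.
have w0 x : 0 <= w x by rewrite exprn_ge0 // frob_ge0.
have hw k : cells U eps k -> {ae mu, forall x, hole T eps k x -> w x = pow6 U v x}.
  move=> kc; apply: filterS hu => x hx Tx.
  have Ux : U x.
    apply: (qcell_sub e0 kc); apply: (scaled_small_qcell e0 e1 sT).
    by rewrite -holeE.
  rewrite pow6E // /w hx; last by exists k => //; exact: subset_closure.
  by rewrite sub0r frobN.
have := cells_lower_bound oU bU (measurable_inner_part U n)
  (fun x (h : inner_part U n x) => h) mT sT muT L0 (ltW tau0) mp (pow6_ge0 U v) lip
  mw w0 e0 er e1 hw.
move=> main; apply: LN_nat_ge; first by rewrite mulr_ge0 // ltW.
change (((Lr * eps) ^+ 6)%:E <= \int[mu]_(x in U) (w x)%:E)%E.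
have {main} : ((eps ^+ 6 * tau)%:E * j%:E <= \int[mu]_(x in U) (w x)%:E + (3 * L * tau * eps ^+ 7)%:E * mu U)%E.
  apply: le_trans main; apply: lee_wpmul2l => //.
  by rewrite lee_fin mulr_ge0 // ?exprn_ge0 // ltW.
rewrite muU -!EFinM.
have : (0 <= \int[mu]_(x in U) (w x)%:E)%E by apply: integral_ge0 => x _; rewrite lee_fin.
move: (\int[mu]_(x in U) (w x)%:E)%E => [W| |] // W0; last by move=> _; exact: leey.
rewrite -EFinD !lee_fin => h.
have c1 : 0 < c + 1 by rewrite ltr_wpDl.
rewrite (ltr_pdivlMr _ _ c1) in ed.
have e6 : 0 < eps ^+ 6 by rewrite exprn_gt0.
have k1 : eps ^+ 6 * (tau * j - c * eps) <= W.
  rewrite mulrBr; have -> : eps ^+ 6 * (c * eps) = 3 * L * tau * eps ^+ 7 * m by rewrite /c; ring.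
  by rewrite lerBlDr mulrA.
apply: le_trans k1; rewrite exprMn mulrC ler_pM2l //.
by lra.
Unshelve. all: by end_near. Qed.

Lemma liminf_lower_bound U T (v : R3 R -> 'cV[R]_3) (ve : R -> R3 R -> 'cV[R]_3) (tau : R) :
  open U -> bounded_set U -> measurable T -> T `<=` eball 0 (1/8) -> mu T = tau%:E ->
  0 < tau -> inX U v ->
  (\forall eps \near 0^'+, inLp 6%:E U (ve eps) /\
        {ae mu, forall x, holes U T eps x -> ve eps x = 0}) ->
  (poweR (mu T) (6^-1)%R * LN 6%:E U v <=
      limf_einf (fun eps : R =>
        (eps^-1)%:E * LN 6%:E U (fun x => (ve eps x - v x)%R)) 0^'+)%E.
Proof.
move=> oU bU mT sT muT tau0 hv hve.
set X := limf_einf _ _; set a := (X in (X <= _)%E).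
have low (Lr : R) : 0 <= Lr -> (Lr%:E < a)%E -> (Lr%:E <= X)%E.
  move=> Lr0 La.
  have hLr : ((Lr ^+ 6)%:E < tau%:E * \int[mu]_(x in U) (frob (v x) ^+ 6)%:E)%E.
    rewrite ltNge; apply/negP => h; move: La; rewrite ltNge => /negP; apply.
    have : (0 <= \int[mu]_(x in U) (frob (v x) ^+ 6)%:E)%E.
      by apply: integral_ge0 => x _; rewrite lee_fin exprn_ge0 // frob_ge0.
    rewrite /a (LN_natE 5) muT.
    case: (\int[mu]_(x in U) _)%E h => [r| |] // h r0; last by rewrite gt0_muley ?lte_fin in h.
    rewrite -EFinM !lee_fin in h r0 *.
    rewrite -powRM //; last exact: ltW.
    have -> : Lr = (Lr ^+ 6) `^ 6^-1.
      by rewrite -powR_mulrn // -powRrM mulfV // powRr1.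
    apply: ge0_ler_powR => //; rewrite ?nnegrE ?exprn_ge0 //.
    by rewrite mulr_ge0 // ltW.
  have near1 := near_lower_bound oU bU mT sT muT tau0 hv Lr0 hLr.
  rewrite /X limf_einfE.
  (* The lower limit is a supremum over neighbourhoods of infima; V is a neighbourhood on which the
     quotient is at least [Lr]. *)
  pose V := [set eps : R | 0 < eps /\ ((Lr * eps)%:E <= LN 6%:E U (fun x => (ve eps x - v x)%R))%E].
  apply: le_trans (ereal_sup_ubound _); last first.
    exists V; last by reflexivity.
    near=> eps; split; first by near: eps; exact: nbhs_right_gt.
    have [[mve _] h0] : inLp 6%:E U (ve eps) /\
        {ae mu, forall x, holes U T eps x -> ve eps x = 0} by near: eps.
    have : forall u : R3 R -> 'cV[R]_3,
      (forall i, measurable_fun U (fun x => u x i 0)) ->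
      {ae mu, forall x, holes U T eps x -> u x = 0} ->
      ((Lr * eps)%:E <= LN 6%:E U (fun x => (u x - v x)%R))%E by near: eps.
    by apply => // i.
  apply: le_ereal_inf_tmp => _ [eps [e0 h] <-].
  have -> : Lr = eps^-1 * (Lr * eps) by rewrite mulrCA mulVf ?mulr1 // gt_eqF.
  by rewrite EFinM; apply: lee_wpmul2l => //; rewrite lee_fin invr_ge0 ltW.
rewrite leNgt; apply/negP => Xa.
have a0 : (0 <= a)%E by rewrite mule_ge0 // ?poweR_ge0 // /LN Lnorm_ge0.
have X0 : (0 <= X)%E.
  have [_|an0] := eqVneq a 0%E; last first.
    by apply: (low 0) => //; rewrite lt_neqAle eq_sym an0.
  rewrite /X limf_einfE; apply: le_trans (ereal_sup_ubound _); last first.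
    exists [set eps : R | 0 < eps]; last by reflexivity.
    exact: nbhs_right_gt.
  apply: le_ereal_inf_tmp => _ [eps e0 <-].
  by apply: mule_ge0; [rewrite lee_fin invr_ge0 ltW|exact: Lnorm_ge0].
(* A finite X below a contradicts [low] at a real number strictly between: the midpoint if a is
   finite, x + 1 otherwise. *)
move: Xa low X0; case: X => [x| |] //; case: a a0 => [b| |] // b0; rewrite ?lte_fin => xa low x0.
- have := low ((x + b) / 2); rewrite !lte_fin !lee_fin => /(_ _ _)/wrap[].
  + by rewrite lee_fin in x0; lra.
  + by lra.
  + by lra.
- have := low (x + 1); rewrite !lee_fin in x0 * => /(_ _ _)/wrap[]; first by lra.
  + by rewrite ltey.
  + by lra.
Unshelve. all: by end_near. Qed.

End LiminfBound.

(** * The cell problem *)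

Lemma Ck_comp (R : realType) (V : normedModType R) k (h : R -> R) (s : V -> R) :
  Ck k h -> Ck k s -> Ck k (fun x => h (s x)).
Proof.
elim: k h => [|k IH] h hh hs.
  split=> // x; apply: continuous_comp; first exact: (Ck_cont hs).
  exact: (Ck_cont hh).
apply: CkS_intro.
  by move=> x; apply: continuous_comp; [exact: (Ck_cont hs)|exact: (Ck_cont hh)].
move=> w; exists (fun x => 'D_(1 : R) h (s x) * 'D_w s x).
  by move=> x; apply: is_derive_chain; [exact: (Ck_is_derive _ _ hh)|exact: (Ck_is_derive _ _ hs)].
apply: Ck_mul; last exact: Ck_derive.
by apply: (IH (fun t => 'D_(1 : R) h t)); [exact: Ck_derive|exact: CkW].
Qed.

(** * A divergence-free cut-off field *)

Section SolenoidalCutoff.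
Context {R : realType}.
Local Notation mu := (@mu3 R).
Implicit Types (U D : set (R3 R)) (x : R3 R).

(** A smooth step from 0 for t <= 1 to 1 for t >= 2: [flat 0] takes the value exp(-1) at 1, so the
    inner difference is nonpositive from t = 2 on, and the division normalizes the value for t <=
    1. *)
Definition cut (t : R) : R :=
  1 - flat 0 (expR (-1) - flat 0 (t - 1)) * (flat 0 (expR (-1)))^-1.

Definition cut1 (t : R) : R := 'D_(1 : R) cut t.

Lemma flat0_expRN1 : flat 0 (expR (-1)) != 0 :> R.
Proof. by rewrite gt_eqF // flat_gt0 // expR_gt0. Qed.

Lemma cut_le1 t : t <= 1 -> cut t = 0.
Proof.
move=> t1; rewrite /cut (@flat_le0 _ 0 (t - 1)) ?subr_le0 // subr0 divff ?subrr //.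
exact: flat0_expRN1.
Qed.

Lemma cut_ge2 t : 2 <= t -> cut t = 1.
Proof.
move=> t2; rewrite /cut (@flat_le0 _ 0 (_ - _)) ?mul0r ?subr0 //.
have t1 : 0 < t - 1 by lra.
rewrite subr_le0 /flat t1 expr0 invr1 mul1r ler_expR lerN2.
by rewrite invf_le1 //; lra.
Qed.

Lemma Ck_cut n : Ck n cut.
Proof.
have Ckid m : Ck m (fun t : R => t).
  elim: m => [|m IH]; first by split=> // t; exact: cvg_id.
  apply: CkS_intro; first by move=> t; exact: cvg_id.
  move=> w; exists (fun=> w); last exact: Ck_cst.
  by move=> t; exact: is_derive_id.
apply: Ck_add; first exact: Ck_cst.
rewrite (_ : (fun _ => _) = fun t : R => - (flat 0 (expR (-1)))^-1 * flat 0 (expR (-1) + (- 1) * flat 0 (t + (- 1)))); last first.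
  by apply/funext => t; rewrite mulN1r mulNr mulrC.
apply: Ck_mul; first exact: Ck_cst.
apply: Ck_flat; apply: Ck_add; first exact: Ck_cst.
apply: Ck_mul; first exact: Ck_cst.
apply: Ck_flat; apply: Ck_add; [exact: Ckid|exact: Ck_cst].
Qed.

Lemma Ck_cut1 n : Ck n cut1.
Proof. exact: Ck_derive (Ck_cut n.+1). Qed.

Lemma cut1_eq0 t : t < 1 \/ 2 < t -> cut1 t = 0.
Proof.
move=> ht; suff h : \forall s \near t, cut s = cst (cut t) s.
  by rewrite /cut1 (near_eq_derive (1 : R) h) derive_cst.
case: ht => ht.
  near=> s; rewrite /= !cut_le1 ?ltW //; near: s; exact: lt_nbhsl.
near=> s; rewrite /= !cut_ge2 ?ltW //; near: s; exact: lt_nbhsr.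
Unshelve. all: by end_near. Qed.

Definition sqn x : R := co 0 x * co 0 x + co 1 x * co 1 x + co 2 x * co 2 x.

Lemma Ck_sqn n : Ck n sqn.
Proof. by apply: Ck_add; [apply: Ck_add|]; apply: Ck_mul; exact: Ck_co. Qed.

Lemma is_derive_sqn x j : is_derive x (e_ R j) sqn (2 * co j x).
Proof.
rewrite (_ : 2 * co j x = (co 0 x * co 0 (e_ R j) + co 0 (e_ R j) * co 0 x) +
  (co 1 x * co 1 (e_ R j) + co 1 (e_ R j) * co 1 x) +
  (co 2 x * co 2 (e_ R j) + co 2 (e_ R j) * co 2 x)); last first.
  rewrite !co_e; move: j; apply: ord3P; rewrite /=; ring.
by apply: is_derive_fD; [apply: is_derive_fD|]; apply: is_derive_fM; exact: is_derive_co.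
Qed.

(* The curl of a multiple of the vector potential of e_i: it is divergence free,
   vanishes for |x| < 1 and equals e_i for |x|^2 > 2. *)
Definition solcut (i a : 'I_3) x : R :=
  (a == i)%:R * cut (sqn x) +
  cut1 (sqn x) * ((a == i)%:R * sqn x + (- 1) * (co i x * co a x)).

Lemma Ck_solcut n i a : Ck n (solcut i a).
Proof.
have ccut m : Ck m (fun x => cut (sqn x)) by apply: Ck_comp; [exact: Ck_cut|exact: Ck_sqn].
have ccut1 m : Ck m (fun x => cut1 (sqn x)) by apply: Ck_comp; [exact: Ck_cut1|exact: Ck_sqn].
apply: Ck_add; apply: Ck_mul => //; first exact: Ck_cst.
by apply: Ck_add; apply: Ck_mul; try exact: Ck_cst; [exact: Ck_sqn|apply: Ck_mul; exact: Ck_co].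
Qed.

Lemma solcut_in i a x : sqn x < 1 -> solcut i a x = 0.
Proof.
by move=> h; rewrite /solcut cut_le1 ?(ltW h) // cut1_eq0 ?mul0r ?mulr0 ?addr0 //; left.
Qed.

Lemma solcut_out i a x : 2 < sqn x -> solcut i a x = (a == i)%:R.
Proof.
by move=> h; rewrite /solcut cut_ge2 ?(ltW h) // cut1_eq0 ?mul0r ?mulr1 ?addr0 //; right.
Qed.

(** The terms in [cut1] have total coefficient 2 x_i + 2 x_i - 3 x_i - x_i = 0; those in its
    derivative cancel because [sqn] is the sum of the x_a^2. *)
Lemma div_solcut i x : \sum_a pd a (solcut i a) x = 0.
Proof.
set t := sqn x.
have d0 j : is_derive x (e_ R j) (fun x => cut (sqn x)) (cut1 t * (2 * co j x)).
  by apply: is_derive_chain (is_derive_sqn x j); exact: (Ck_is_derive _ _ (Ck_cut 1)).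
have d1 j : is_derive x (e_ R j) (fun x => cut1 (sqn x)) ('D_(1 : R) cut1 t * (2 * co j x)).
  by apply: is_derive_chain (is_derive_sqn x j); exact: (Ck_is_derive _ _ (Ck_cut1 1)).
have pdE a : pd a (solcut i a) x = (a == i)%:R * (cut1 t * (2 * co a x)) +
   (cut1 t * ((a == i)%:R * (2 * co a x) - (co i x + (i == a)%:R * co a x)) +
    ('D_(1 : R) cut1 t * (2 * co a x)) * ((a == i)%:R * t - co i x * co a x)).
  have c0 (k : R) : is_derive x (e_ R a) (fun=> k) 0 by exact: is_derive_fcst.
  have := is_derive_fD (is_derive_fM (c0 (a == i)%:R) (d0 a))
    (is_derive_fM (d1 a) (is_derive_fD (is_derive_fM (c0 (a == i)%:R) (is_derive_sqn x a))
      (is_derive_fM (c0 (- 1)) (is_derive_fM (is_derive_co i x (e_ R a)) (is_derive_co a x (e_ R a)))))).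
  move=> h; rewrite /pd (@derive_val _ _ _ _ _ _ _ h) !co_e eqxx -/t /=; ring.
rewrite sum3 !pdE; move: ('D_(1 : R) cut1 t) (cut1 t) => A B.
rewrite /t /sqn {pdE}; move: i; apply: ord3P; rewrite /=; ring.
Qed.

End SolenoidalCutoff.

(** * Gluing of test functions and energy estimates *)

Section EnergyTools.
Context {R : realType}.
Local Notation mu := (@mu3 R).
Implicit Types (U D : set (R3 R)) (f g u : R3 R -> R).

Lemma test_fun_intro U f r : (forall k, Ck k f) -> csupp r f ->
  (forall x, ~ U x -> \forall y \near x, f y = 0) -> test_fun U f.
Proof.
move=> cf sf nf; split=> //; split.
  apply: (@bounded_closure_compact _ _ r) => x /= fx0.
  by apply: contrapT => nx; rewrite sf // eqxx in fx0.
move=> x hx; apply: contrapT => /nf nx.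
by have [y [/= fy0 fy]] := hx _ nx; rewrite fy eqxx in fy0.
Qed.

(** The vanishing of f is required only at nearby points inside D; this makes the extension by 0
    smooth across the boundary whatever f is outside. *)
Lemma glue_test_fun D f r : open D -> D `<=` cube r -> (forall k, Ck k f) ->
  (forall x, ~ D x -> \forall y \near x, D y -> f y = 0) -> test_fun D (zext D f).
Proof.
move=> oD Dr cf nf; apply: (@test_fun_intro _ _ r).
- move=> k; apply: Ck_local => x; have [Dx|nDx] := pselect (D x).
    exists f => //; have : \forall y \near x, D y by exact: open_nbhs_nbhs.
    by apply: filterS => y Dy; rewrite /zext mem_set.
  exists (fun=> 0); first exact: Ck_cst.
  apply: filterS (nf x nDx) => y hy; rewrite /zext; case: ifPn => // /set_mem Dy.
  by rewrite hy.
- move=> x nx; rewrite /zext; case: ifPn => // /set_mem /Dr //.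
- move=> x nDx; apply: filterS (nf x nDx) => y hy; rewrite /zext.
  by case: ifPn => // /set_mem Dy; rewrite hy.
Qed.

Lemma test_funD U f g : test_fun U f -> test_fun U g -> test_fun U (fun x => f x + g x).
Proof.
move=> tf tg; have [r1 r10 [s1 _]] := test_fun_csupp tf; have [r2 r20 [s2 _]] := test_fun_csupp tg.
apply: (@test_fun_intro _ _ (Num.max r1 r2)).
- by move=> k; apply: Ck_add; [exact: test_fun_Ck tf|exact: test_fun_Ck tg].
- move=> x nx; rewrite s1 ?s2 ?addr0 // => /cubeP h; apply: nx; apply/cubeP => i;
    by rewrite le_max h ?orbT.
have near0 h : test_fun U h -> forall x, ~ U x -> \forall y \near x, h y = 0.
  move=> [_ [_ sh]] x nUx.
  have : ~ closure [set x | h x != 0] x by move=> /sh.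
  rewrite -[~ _]/((~` closure _) x) => nx.
  have : nbhs x (~` closure [set x | h x != 0]).
    by apply: open_nbhs_nbhs; split => //; apply: closed_openC; exact: closed_closure.
  apply: filterS => y ny; apply/eqP/negPn/negP => hy; apply: ny.
  exact: subset_closure.
move=> x nUx; have n1 := near0 _ tf x nUx; have n2 := near0 _ tg x nUx.
by apply: filterS2 n1 n2 => y -> ->; rewrite addr0.
Qed.

Lemma eq_sqint U f g : (forall x, U x -> f x = g x) -> sqint U f = sqint U g.
Proof. by move=> h; apply: eq_integral => x /set_mem Ux; rewrite h. Qed.

(** Serves to change the lift of the boundary values: two lifts that agree near the boundary differ
    by a test function. *)
Lemma H10s_add_test U u (g : 'I_3 -> R3 R -> R) u' (g' : 'I_3 -> R3 R -> R) eta : H10s U u g -> test_fun U eta ->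
  measurable U -> (forall x, U x -> u' x = u x + eta x) ->
  (forall j x, U x -> g' j x = g j x + pd j eta x) -> H10s U u' g'.
Proof.
move=> [mu_ mg h] te mU hu hg; have [le lde] := test_fun_L2 mU te.
split.
- apply: (eq_measurable_fun (fun x => u x + eta x)); last exact: measurable_funD mu_ le.1.
  by move=> x /set_mem Ux; rewrite hu.
- move=> j; apply: (eq_measurable_fun (fun x => g j x + pd j eta x)).
    by move=> x /set_mem Ux; rewrite hg.
  by apply: measurable_funD => //; exact: (lde j).1.
move=> d d0; have [phi [tphi h1 h2]] := h d d0.
exists (fun x => phi x + eta x); split; first exact: test_funD.
  rewrite (@eq_sqint U _ (fun x => u x - phi x)) // => x Ux; rewrite hu //; ring.
move=> j; rewrite (@eq_sqint U _ (fun x => g j x - pd j phi x)) // => x Ux; rewrite hg //.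
have := is_derive_fD (Ck_is_derive x (e_ R j) (test_fun_Ck 1 tphi))
  (Ck_is_derive x (e_ R j) (test_fun_Ck 1 te)).
by move=> hd; rewrite /pd (@derive_val _ _ _ _ _ _ _ hd); ring.
Qed.

Lemma Rintegral_sum3 U (F : 'I_3 -> R3 R -> R) : measurable U ->
  (forall a, mu.-integrable U (EFin \o F a)) ->
  \int[mu]_(x in U) (\sum_a F a x) = \sum_a \int[mu]_(x in U) F a x.
Proof.
move=> mU iF; rewrite sum3.
have i01 := @integrableD _ _ _ mu U mU _ _ (iF 0) (iF 1).
transitivity (\int[mu]_(x in U) ((F 0 x + F 1 x) + F 2 x)).
  by congr (Rintegral _ _ _); apply/funext => x; rewrite sum3.
by rewrite (@RintegralD _ _ _ mu U _ _ mU i01 (iF 2)) (@RintegralD _ _ _ mu U _ _ mU (iF 0) (iF 1)).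
Qed.

Lemma integrable_sum3 U (F : 'I_3 -> R3 R -> R) : measurable U ->
  (forall a, mu.-integrable U (EFin \o F a)) ->
  mu.-integrable U (EFin \o (fun x => \sum_a F a x)).
Proof.
move=> mU iF.
have := @integrableD _ _ _ mu U mU _ _ (@integrableD _ _ _ mu U mU _ _ (iF 0) (iF 1)) (iF 2).
congr (integrable _ _ _); apply/funext => x; rewrite /= -!EFinD; congr EFin.
by rewrite sum3.
Qed.

Lemma ae_eq_Rintegral U f g : measurable U -> measurable_fun U f -> measurable_fun U g ->
  {ae mu, forall x, U x -> f x = g x} -> \int[mu]_(x in U) f x = \int[mu]_(x in U) g x.
Proof.
move=> mU mf mg h; congr fine.
apply: (@ae_eq_integral _ _ _ mu _ _ _ mU); [exact/measurable_EFinP|exact/measurable_EFinP|].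
by apply: filterS h => x hx Ux; rewrite hx.
Qed.

(** Here w is the gradient of the solution and p that of the lift. Q multiplies the trace of w - p,
    which vanishes, so w : (w - p) has integral 0; then |w|^2 <= |p|^2 + 2 w : (w - p) is
    integrated. *)
Lemma energy_bound D (w p : 'I_3 -> 'I_3 -> R3 R -> R) (Q : R3 R -> R) : measurable D ->
  (forall a j, L2 D (w a j)) -> (forall a j, L2 D (p a j)) -> L2 D Q ->
  (forall a, \int[mu]_(x in D) (\sum_j (w a j x - Q x * (j == a)%:R) * (w a j x - p a j x)) = 0) ->
  {ae mu, forall x, D x -> \sum_a w a a x = 0} ->
  (forall x, \sum_a p a a x = 0) ->
  forall a j, (sqint D (w a j) <= \int[mu]_(x in D) (\sum_a \sum_j (p a j x) ^+ 2)%:E)%E.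
Proof.
move=> mD lw lp lQ h0 divw divp a j.
have lb a1 j1 : L2 D (fun x => w a1 j1 x - Q x * (j1 == a1)%:R).
  apply: L2B => //; case: (j1 == a1).
    by under [X in L2 _ X]eq_fun do rewrite mulr1.
  under [X in L2 _ X]eq_fun do rewrite mulr0.
  split; first exact: measurable_cst.
  rewrite /sqint (eq_integral (cst 0%E)) ?integral0 // => x _.
  by rewrite /= expr0n.
have lwp a1 j1 : L2 D (fun x => w a1 j1 x - p a1 j1 x) by exact: L2B.
have iS a1 := L2_sum_integrable mD (lb a1) (lwp a1).
have iw a1 := L2_sum_integrable mD (lw a1) (lwp a1).
have S0 : \int[mu]_(x in D) (\sum_a1 \sum_j1 w a1 j1 x * (w a1 j1 x - p a1 j1 x)) = 0.
  transitivity (\int[mu]_(x in D)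
     (\sum_a1 \sum_j1 (w a1 j1 x - Q x * (j1 == a1)%:R) * (w a1 j1 x - p a1 j1 x))).
    apply: ae_eq_Rintegral => //.
    - apply: measurable_sum => a1; apply/measurable_EFinP.
      exact: (measurable_int mu (iw a1)).
    - apply: measurable_sum => a1; apply/measurable_EFinP.
      exact: (measurable_int mu (iS a1)).
    apply: filterS divw => x hx Dx; have := hx Dx; have := divp x.
    rewrite !sum3 /= => e1 e2; rewrite !mulr1 !mulr0 !subr0.
    have e3 : w 2 2 x = - (w 0 0 x + w 1 1 x) by lra.
    have e4 : p 2 2 x = - (p 0 0 x + p 1 1 x) by lra.
    by rewrite e3 e4; ring.
  by rewrite Rintegral_sum3 // big1.
have iww a1 := L2_sum_integrable mD (lw a1) (lw a1).
have ipp a1 := L2_sum_integrable mD (lp a1) (lp a1).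
pose W x := \sum_a1 \sum_j1 w a1 j1 x * w a1 j1 x.
pose P x := \sum_a1 \sum_j1 p a1 j1 x * p a1 j1 x.
pose S x := \sum_a1 \sum_j1 w a1 j1 x * (w a1 j1 x - p a1 j1 x).
have iW : mu.-integrable D (EFin \o W) := integrable_sum3 mD iww.
have iP : mu.-integrable D (EFin \o P) := integrable_sum3 mD ipp.
have iSS : mu.-integrable D (EFin \o S) := integrable_sum3 mD iw.
have WPS : (\int[mu]_(x in D) (W x)%:E <= \int[mu]_(x in D) (P x)%:E)%E.
  have fin G : mu.-integrable D (EFin \o G) -> (\int[mu]_(x in D) (G x)%:E = (\int[mu]_(x in D) G x)%:E)%E.
    by move=> iG; rewrite /Rintegral fineK //; exact: (@integrable_fin_num _ _ _ mu D mD _ iG).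
  have i2 := @integrableD _ _ _ mu D mD _ _ iSS iSS.
  have i4 := @integrableD _ _ _ mu D mD _ _ iP i2.
  apply: (@le_trans _ _ (\int[mu]_(x in D) (P x + (S x + S x))%:E)%E).
    apply: ge0_le_integral_nomeas => x _; rewrite lee_fin.
      by apply: sumr_ge0 => a1 _; apply: sumr_ge0 => j1 _; rewrite -expr2 sqr_ge0.
    rewrite /W /P /S -!big_split /=; apply: ler_sum => a1 _.
    rewrite -!big_split /=; apply: ler_sum => j1 _.
    by rewrite -subr_ge0; have := sqr_ge0 (w a1 j1 x - p a1 j1 x); congr (_ <= _); ring.
  rewrite fin // (@RintegralD _ _ _ mu D _ _ mD iP i2) (@RintegralD _ _ _ mu D _ _ mD iSS iSS).
  by rewrite [\int[mu]_(x in D) S x]S0 !addr0 fin.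
apply: (@le_trans _ _ (\int[mu]_(x in D) (W x)%:E)%E).
  apply: ge0_le_integral_nomeas => x _; rewrite lee_fin ?sqr_ge0 //.
  rewrite /W (bigD1 a) //= (bigD1 j) //= -expr2 -addrA lerDl addr_ge0 //.
    by apply: sumr_ge0 => j1 _; rewrite -expr2 sqr_ge0.
  by apply: sumr_ge0 => a1 _; apply: sumr_ge0 => j1 _; rewrite -expr2 sqr_ge0.
apply: le_trans WPS _; apply: ge0_le_integral_nomeas => x _; rewrite lee_fin.
  by apply: sumr_ge0 => a1 _; apply: sumr_ge0 => j1 _; rewrite -expr2 sqr_ge0.
by apply: ler_sum => a1 _; apply: ler_sum => j1 _; rewrite expr2.
Qed.

Lemma integral_grad_mul U (phi psi : R3 R -> R) j : measurable U -> Ck 1 phi -> test_fun U psi ->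
  \int[mu]_(x in U) (pd j phi x * psi x + phi x * pd j psi x) = 0.
Proof.
move=> mU cphi tpsi.
have e x : pd j (fun y => phi y * psi y) x = pd j phi x * psi x + phi x * pd j psi x.
  have hd := is_derive_fM (Ck_is_derive x (e_ R j) cphi)
    (Ck_is_derive x (e_ R j) (test_fun_Ck 1 tpsi)).
  by rewrite /pd (@derive_val _ _ _ _ _ _ _ hd) addrC.
rewrite /Rintegral -(@integral_sub_support _ setT U) //.
  have := integral_pd_mul j cphi tpsi.
  rewrite (_ : (fun x => (pd j (fun y => phi y * psi y) x)%:E) =
     fun x => (pd j phi x * psi x + phi x * pd j psi x)%:E); last by apply/funext => x; rewrite e.
  by move=> ->.
by move=> x _ nUx; have [-> h] := test_fun_out tpsi nUx; rewrite /pd h !mulr0 addr0.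
Qed.

(* Integration by parts for a limit of test functions, summed over components. *)
Lemma H10s_weak_div D (u : 'I_3 -> R3 R -> R) (g : 'I_3 -> 'I_3 -> R3 R -> R) phi :
  measurable D -> (forall a, H10s D (u a) (g a)) ->
  {ae mu, forall x, D x -> \sum_a g a a x = 0} -> test_fun setT phi ->
  \int[mu]_(x in D) (\sum_a u a x * pd a phi x) = 0.
Proof.
move=> mD hug hdiv tphi.
have [lphi lpd] := test_fun_L2 mD tphi.
have lu a := (H10s_L2 mD (hug a)).1; have lg a j := (H10s_L2 mD (hug a)).2 j.
have ld (a j : 'I_3) : L2 D (fun x => (j == a)%:R * phi x).
  case: (j == a); first by under [X in L2 _ X]eq_fun do rewrite mul1r.
  under [X in L2 _ X]eq_fun do rewrite mul0r.
  split; first exact: measurable_cst.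
  rewrite /sqint (eq_integral (cst 0%E)) ?integral0 // => x _.
  by rewrite /= expr0n.
have delta a (F : 'I_3 -> R) (k : R) : \sum_j (j == a)%:R * k * F j = k * F a.
  by rewrite sum3; move: a; apply: ord3P; rewrite /=; ring.
have h a : \int[mu]_(x in D) (u a x * pd a phi x + phi x * g a a x) = 0.
  have := @H10s_lim _ D (u a) (pd a phi) (g a) (fun j x => (j == a)%:R * phi x) mD (hug a) (lpd a) (ld a).
  have e (A B : R3 R -> R) : A = B -> \int[mu]_(x in D) A x = 0 -> \int[mu]_(x in D) B x = 0.
    by move=> ->.
  move=> /(_ _)/wrap[].
    move=> psi tpsi; apply: e (integral_grad_mul a mD (test_fun_Ck 1 tphi) tpsi).
    by apply/funext => x; rewrite delta.
  by apply: e; apply/funext => x; rewrite delta mulrC.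
have i1 a := L2_mul_integrable mD (lu a) (lpd a).
have i2 a := L2_mul_integrable mD lphi (lg a a).
have i12 a := @integrableD _ _ _ mu D mD _ _ (i1 a) (i2 a).
transitivity (\int[mu]_(x in D) (\sum_a (u a x * pd a phi x + phi x * g a a x))).
  apply: ae_eq_Rintegral => //.
  - by apply: measurable_sum => a; apply/measurable_EFinP; exact: (measurable_int mu (i1 a)).
  - by apply: measurable_sum => a; apply/measurable_EFinP; exact: (measurable_int mu (i12 a)).
  apply: filterS hdiv => x hx Dx.
  by rewrite big_split /= -mulr_sumr hx // mulr0 addr0.
by rewrite Rintegral_sum3 // big1.
Qed.

End EnergyTools.

(** * The Stokes problem in an annulus *)

Section Stokes.
Context {R : realType}.
Local Notation mu := (@mu3 R).
Implicit Types (U D T : set (R3 R)).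

Lemma enorm_ge0 (x : R3 R) : 0 <= enorm x.
Proof. exact: frob_ge0. Qed.

Lemma enorm_sqr (x : R3 R) : enorm x ^+ 2 = sqn x.
Proof. by rewrite frob_sqr sum3 !big_ord1 !expr2. Qed.

Lemma eballP (c x : R3 R) (r : R) : 0 < r -> eball c r x <-> sqn (x - c) < r ^+ 2.
Proof.
move=> r0; rewrite /eball /= -enorm_sqr; split => h.
  by rewrite ltr_pXn2r ?nnegrE ?enorm_ge0 ?(ltW r0).
by rewrite -(ltr_pXn2r (n := 2)) ?nnegrE ?enorm_ge0 ?(ltW r0).
Qed.

Lemma near_sqn_lt (x : R3 R) (t : R) : sqn x < t -> \forall y \near x, sqn y < t.
Proof.
move=> h; have c : continuous (@sqn R) := Ck_cont (Ck_sqn 0).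
exact: (c x _ (lt_nbhsl h)).
Qed.

Lemma near_sqn_gt (x : R3 R) (t : R) : t < sqn x -> \forall y \near x, t < sqn y.
Proof.
move=> h; have c : continuous (@sqn R) := Ck_cont (Ck_sqn 0).
exact: (c x _ (lt_nbhsr h)).
Qed.

Lemma sqn_cube (x : R3 R) (r : R) : 0 <= r -> sqn x <= r ^+ 2 -> cube r x.
Proof.
move=> r0; rewrite -enorm_sqr => h; apply/cubeP => i.
apply: le_trans (abs_entry_le_frob (vec x) i 0) _.
by rewrite -(ler_pXn2r (n := 2)) ?nnegrE // enorm_ge0.
Qed.

Lemma open_annulus T (r : R) : 0 < r -> open (annulus T r).
Proof.
move=> r0; rewrite /annulus setDE; apply: openI; last first.
  by apply: closed_openC; exact: closed_closure.
rewrite openE => x /(eballP _ _ r0); rewrite subr0 => /near_sqn_lt.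
by apply: filterS => y hy; apply/(eballP _ _ r0); rewrite subr0.
Qed.

(** Subtracting e_i makes the cut-off compactly supported without changing its gradient. *)
Definition tau (i a : 'I_3) (x : R3 R) : R := solcut i a x + (- (a == i)%:R).

Lemma Ck_tau n i a : Ck n (tau i a).
Proof. by apply: Ck_add; [exact: Ck_solcut|exact: Ck_cst]. Qed.

Lemma pd_tau j i a x : pd j (tau i a) x = pd j (solcut i a) x.
Proof.
have hd := is_derive_fD (Ck_is_derive x (e_ R j) (Ck_solcut 1 i a))
  (is_derive_fcst (- (a == i)%:R : R) x (e_ R j)).
by rewrite /pd (@derive_val _ _ _ _ _ _ _ hd) addr0.
Qed.

Lemma div_tau i x : \sum_a pd a (tau i a) x = 0.
Proof. by under eq_bigr do rewrite pd_tau; exact: div_solcut. Qed.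

Lemma csupp_tau i a : csupp 2 (tau i a).
Proof.
move=> x nx; rewrite /tau solcut_out ?subrr // ltNge; apply/negP => h; apply: nx.
by apply: sqn_cube => //; apply: le_trans h _; lra.
Qed.

Lemma test_tau i a : test_fun setT (tau i a).
Proof.
apply: (@test_fun_intro _ _ _ 2); [by move=> k; exact: Ck_tau|exact: csupp_tau|].
by move=> x /= h; exfalso; apply: h.
Qed.

(* The velocity of the cell problem minus e_i, extended by its boundary values. *)
Definition corr T (r : R) i (V : R3 R -> 'cV[R]_3) (a : 'I_3) (x : R3 R) : R :=
  if x \in annulus T r then V x a 0 - (a == i)%:R
  else if x \in closure T then - (a == i)%:R else 0.

(** Separates an H^1_0 function extended by 0 from a fixed test function. It uses that the cut-off
    is 0 on the hole and e_i outside the ball of radius r >= 4. *)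
Lemma corrE T (r : R) i V a x : closure T `<=` eball 0 (1/8) -> 4 <= r ->
  corr T r i V a x = zext (annulus T r) (fun y => V y a 0 - solcut i a y) x + tau i a x.
Proof.
move=> sT r4; rewrite /corr /zext /tau.
have [xD|xD] := boolP (x \in annulus T r); first by ring.
have [xT|xT] := boolP (x \in closure T); rewrite add0r.
  have /set_mem /sT /(eballP _ _ _) := xT; rewrite subr0 => h.
  rewrite solcut_in ?add0r //; apply: lt_le_trans (h _) _; lra.
rewrite solcut_out ?subrr // ltNge; apply/negP => h.
move: xD; rewrite notin_setE; apply; split; last by rewrite notin_setE in xT.
apply/eballP; first by lra.
by rewrite subr0; apply: le_lt_trans h _; nra.
Qed.

Lemma L2_0 U : L2 U (fun=> 0 : R).
Proof.
split; first exact: measurable_cst.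
rewrite /sqint (eq_integral (cst 0%E)) ?integral0 // => x _.
by rewrite /= expr0n.
Qed.

Lemma test_fun0 U : test_fun U (fun=> 0 : R).
Proof.
apply: (@test_fun_intro _ _ _ 1); [by move=> k; exact: Ck_cst|by []|].
by move=> x _; near=> y.
Unshelve. all: by end_near.
Qed.

Section Cell.
Variables (T : set (R3 R)) (r : R) (i : 'I_3) (V : R3 R -> 'cV[R]_3) (Q : R3 R -> R).
Hypotheses (sT : closure T `<=` eball 0 (1/8)) (r4 : 4 <= r) (hV : stokes_cell T r i V Q).
Local Notation D := (annulus T r).

Let r0 : 0 < r. Proof. by apply: lt_le_trans r4. Qed.
Let oD : open D. Proof. exact: open_annulus. Qed.
Let mD : measurable D. Proof. exact: open_measurable3. Qed.

(** The lift g supplied by the weak solution is arbitrary away from the boundary, so it is replaced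
    by the fixed cut-off. Both are 0 near the hole and e_i near the outer sphere, hence g - [solcut]
    extended by 0 is a test function of the annulus. *)
Lemma stokes_H10s a : H10s D (fun x => V x a 0 - solcut i a x)
  (fun j x => wgrad D V x a j - pd j (tau i a) x).
Proof.
have [[_ exV _] _ _ _ [g [cg [A1 [oA1 sA1 gA1]] [A2 [oA2 sA2 gA2]] hz]]] := hV.
have zE : (fun x => (V x - g x) a 0) = (fun x => V x a 0 - g x a 0).
  by apply/funext => x; rewrite !mxE.
have h1 : H10s D (fun x => V x a 0 - g x a 0) (fun j x => wgrad D V x a j - pd j (fun y => g y a 0) x).
  rewrite -zE; apply: (inH10_H10s_gen oD hz) => j; rewrite zE.
  have := is_weak_partialB oD (weak_partialP (exV a j)) (is_weak_partial_smooth j oD (cg a 1)).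
  by congr is_weak_partial; apply/funext => x; rewrite mxE.
pose f x := g x a 0 + (- 1) * solcut i a x.
have cf k : Ck k f.
  apply: Ck_add; first exact: cg.
  by apply: Ck_mul; [exact: Ck_cst|exact: Ck_solcut].
have te : test_fun D (zext D f).
  apply: (@glue_test_fun _ _ _ r) => //.
    by move=> x [/(eballP _ _ r0) h _]; apply: sqn_cube; rewrite ?ltW // -[x]subr0.
  move=> x nDx; have [xT|xT] := pselect (closure T x).
    have n1 : \forall y \near x, A1 y by apply: open_nbhs_nbhs; split => //; exact: sA1.
    have n2 : \forall y \near x, sqn y < 1.
      have /sT /(eballP _ _ _) := xT; rewrite subr0 => h.
      by apply: near_sqn_lt; apply: lt_le_trans (h _) _; lra.
    apply: filterS2 n1 n2 => y y1 y2 _.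
    by rewrite /f gA1 // solcut_in // mxE mulr0 addr0.
  have rx : r ^+ 2 <= sqn x.
    rewrite leNgt; apply/negP => h; apply: nDx; split => //.
    by apply/(eballP _ _ r0); rewrite subr0.
  move: rx; rewrite le_eqVlt => /orP[/eqP rx|rx].
    have n1 : \forall y \near x, A2 y.
      apply: open_nbhs_nbhs; split => //; apply: sA2 => /=.
      apply/eqP; rewrite -(eqrXn2 (n := 2)) ?enorm_sqr ?rx //; first exact: enorm_ge0.
      exact: ltW.
    have n2 : \forall y \near x, 2 < sqn y.
      apply: near_sqn_gt; rewrite -rx; apply: (@lt_le_trans _ _ (4 ^+ 2 : R)).
        by rewrite -natrX ltr_nat.
      by rewrite ler_pXn2r ?nnegrE ?(ltW r0).
    apply: filterS2 n1 n2 => y y1 y2 _.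
    by rewrite /f gA2 // solcut_out // mxE eqxx andbT mulN1r subrr.
  apply: filterS (near_sqn_gt rx) => y hy [/(eballP _ _ r0)].
  by rewrite subr0 => h; have := lt_trans h hy; rewrite ltxx.
apply: (H10s_add_test h1 te mD).
  by move=> x Dx; rewrite /zext mem_set // /f; ring.
move=> j x Dx; rewrite pd_tau.
have nD : \forall y \near x, zext D f y = f y.
  have : \forall y \near x, D y by exact: open_nbhs_nbhs.
  by apply: filterS => y Dy; rewrite /zext mem_set.
have hd := is_derive_fD (Ck_is_derive x (e_ R j) (cg a 1))
  (is_derive_fM (is_derive_fcst (- 1 : R) x (e_ R j)) (Ck_is_derive x (e_ R j) (Ck_solcut 1 i a))).
rewrite {3}/pd (near_eq_derive _ nD) (@derive_val _ _ _ _ _ _ _ hd) /pd; ring.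
Qed.

Lemma stokes_div : {ae mu, forall x, D x ->
  \sum_a (wgrad D V x a a - pd a (tau i a) x) = 0}.
Proof.
have [_ _ _ hd _] := hV; apply: filterS hd => x hx Dx.
by rewrite sumrB div_tau subr0; exact: hx.
Qed.

(** By density the weak formulation may be tested with V - [solcut], component by component; the
    bound then involves the cut-off only. *)
Lemma stokes_energy a j :
  (sqint D (fun x => wgrad D V x a j) <=
   \int[mu]_(x in D) (\sum_a \sum_j (pd j (tau i a) x) ^+ 2)%:E)%E.
Proof.
have [[_ _ lw] lQ weak hd _] := hV.
have lw' a1 j1 := inLp2_L2 a1 j1 lw.
have lp a1 j1 := (test_fun_L2 mD (test_tau i a1)).2 j1.
have lQ' : L2 D Q.
  have := inLp2_L2 0 0 lQ; congr L2; by apply/funext => x; rewrite mxE eqxx mulr1n.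
have lQd (a1 j1 : 'I_3) : L2 D (fun x => wgrad D V x a1 j1 - Q x * (j1 == a1)%:R).
  apply: L2B => //; case: (j1 == a1).
    by under [X in L2 _ X]eq_fun do rewrite mulr1.
  by under [X in L2 _ X]eq_fun do rewrite mulr0; exact: L2_0.
have e (A B : R3 R -> R) : A = B -> \int[mu]_(x in D) A x = 0 -> \int[mu]_(x in D) B x = 0.
  by move=> ->.
apply: (@energy_bound _ D (fun a j x => wgrad D V x a j) (fun a j => pd j (tau i a)) Q);
  [exact: mD|exact: lw'|exact: lp|exact: lQ'| |exact: hd|by move=> x; exact: div_tau].
move=> a1.
have := @H10s_lim _ D _ (fun=> 0) _ (fun j x => wgrad D V x a1 j - Q x * (j == a1)%:R) mD
  (stokes_H10s a1) (L2_0 D) (lQd a1).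
move=> /(_ _)/wrap[].
  move=> phi tphi.
  (* A test field with a single nonzero component turns the vector equation into the scalar one that
     [H10s_lim] extends. *)
  pose Phi (x : R3 R) : 'cV[R]_3 := phi x *: delta_mx a1 0.
  have PhiE b : (fun x => Phi x b 0) = fun x => (b == a1)%:R * phi x.
    by apply/funext => x; rewrite !mxE eqxx andbT mulrC.
  have tPhi : test_field D Phi.
    move=> b; rewrite PhiE; case: (b == a1).
      by under [X in test_fun _ X]eq_fun do rewrite mul1r.
    by under [X in test_fun _ X]eq_fun do rewrite mul0r; exact: test_fun0.
  have pdPhi b j1 x : cgrad Phi x b j1 = (b == a1)%:R * pd j1 phi x.
    rewrite mxE PhiE.
    have hd1 := is_derive_fM (is_derive_fcst ((b == a1)%:R : R) x (e_ R j1))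
      (Ck_is_derive x (e_ R j1) (test_fun_Ck 1 tphi)).
    by rewrite (@derive_val _ _ _ _ _ _ _ hd1) mul0r addr0.
  apply: e (weak Phi tPhi); apply/funext => x.
  rewrite /ddot /mxtrace !sum3 !pdPhi.
  move: (wgrad D V x) (pd 0 phi x) (pd 1 phi x) (pd 2 phi x) (Q x) => M p0 p1 p2 q.
  clear; move: a1; apply: ord3P; rewrite /=; ring.
by apply: e; apply/funext => x; rewrite mul0r add0r.
Qed.

End Cell.
End Stokes.

Section Corrector.
Context {R : realType}.
Local Notation mu := (@mu3 R).
Implicit Types (U D T : set (R3 R)).

Lemma pow6_addr (a b : R) : (a + b) ^+ 6 <= 32 * (a ^+ 6 + b ^+ 6).
Proof.
have e (t : R) : t ^+ 6 = `|t| ^+ 6.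
  by rewrite (_ : 6 = 2 * 3)%N // !exprM real_normK ?num_real.
rewrite (e (a + b)) (e a) (e b); apply: le_trans (pow6_add (normr_ge0 a) (normr_ge0 b)).
by rewrite ler_pXn2r ?nnegrE ?addr_ge0 // ler_normD.
Qed.

Lemma sixth_ge0 (t : R) : 0 <= t ^+ 6.
Proof. by rewrite (_ : 6 = 2 * 3)%N // exprM exprn_ge0 // sqr_ge0. Qed.

Lemma integral_pow6_add U (f g : R3 R -> R) : measurable U -> measurable_fun U f -> measurable_fun U g ->
  (\int[mu]_(x in U) ((f x + g x) ^+ 6)%:E <=
   32%:E * (\int[mu]_(x in U) (f x ^+ 6)%:E + \int[mu]_(x in U) (g x ^+ 6)%:E))%E.
Proof.
move=> mU mf mg.
have m6 (h : R3 R -> R) : measurable_fun U h -> measurable_fun U (fun x => (h x ^+ 6)%:E).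
  by move=> mh; apply/measurable_EFinP; exact: measurable_funX.
have p0 (h : R3 R -> R) x : (0 <= (h x ^+ 6)%:E)%E by rewrite lee_fin sixth_ge0.
apply: (@le_trans _ _ (\int[mu]_(x in U) (32%:E * ((f x ^+ 6)%:E + (g x ^+ 6)%:E)))%E).
  apply: ge0_le_integral_nomeas => x _; first by rewrite lee_fin sixth_ge0.
  by rewrite -EFinD -EFinM lee_fin pow6_addr.
rewrite (@ge0_integralZl_EFin _ _ _ mu U mU); last 3 first.
- by move=> x _; apply: adde_ge0.
- by apply: emeasurable_funD; exact: m6.
- by [].
apply: lee_wpmul2l => //.
rewrite le_eqVlt; apply/orP; left; apply/eqP.
by apply: (@ge0_integralD _ _ _ mu U mU) => //; exact: m6.
Qed.

Lemma integral_zext_pow n D (u : R3 R -> R) :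
  (\int[mu]_x (zext D u x ^+ n.+1)%:E = \int[mu]_(x in D) (u x ^+ n.+1)%:E)%E.
Proof.
rewrite (@integral_sub_support _ setT D) //.
  by apply: eq_integral => x /set_mem Dx; rewrite /zext mem_set.
by move=> x _ nDx; rewrite /zext memNset // expr0n.
Qed.

Lemma tau_L2 i a : L2 setT (@tau R i a) /\ forall j, L2 setT (pd j (@tau R i a)).
Proof. exact: test_fun_L2 measurableT (test_tau i a). Qed.

Definition tau_energy (i : 'I_3) : \bar R :=
  (\int[mu]_x (\sum_a \sum_j (pd j (tau i a) x) ^+ 2)%:E)%E.

Lemma tau_energy_fin i : tau_energy i \is a fin_num.
Proof.
rewrite /tau_energy.
have := @integrable_sum3 R setT (fun a x => \sum_j pd j (tau i a) x * pd j (tau i a) x) measurableT.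
move=> /(_ _)/wrap[].
  by move=> a; exact: L2_sum_integrable measurableT (tau_L2 i a).2 (tau_L2 i a).2.
move=> h; have := @integrable_fin_num _ _ _ mu setT measurableT _ h.
by congr (_ \is a _); apply: eq_integral => x _ /=; congr EFin.
Qed.

(** C0 is built from the fields [tau] alone, so it is uniform in the radius, which tends to infinity
    as eps tends to 0. Membership in L^2 comes with no bound; the quantitative statement is the one
    for sixth powers. *)
Lemma corr_facts : exists2 C0 : R, 0 <= C0 & forall T r i V Q,
  closure T `<=` eball 0 (1/8) -> 4 <= r -> stokes_cell T r i V Q ->
  [/\ forall a, L2 setT (corr T r i V a),
      forall a, (\int[mu]_x (corr T r i V a x ^+ 6)%:E <= C0%:E)%E &
      forall phi, test_fun setT phi ->
        \int[mu]_x (\sum_a corr T r i V a x * pd a phi x) = 0].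
Proof.
have [C C_gt0 sob] := @H10s_sobolev R.
pose E := \sum_i fine (tau_energy i).
have E0 : 0 <= E by apply: sumr_ge0 => i _; apply: fine_ge0; apply: integral_ge0 => x _;
  rewrite lee_fin; apply: sumr_ge0 => a _; apply: sumr_ge0 => j _; exact: sqr_ge0.
pose S6 i a := (\int[mu]_x (tau i a x ^+ 6)%:E)%E.
have S60 i a : (0 <= S6 i a)%E by apply: integral_ge0 => x _; rewrite lee_fin sixth_ge0.
have S6fin i a : S6 i a \is a fin_num.
  by apply: (@csupp_even_fin _ _ 2); [exact: (Ck_cont (Ck_tau 0 i a))|exact: csupp_tau].
pose S := \sum_i \sum_a fine (S6 i a).
have S0 : 0 <= S by apply: sumr_ge0 => i _; apply: sumr_ge0 => a _; exact: fine_ge0.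
(* The gradients of V and of the cut-off have squared norm at most E each, so that of the difference
   has at most 2 E + 2 E; the 1 provides strict positivity. *)
pose K := 4 * E + 1.
have K0 : 0 < K by rewrite ltr_wpDl // mulr_ge0.
exists (32 * (C * K ^+ 3 + S)).
  by rewrite mulr_ge0 // addr_ge0 // mulr_ge0 // ?exprn_ge0 // ltW.
move=> T r i V Q sT r4 hV.
have r0 : 0 < r by apply: lt_le_trans r4.
pose D := annulus T r.
have oD : open D by exact: open_annulus.
have mD : measurable D by exact: open_measurable3.
pose u a x := V x a 0 - solcut i a x.
have hu a := stokes_H10s sT r4 hV a.
have [[_ _ lw] _ _ _ _] := hV.
have lw' a1 j1 := inLp2_L2 a1 j1 lw.
have lp a1 j1 := (test_fun_L2 mD (test_tau i a1)).2 j1.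
have EE (f : R3 R -> R) :
    (sqint D f <= \int[mu]_(x in D) (\sum_a \sum_j (pd j (tau i a) x) ^+ 2)%:E)%E ->
    (sqint D f <= E%:E)%E.
  move=> h; apply: le_trans h _; apply: (@le_trans _ _ (tau_energy i)).
    rewrite /tau_energy; apply: (@ge0_subset_integral _ _ _ mu D setT mD measurableT) => //.
      apply/measurable_EFinP; apply: measurable_sum => a1; apply: measurable_sum => j1.
      by apply: measurable_funX; exact: ((tau_L2 i a1).2 j1).1.
    move=> x _; rewrite lee_fin.
    by apply: sumr_ge0 => a1 _; apply: sumr_ge0 => j1 _; exact: sqr_ge0.
  rewrite -(fineK (tau_energy_fin i)) lee_fin /E (bigD1 i) //= lerDl.
  apply: sumr_ge0 => i1 _; apply: fine_ge0; apply: integral_ge0 => x _.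
  by rewrite lee_fin; apply: sumr_ge0 => a1 _; apply: sumr_ge0 => j1 _; exact: sqr_ge0.
have hw a j : (sqint D (fun x => wgrad D V x a j) <= E%:E)%E.
  by apply: EE; exact: (stokes_energy sT r4 hV).
have hp a j : (sqint D (pd j (tau i a)) <= E%:E)%E.
  apply: EE; apply: ge0_le_integral_nomeas => x _; rewrite lee_fin ?sqr_ge0 //.
  rewrite (bigD1 a) //= (bigD1 j) //= -addrA lerDl addr_ge0 //.
    by apply: sumr_ge0 => j1 _; exact: sqr_ge0.
  by apply: sumr_ge0 => a1 _; apply: sumr_ge0 => j1 _; exact: sqr_ge0.
have hg a j : (sqint D (fun x => (wgrad D V x a j - pd j (tau i a) x)%R) <= K%:E)%E.
  have := sqintD mD (lw' a j).1 (L2N mD (lp a j)).1.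
  rewrite sqintN => h; apply: le_trans h _.
  apply: (@le_trans _ _ (2%:E * E%:E + 2%:E * E%:E)%E).
    by apply: leeD; apply: lee_wpmul2l.
  by rewrite -!EFinM -EFinD lee_fin /K; lra.
have hu6 a := sob D _ _ K mD (hu a) K0 (hg a).
have lu a := (H10s_L2 mD (hu a)).1.
have ltau a := (tau_L2 i a).1.
have lz a : L2 setT (zext D (u a)).
  split; first by apply: measurable_zext => //; exact: (lu a).1.
  by rewrite /sqint (integral_zext_pow 1); exact: (lu a).2.
have cE a : corr T r i V a = fun x => zext D (u a) x + tau i a x.
  by apply/funext => x; rewrite corrE.
split.
- by move=> a; rewrite cE; exact: L2D.
- move=> a; rewrite cE; apply: le_trans (integral_pow6_add measurableT (lz a).1 (ltau a).1) _.
  rewrite EFinM; apply: lee_wpmul2l => //; rewrite EFinD; apply: leeD.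
    by rewrite (integral_zext_pow 5); exact: hu6.
  rewrite -[leLHS]/(S6 i a) -(fineK (S6fin i a)) lee_fin /S (bigD1 i) //= (bigD1 a) //= -addrA lerDl.
  rewrite addr_ge0 //; first by apply: sumr_ge0 => a1 _; exact: fine_ge0.
  by apply: sumr_ge0 => i1 _; apply: sumr_ge0 => a1 _; exact: fine_ge0.
- move=> phi tphi.
  have lpd a := (test_fun_L2 measurableT tphi).2 a.
  have i1 := L2_sum_integrable measurableT lz lpd.
  have i2 := L2_sum_integrable measurableT ltau lpd.
  transitivity (\int[mu]_x ((\sum_a zext D (u a) x * pd a phi x) + (\sum_a tau i a x * pd a phi x))).
    congr (Rintegral _ _ _); apply/funext => x; rewrite -big_split /=.
    by apply: eq_bigr => a _; rewrite cE mulrDl.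
  rewrite (@RintegralD _ _ _ mu setT _ _ measurableT i1 i2).
  (* Here phi may be nonzero on the boundary of the annulus; the integration by parts is made on the
     test functions that approximate V - [solcut]. *)
  have -> : \int[mu]_x (\sum_a zext D (u a) x * pd a phi x) = 0.
    rewrite -[RHS](H10s_weak_div mD hu (stokes_div hV) tphi).
    rewrite /Rintegral (@integral_sub_support _ setT D) //.
      congr fine; apply: eq_integral => x /set_mem Dx; congr EFin.
      by apply: eq_bigr => a _; rewrite /zext mem_set.
    move=> x _ nDx; rewrite big1 // => a _.
    by rewrite /zext memNset // mul0r.
  rewrite add0r.
  have h a := integral_grad_mul a measurableT (Ck_tau 1 i a) tphi.
  have i3 a : mu.-integrable setT (EFin \o (fun x => pd a (tau i a) x * phi x + tau i a x * pd a phi x)).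
    have lphi := (test_fun_L2 measurableT tphi).1.
    have ltd := (tau_L2 i a).2 a.
    exact: (@integrableD _ _ _ mu setT measurableT _ _ (L2_mul_integrable measurableT ltd lphi)
      (L2_mul_integrable measurableT (ltau a) (lpd a))).
  have := Rintegral_sum3 measurableT i3; rewrite big1 => [e|a _]; last exact: h.
  rewrite -[RHS]e.
  congr (Rintegral _ _ _); apply/funext => x.
  by rewrite big_split /= -mulr_suml div_tau mul0r add0r.
Qed.

End Corrector.

(** * Rescaled correctors and the upper bound *)

Section Rescaling.
Context {R : realType}.
Local Notation mu := (@mu3 R).
Implicit Types (c x y w : R3 R) (l : R) (phi f : R3 R -> R).

Lemma derive_aff phi c l y w : 'D_w (fun x => phi (aff c l x)) y = 'D_(l *: w) phi (aff c l y) /\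
  (derivable phi (aff c l y) (l *: w) -> derivable (fun x => phi (aff c l x)) y w).
Proof.
have e : (fun h : R => h^-1 *: (((fun x => phi (aff c l x)) \o shift y) (h *: w) - phi (aff c l y))) =
    (fun h : R => h^-1 *: ((phi \o shift (aff c l y)) (h *: (l *: w)) - phi (aff c l y))).
  apply/funext => h /=; congr (_ *: (phi _ - _)).
  by rewrite !affE scalerDr scalerA mulrC -scalerA addrCA.
by rewrite /derive /derivable e.
Qed.

Lemma continuous_aff c l : continuous (aff c l).
Proof.
rewrite (_ : aff c l = fun x => c + l *: x); last by apply/funext => x; rewrite affE.
by move=> x; apply: cvgD; [exact: cvg_cst|apply: cvgZl_tmp; exact: cvg_id].
Qed.

Lemma Ck_aff k phi c l : Ck k phi -> Ck k (fun x => phi (aff c l x)).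
Proof.
have cc psi : continuous psi -> continuous (fun x => psi (aff c l x) : R).
  by move=> cpsi x; apply: continuous_comp; [exact: continuous_aff|exact: cpsi].
elim: k phi => [|k IH] phi hphi; first by split=> //; exact: cc (Ck_cont hphi).
split; first exact: cc (Ck_cont hphi).
move=> w; split=> [x|].
  by apply: (derive_aff phi c l x w).2; have [_ /(_ (l *: w))[h _]] := hphi.
have e : (fun x => 'D_w (fun x => phi (aff c l x)) x) = fun x => 'D_(l *: w) phi (aff c l x).
  by apply/funext => x; exact: (derive_aff phi c l x w).1.
by rewrite e; apply: (IH (fun x => 'D_(l *: w) phi x)); exact: Ck_derive.
Qed.

(** The derivative in direction l e_j is l times that in direction e_j: s |-> phi (s (l e_j) + x) is
    differentiated at 0 in two ways. *)
Lemma pd_aff phi c l j y : Ck 1 phi -> pd j (fun x => phi (aff c l x)) y = l * pd j phi (aff c l y).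
Proof.
move=> hphi; rewrite /pd (derive_aff phi c l y _).1; set x := aff c l y.
have h1 := is_derive_ray x (l *: e_ R j) (0 : R) hphi.
have h2 := is_derive_chain (is_derive_ray x (e_ R j) (l * 0) hphi)
  (is_derive_fM (is_derive_fcst (l : R) (0 : R) (1 : R)) (is_derive_id (0 : R) (1 : R))).
have e : (fun s : R => phi (s *: (l *: e_ R j) + x)) = fun s : R => phi ((l * s) *: e_ R j + x).
  by apply/funext => s; rewrite scalerA mulrC.
have := @derive_val _ _ _ _ _ _ _ h1; rewrite e (@derive_val _ _ _ _ _ _ _ h2).
by rewrite !mulr0 !scale0r !add0r ?mul0r ?addr0 ?mulr1 mulrC => ->.
Qed.

Lemma test_fun_aff phi c l : 0 < l -> test_fun setT phi -> test_fun setT (fun x => phi (aff c l x)).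
Proof.
move=> l0 tphi; have [r r0 [sp _]] := test_fun_csupp tphi.
apply: (@test_fun_intro _ _ _ (l^-1 * (r + l1 c))).
- by move=> k; apply: Ck_aff; exact: test_fun_Ck tphi.
- move=> x nx; apply: sp => /cubeP h; apply: nx; apply/cubeP => i.
  rewrite ler_pdivlMl //; have := h i; rewrite affE coD coZ => hi.
  have ci : `|co i c| <= l1 c.
    by rewrite /l1; move: i {h hi}; apply: ord3P; have := normr_ge0 (co 0 c);
      have := normr_ge0 (co 1 c); have := normr_ge0 (co 2 c); lra.
  have -> : l * `|co i x| = `|(co i c + l * co i x) - co i c|.
    by rewrite addrAC subrr add0r normrM gtr0_norm.
  exact: le_trans (ler_normB _ _) (lerD hi ci).
- by move=> x h; exfalso; apply: h.
Qed.

Lemma Rintegral_aff c l (F : R3 R -> R) : 0 < l -> mu.-integrable setT (EFin \o F) ->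
  \int[mu]_y F (aff c l y) = (l^-1) ^+ 3 * \int[mu]_x F x.
Proof.
move=> l0 iF; rewrite /Rintegral.
have mF : measurable_fun setT (EFin \o F) := measurable_int mu iF.
have l30 : 0 <= (l^-1) ^+ 3 by rewrite exprn_ge0 // invr_ge0 ltW.
have -> : (\int[mu]_y (F (aff c l y))%:E = ((l^-1) ^+ 3)%:E * \int[mu]_x (F x)%:E)%E.
  rewrite integralE [in RHS]integralE.
  have pE : (fun y => (F (aff c l y))%:E)^\+%E = fun y => ((EFin \o F)^\+%E (aff c l y)).
    by apply/funext => y; rewrite funepos.unlock.
  have nE : (fun y => (F (aff c l y))%:E)^\-%E = fun y => ((EFin \o F)^\-%E (aff c l y)).
    by apply/funext => y; rewrite funeneg.unlock.
  rewrite pE nE.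
  rewrite (ge0_integral_aff c l0 (measurable_funepos mF) (fun x => funepos_ge0 _ x)).
  rewrite (ge0_integral_aff c l0 (measurable_funeneg mF) (fun x => funeneg_ge0 _ x)).
  have hp := @integrable_fin_num _ _ _ mu setT measurableT _ (integrable_funepos measurableT iF).
  apply/esym; apply: (@muleBr _ ((l^-1) ^+ 3)%:E (\int[mu]_x ((EFin \o F)^\+ x))%E
    (\int[mu]_x ((EFin \o F)^\- x))%E) => //.
  exact: fin_num_adde_defr hp.
by rewrite fineM //; exact: (@integrable_fin_num _ _ _ mu setT measurableT _ iF).
Qed.

Definition sc c l f x : R := f (l^-1 *: (x - c)).

Lemma sc_aff c l f y : 0 < l -> sc c l f (aff c l y) = f y.
Proof.
by move=> l0; rewrite /sc affE addrAC subrr add0r scalerA mulVf ?gt_eqF // scale1r.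
Qed.

Lemma measurable_sc c l f : measurable_fun setT f -> measurable_fun setT (sc c l f).
Proof.
move=> mf; rewrite (_ : sc c l f = f \o aff (- (l^-1 *: c)) l^-1).
  by apply: measurableT_comp => //; exact: measurable_aff.
by apply/funext => x; rewrite /sc /= affE scalerBr addrC.
Qed.

Lemma integral_sc_pow n c l f : 0 < l -> measurable_fun setT f -> (forall x, 0 <= f x ^+ n) ->
  (\int[mu]_x (sc c l f x ^+ n)%:E = (l ^+ 3)%:E * \int[mu]_x (f x ^+ n)%:E)%E.
Proof.
move=> l0 mf f0.
apply: (@integral_scaled _ c l setT (fun x => (f x ^+ n)%:E) l0 measurableT).
  by apply/measurable_EFinP; exact: measurable_funX.
by move=> x; rewrite lee_fin.
Qed.

Lemma L2_sc c l f : 0 < l -> L2 setT f -> L2 setT (sc c l f).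
Proof.
move=> l0 [mf hf]; split; first exact: measurable_sc.
rewrite /sqint (integral_sc_pow c l0 mf) => [|x]; last exact: sqr_ge0.
by apply: lte_mul_pinfty => //; rewrite ?lee_fin ?exprn_ge0 // ltW.
Qed.

(** The weak form of div Z = 0 on the whole space: no derivative of Z across the holes or the cell
    spheres is involved, and the property passes to rescalings and finite sums. *)
Definition weakly_solenoidal (Z : 'I_3 -> R3 R -> R) : Prop :=
  (forall a, L2 setT (Z a)) /\
  forall phi, test_fun setT phi -> \int[mu]_x (\sum_a Z a x * pd a phi x) = 0.

Lemma weakly_solenoidal_sc (Z : 'I_3 -> R3 R -> R) c l : 0 < l -> weakly_solenoidal Z ->
  weakly_solenoidal (fun a => sc c l (Z a)).
Proof.
move=> l0 [lZ hZ]; have lZ' a := L2_sc c l0 (lZ a); split=> // phi tphi.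
have lpd a := (test_fun_L2 measurableT tphi).2 a.
have iF := L2_sum_integrable measurableT lZ' lpd.
set F := (fun x => _) in iF.
have h : \int[mu]_y (l * F (aff c l y)) = 0.
  rewrite -[RHS](hZ _ (test_fun_aff c l0 tphi)).
  congr (Rintegral _ _ _); apply/funext => y; rewrite /F mulr_sumr; apply: eq_bigr => a _.
  by rewrite (pd_aff _ _ _ _ (test_fun_Ck 1 tphi)) sc_aff // mulrCA.
have iG : mu.-integrable setT (EFin \o (fun x => l * F x)).
  have := @integrableZl _ _ _ mu setT measurableT l _ iF.
  by congr integrable; apply/funext => x; rewrite /= EFinM.
have := Rintegral_aff c l0 iG; rewrite h (@RintegralZl _ _ _ mu setT F l measurableT iF).
move=> /esym/eqP; rewrite mulrA mulf_eq0 => /orP[|/eqP //].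
by rewrite gt_eqF // mulr_gt0 // exprn_gt0 // invr_gt0.
Qed.

Lemma weakly_solenoidal_sum (I : Type) (s : seq I) (Z : I -> 'I_3 -> R3 R -> R) :
  (forall k, weakly_solenoidal (Z k)) ->
  weakly_solenoidal (fun a x => \sum_(k <- s) Z k a x).
Proof.
move=> hZ; elim: s => [|k s [lS hS]].
  split=> [a|phi tphi].
    by under [X in L2 _ X]eq_fun do rewrite big_nil; exact: L2_0.
  rewrite /Rintegral (eq_integral (cst 0%E)) ?integral0 // => x _.
  by rewrite big1 // => a _; rewrite big_nil mul0r.
have [lk hk] := hZ k; split=> [a|phi tphi].
  by under [X in L2 _ X]eq_fun do rewrite big_cons; exact: L2D.
have lpd a := (test_fun_L2 measurableT tphi).2 a.
have i1 := L2_sum_integrable measurableT lk lpd.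
have i2 := L2_sum_integrable measurableT lS lpd.
transitivity (\int[mu]_x ((\sum_a Z k a x * pd a phi x) + \sum_a (\sum_(k <- s) Z k a x) * pd a phi x)).
  congr (Rintegral _ _ _); apply/funext => x; rewrite -big_split /=.
  by apply: eq_bigr => a _; rewrite big_cons mulrDl.
by rewrite (@RintegralD _ _ _ mu setT _ _ measurableT i1 i2) hk // hS // addr0.
Qed.

Lemma sum_single (I : eqType) (s : seq I) (F : I -> R) k0 : uniq s -> k0 \in s ->
  (forall k, k != k0 -> F k = 0) -> \sum_(k <- s) F k = F k0.
Proof.
by move=> us ks h; rewrite (bigD1_seq k0) //= big1 ?addr0 // => k; exact: h.
Qed.

End Rescaling.

(** * The corrector W - I assembled from the cells *)

Section PerforatedCorrector.
Context {R : realType}.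
Local Notation mu := (@mu3 R).

Variables (U T : set (R3 R)) (V : R -> 'I_3 -> R3 R -> 'cV[R]_3) (eps : R).
Variable (s : seq 'cV[int]_3).
Hypotheses (oU : open U) (sT : closure T `<=` eball 0 (1/8)) (e0 : 0 < eps) (e4 : eps <= 1/4).
Hypotheses (us : uniq s) (cs : cells U eps = [set` s]).
Local Notation r := ((4 * eps ^+ 2)^-1).

Definition cell_corr i a k : R3 R -> R :=
  sc (eps *: lattice R k) (eps ^+ 3) (corr T r i (V r i) a).

(** Entry (a, i) of W - I, with W set to 0 on the closed holes. As a sum over all cells it inherits
    linear properties termwise, although at each point at most one term is nonzero. *)
Definition zeta (i a : 'I_3) (x : R3 R) : R := \sum_(k <- s) cell_corr i a k x.

Let e1 : eps <= 1. Proof. by apply: le_trans e4 _; lra. Qed.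
Let e30 : 0 < eps ^+ 3. Proof. exact: exprn_gt0. Qed.
Let r0 : 0 < r. Proof. by rewrite invr_gt0 mulr_gt0 // exprn_gt0. Qed.

Lemma radius_ge4 : 4 <= r.
Proof.
rewrite -[leLHS]invrK lef_pV2 ?posrE ?mulr_gt0 ?exprn_gt0 ?invr_gt0 //.
by have := e0; have := e4; move=> *; nra.
Qed.

Lemma sqnZ (l : R) (x : R3 R) : sqn (l *: x) = l ^+ 2 * sqn x.
Proof. by rewrite /sqn !coZ; ring. Qed.

(** The radius of the cell problem times the scale eps^3 is exactly eps / 4. *)
Lemma cell_ballP k x : cell_ball eps k x <->
  eball 0 r ((eps ^+ 3)^-1 *: (x - eps *: lattice R k)).
Proof.
have en : eps != 0 by rewrite gt_eqF.
have e40 : 0 < eps / 4 by rewrite divr_gt0.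
rewrite /cell_ball (eballP _ _ e40) (eballP _ _ r0) subr0 sqnZ.
have -> : r ^+ 2 = ((eps ^+ 3)^-1) ^+ 2 * (eps / 4) ^+ 2 by field.
by rewrite ltr_pM2l // exprn_gt0 // invr_gt0.
Qed.

Lemma cell_ball_qcell k x : cell_ball eps k x -> qcell eps k x.
Proof.
move=> h; apply/(qcellP _ _ e0) => i.
have := le_lt_trans (abs_entry_le_frob (vec (x - eps *: lattice R k)) i 0) h.
rewrite -/(co i _) coB coZ co_lattice => hi.
have -> : eps^-1 * co i x - (k i 0)%:~R = eps^-1 * (co i x - eps * (k i 0)%:~R).
  by field; rewrite gt_eqF.
have : `|eps^-1 * (co i x - eps * (k i 0)%:~R)| < 1/4.
  rewrite normrM gtr0_norm ?invr_gt0 // ltr_pdivrMl //.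
  by apply: lt_le_trans hi _; lra.
by rewrite ltr_norml => /andP[? ?]; apply/andP; split; lra.
Qed.

Lemma cell_corr0 i a k x : ~ cell_ball eps k x -> cell_corr i a k x = 0.
Proof.
move=> /cell_ballP h; rewrite /cell_corr /sc /corr; set y := _ *: _ in h *.
rewrite memNset; last by case.
rewrite memNset // => /sT /(eballP _ _ _) hy; apply: h; apply/(eballP _ _ r0).
apply: lt_le_trans (hy _) _ => //; rewrite ler_pXn2r ?nnegrE ?(ltW r0) //.
by apply: le_trans radius_ge4; lra.
Qed.

Lemma zeta_single i a k x : k \in s -> qcell eps k x -> zeta i a x = cell_corr i a k x.
Proof.
move=> ks kx; apply: (sum_single (F := fun k => cell_corr i a k x) us ks) => k' kk.
apply: cell_corr0 => /cell_ball_qcell k'x.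
by rewrite (qcell_inj e0 k'x kx) eqxx in kk.
Qed.

Lemma zeta_out i a x : (forall k, k \in s -> ~ cell_ball eps k x) -> zeta i a x = 0.
Proof.
by move=> h; rewrite /zeta big_seq big1 // => k ks; apply: cell_corr0; exact: h.
Qed.

Lemma closure_holeE k : closure (hole T eps k) = scaled (eps *: lattice R k) (eps ^+ 3) (closure T).
Proof. by rewrite holeE // closure_scaled. Qed.

Lemma zeta_hole i a x : holes U T eps x -> zeta i a x = - (a == i)%:R.
Proof.
move=> [k ck]; rewrite closure_holeE => hx.
have ks : k \in s by move: ck; rewrite cs.
rewrite (zeta_single i a ks); last exact: scaled_small_qcell hx.
rewrite /cell_corr /sc /corr; set y := _ *: _.
have yT : closure T y := hx.
by rewrite memNset; [rewrite mem_set|case].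
Qed.

Lemma WcolE i a x : ~ holes U T eps x ->
  Wcol U T V eps i x a 0 - (a == i)%:R = zeta i a x.
Proof.
move=> nh; rewrite /Wcol; set P := [set k | _ /\ _].
case: (pselect (exists k, P k)) => [[k0 Pk0]|nP]; last first.
  have nPx : ~ P (xget 0 P) by move=> h; apply: nP; exists (xget 0 P).
  rewrite asboolF //= mxE eqxx andbT subrr zeta_out // => k ks kx; apply: nP.
  by exists k; split => //; rewrite cs.
(* Any ball selected by [xget] will do: it lies in one cell, and by disjointness of the cells the
   sum [zeta] reduces to that term. *)
have := xgetPex 0 (ex_intro _ k0 Pk0); set k := xget 0 P => -[ck kx].
have ks : k \in s by move: ck; rewrite cs.
rewrite asboolT //=.
have nT : ~ closure (hole T eps k) x by move=> h; apply: nh; exists k.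
rewrite memNset; last by move=> h; apply: nT; exact: subset_closure.
have hD : annulus T r ((eps ^+ 3)^-1 *: (x - eps *: lattice R k)).
  split; first exact: (cell_ballP k x).1 kx.
  by move=> h; apply: nT; rewrite closure_holeE; exact: h.
by rewrite (zeta_single i a ks (cell_ball_qcell kx)) /cell_corr /sc /corr (mem_set hD).
Qed.

Variable C0 : R.
Hypothesis C00 : 0 <= C0.
Hypothesis ws : forall i, weakly_solenoidal (corr T r i (V r i)).
Hypothesis h6 : forall i a, (\int[mu]_x (corr T r i (V r i) a x ^+ 6)%:E <= C0%:E)%E.

Lemma zeta_solenoidal i : weakly_solenoidal (zeta i).
Proof.
apply: (@weakly_solenoidal_sum R _ s (fun k a => cell_corr i a k)) => k.
exact: weakly_solenoidal_sc.
Qed.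

(** Rescaling gives eps^9 C0 per cell, that is eps^6 C0 times the volume of the cell, and the cells
    are disjoint subsets of U. *)
Lemma integral_zeta6 i a :
  (\int[mu]_x (zeta i a x ^+ 6)%:E <= (eps ^+ 6 * C0)%:E * mu U)%E.
Proof.
have mU := open_measurable3 oU.
have mc k : measurable_fun setT (fun x => (cell_corr i a k x ^+ 6)%:E).
  apply/measurable_EFinP; apply: measurable_funX; apply: measurable_sc.
  exact: ((ws i).1 a).1.
apply: (@le_trans _ _ (\int[mu]_x (\sum_(k <- s) (cell_corr i a k x ^+ 6)%:E))%E).
  apply: ge0_le_integral_nomeas => x _; first by rewrite lee_fin sixth_ge0.
  rewrite sumEFin lee_fin.
  have s0 : 0 <= \sum_(k <- s) cell_corr i a k x ^+ 6.
    by apply: sumr_ge0 => k _; exact: sixth_ge0.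
  have [[k ks kx]|h] := pselect (exists2 k, k \in s & qcell eps k x); last first.
    rewrite zeta_out ?expr0n //= => k ks kx; apply: h; exists k => //.
    exact: cell_ball_qcell.
  rewrite (zeta_single i a ks kx) (bigD1_seq k) //= lerDl.
  by apply: sumr_ge0 => k' _; exact: sixth_ge0.
rewrite (@ge0_integral_sum _ _ _ mu setT measurableT) //; last first.
  by move=> k x _; rewrite lee_fin sixth_ge0.
apply: (@le_trans _ _ (\sum_(k <- s) (eps ^+ 6 * C0)%:E * \int[mu]_(x in qcell eps k) 1)%E).
  apply: lee_sum => k _.
  have -> : (\int[mu]_(x in qcell eps k) 1 = (eps ^+ 3)%:E)%E.
    have /= -> := @integral_cst _ _ _ mu _ (measurable_qcell eps k) 1%E.
    by rewrite mul1e; exact: mu_qcell.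
  rewrite integral_sc_pow //; last 2 first.
  - exact: ((ws i).1 a).1.
  - by move=> x; exact: sixth_ge0.
  rewrite (_ : (eps ^+ 6 * C0)%:E * _ = ((eps ^+ 3) ^+ 3)%:E * C0%:E)%E.
    by apply: lee_wpmul2l => //; rewrite lee_fin exprn_ge0 // ltW.
  by rewrite -!EFinM; congr EFin; ring.
rewrite -ge0_sume_distrr; last by move=> k _; exact: integral_ge0.
apply: lee_wpmul2l; first by rewrite lee_fin mulr_ge0 // exprn_ge0 // ltW.
have := sum_integral_le us (@measurable_qcell _ eps) (trivIset_qcell e0) mU _
  (measurable_cst 1%E) (fun x => lee01).
have /= -> := @integral_cst _ _ _ mu U mU 1%E; rewrite mul1e; apply.
by move=> k ks; apply: (qcell_sub e0); rewrite cs.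
Qed.

(** Deduced from the sixth powers: with t = (z / eps)^2, the inequality t <= 1 + t^3 reads z^2 <=
    eps^2 + eps^-4 z^6, and both terms integrate to order eps^2. *)
Lemma integral_zeta2 i a :
  (sqint U (zeta i a) <= (eps ^+ 2 * (1 + C0))%:E * mu U)%E.
Proof.
have mU := open_measurable3 oU.
have en : eps != 0 by rewrite gt_eqF.
have mz : measurable_fun setT (zeta i a) := ((zeta_solenoidal i).1 a).1.
apply: (@le_trans _ _ (\int[mu]_(x in U) ((eps ^+ 2)%:E + (eps ^- 4)%:E * (zeta i a x ^+ 6)%:E))%E).
  apply: ge0_le_integral_nomeas => x _; rewrite -?EFinM -?EFinD lee_fin ?sqr_ge0 //.
  set z := zeta i a x; pose t := (eps^-1 * z) ^+ 2.
  have t0 : 0 <= t by exact: sqr_ge0.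
  have -> : z ^+ 2 = eps ^+ 2 * t by rewrite /t; field.
  have -> : eps ^+ 2 + eps ^- 4 * z ^+ 6 = eps ^+ 2 * (1 + t ^+ 3) by rewrite /t; field.
  clearbody t; apply: ler_wpM2l; first exact: sqr_ge0.
  have t3 := exprn_ge0 3 t0; case: (lerP t 1) => t1; first by lra.
  have p1 : 0 <= t - 1 by lra.
  have p2 : 0 <= t + 1 by lra.
  have := mulr_ge0 (mulr_ge0 t0 p1) p2; rewrite (_ : t * _ * _ = t ^+ 3 - t); last by ring.
  by move=> ?; lra.
have m6 : measurable_fun U (fun x => (zeta i a x ^+ 6)%:E).
  by apply/measurable_EFinP; apply: measurable_funX; exact: measurable_funTS.
have e4i : 0 <= eps ^- 4 by rewrite invr_ge0 exprn_ge0 // ltW.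
rewrite (@ge0_integralD _ _ _ mu U mU); last 4 first.
- by move=> x _; rewrite lee_fin sqr_ge0.
- exact: measurable_cst.
- by move=> x _; rewrite -EFinM lee_fin mulr_ge0 // sixth_ge0.
- exact: measurable_funeM.
rewrite (@integral_cst _ _ _ mu U mU) (@ge0_integralZl_EFin _ _ _ mu U mU) //; last first.
  by move=> x _; rewrite lee_fin sixth_ge0.
rewrite mulrDr mulr1 EFinD ge0_muleDl; last 2 first.
- by rewrite lee_fin sqr_ge0.
- by rewrite lee_fin mulr_ge0 // sqr_ge0.
apply: leeD => //.
rewrite (_ : (eps ^+ 2 * C0)%:E = (eps ^- 4)%:E * (eps ^+ 6 * C0)%:E)%E; last first.
  by rewrite -EFinM; congr EFin; field.
rewrite -muleA; apply: lee_wpmul2l => //.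
apply: le_trans (integral_zeta6 i a).
apply: (@ge0_subset_integral _ _ _ mu U setT mU measurableT) => //.
  by apply/measurable_EFinP; exact: measurable_funX.
by move=> x _; rewrite lee_fin sixth_ge0.
Qed.

Lemma open_perforated : open (perforated U T eps).
Proof.
rewrite /perforated setDE; apply: openI => //; apply: closed_openC.
rewrite /holes cs bigcup_seq; apply: closed_bigsetU => k _; exact: closed_closure.
Qed.

End PerforatedCorrector.

(** * The error of the restriction operator *)

Section RestrictionError.
Context {R : realType}.
Local Notation mu := (@mu3 R).

(** The constant is 10 = 2 * 4 + 2, from applying [sqintD] twice. *)
Lemma sqint_sum3 (U : set (R3 R)) (f : 'I_3 -> R3 R -> R) (k : R) : measurable U ->
  (forall a, measurable_fun U (f a)) -> (forall a, (sqint U (f a) <= k%:E)%E) ->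
  (sqint U (fun x => (\sum_a f a x)%R) <= (10 * k)%:E)%E.
Proof.
move=> mU mf hf.
rewrite (_ : (fun x => _) = fun x => (f 0 x + f 1 x) + f 2 x); last first.
  by apply/funext => x; rewrite sum3.
apply: le_trans (sqintD mU (measurable_funD (mf 0) (mf 1)) (mf 2)) _.
have h01 : (sqint U (fun x => (f 0%R x + f 1%R x)%R) <= (4 * k)%:E)%E.
  apply: le_trans (sqintD mU (mf 0) (mf 1)) _.
  apply: (@le_trans _ _ (2%:E * k%:E + 2%:E * k%:E)%E); last by rewrite -!EFinM -EFinD lee_fin; lra.
  by apply: leeD; apply: lee_wpmul2l.
apply: (@le_trans _ _ (2%:E * (4 * k)%:E + 2%:E * k%:E)%E); last by rewrite -!EFinM -EFinD lee_fin; lra.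
by apply: leeD; apply: lee_wpmul2l.
Qed.

(** The constant is 2080 = 32 * (64 + 1), from applying [integral_pow6_add] twice. *)
Lemma pow6_sum3 (U : set (R3 R)) (f : 'I_3 -> R3 R -> R) (k : R) : measurable U ->
  (forall a, measurable_fun U (f a)) ->
  (forall a, (\int[mu]_(x in U) (f a x ^+ 6)%:E <= k%:E)%E) ->
  (\int[mu]_(x in U) ((\sum_a f a x) ^+ 6)%:E <= (2080 * k)%:E)%E.
Proof.
move=> mU mf hf.
rewrite (_ : (fun x => _) = fun x => (((f 0 x + f 1 x) + f 2 x) ^+ 6)%:E); last first.
  by apply/funext => x; rewrite sum3.
apply: le_trans (integral_pow6_add mU (measurable_funD (mf 0) (mf 1)) (mf 2)) _.
have h01 : (\int[mu]_(x in U) ((f 0%R x + f 1%R x) ^+ 6)%:E <= (64 * k)%:E)%E.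
  apply: le_trans (integral_pow6_add mU (mf 0) (mf 1)) _.
  apply: (@le_trans _ _ (32%:E * (k%:E + k%:E))%E); last by rewrite -EFinD -EFinM lee_fin; lra.
  by apply: lee_wpmul2l => //; exact: leeD.
apply: (@le_trans _ _ (32%:E * ((64 * k)%:E + k%:E))%E); last by rewrite -EFinD -EFinM lee_fin; lra.
by apply: lee_wpmul2l => //; exact: leeD.
Qed.

(** Used with n = 1 for the divergence datum and with n = 3 for the product (W - I) v. *)
Lemma integral_mul_bounded n (U : set (R3 R)) (f g : R3 R -> R) (M : R) : measurable U ->
  measurable_fun U f -> measurable_fun U g -> 0 <= M ->
  {ae mu, forall x, U x -> `|g x| <= M} ->
  (\int[mu]_(x in U) ((f x * g x) ^+ (2 * n))%:E <=
   (M ^+ (2 * n))%:E * \int[mu]_(x in U) (f x ^+ (2 * n))%:E)%E.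
Proof.
move=> mU mf mg M0 hg.
have ev (t : R) : 0 <= t ^+ (2 * n) by rewrite exprM exprn_ge0 // sqr_ge0.
have mp (h : R3 R -> R) : measurable_fun U h -> measurable_fun U (fun x => (h x ^+ (2 * n))%:E).
  by move=> mh; apply/measurable_EFinP; exact: measurable_funX.
rewrite -(@ge0_integralZl_EFin _ _ _ mu U mU); last 3 first.
- by move=> x _; rewrite lee_fin.
- exact: mp.
- exact: ev.
apply: (@ae_ge0_le_integral _ _ _ mu U mU).
- by move=> x _; rewrite lee_fin.
- by apply: (mp (fun x => f x * g x)); exact: measurable_funM.
- by move=> x _; rewrite -EFinM lee_fin mulr_ge0.
- by apply: measurable_funeM; exact: mp.
apply: filterS hg => x hx Ux; rewrite -EFinM lee_fin exprMn mulrC.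
apply: ler_wpM2r => //; rewrite !exprM; apply: lerXn2r; rewrite ?nnegrE ?sqr_ge0 //.
by rewrite -(real_normK (num_real (g x))) ler_pXn2r ?nnegrE //; exact: hx.
Qed.

Lemma cube_add3 (a b c : R) : 0 <= a -> 0 <= b -> 0 <= c ->
  (a + b + c) ^+ 3 <= 16 * (a ^+ 3 + b ^+ 3 + c ^+ 3).
Proof.
have two (p q : R) : 0 <= p -> 0 <= q -> (p + q) ^+ 3 <= 4 * (p ^+ 3 + q ^+ 3).
  move=> p0 q0; rewrite -subr_ge0.
  rewrite (_ : _ - _ = 3 * ((p + q) * (p - q) ^+ 2)); last by ring.
  by apply: mulr_ge0 => //; apply: mulr_ge0; [exact: addr_ge0|exact: sqr_ge0].
move=> a0 b0 c0; have h1 := two _ _ (addr_ge0 a0 b0) c0; have h2 := two _ _ a0 b0.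
have := exprn_ge0 3 c0 => h3; lra.
Qed.

Variables (U T : set (R3 R)) (V : R -> 'I_3 -> R3 R -> 'cV[R]_3).
Variables (B : R -> (R3 R -> R) -> R3 R -> 'cV[R]_3) (eps : R) (s : seq 'cV[int]_3).
Variables (v : R3 R -> 'cV[R]_3) (M C C0 CS m : R).
Hypotheses (oU : open U) (sT : closure T `<=` eball 0 (1/8)) (e0 : 0 < eps) (e4 : eps <= 1/4).
Hypotheses (us : uniq s) (cs : cells U eps = [set` s]) (muU : mu U = m%:E) (m0 : 0 <= m).
Hypotheses (C00 : 0 <= C0) (M0 : 0 <= M) (CS0 : 0 <= CS).
Hypothesis ws : forall i, weakly_solenoidal (corr T ((4 * eps ^+ 2)^-1) i (V ((4 * eps ^+ 2)^-1) i)).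
Hypothesis h6 : forall i a,
  (\int[mu]_x (corr T ((4 * eps ^+ 2)^-1) i (V ((4 * eps ^+ 2)^-1) i) a x ^+ 6)%:E <= C0%:E)%E.
Hypothesis sob : forall U u g K, measurable U ->
  H10s U u g -> 0 < K -> (forall j, (sqint U (g j) <= K%:E)%E) ->
  (\int[mu]_(x in U) (u x ^+ 6)%:E <= (CS * K ^+ 3)%:E)%E.
Hypothesis hv : inX U v.
Hypothesis hu : forall i, H10s U (fun x => v x i 0) (fun j x => wgrad U v x i j).
Hypothesis hvM : forall i, {ae mu, forall x, U x -> `|v x i 0| <= M}.
Hypothesis hgM : forall i j, {ae mu, forall x, U x -> `|wgrad U v x i j| <= M}.
Local Notation O := (perforated U T eps).
Hypothesis hB : div_right_inverse O C (B eps).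
Local Notation z := (zeta T V eps s).

Let h (y : R3 R) : R := ddot ((Wmx U T V eps y)^T - 1%:M) (wgrad U v y).
(** It agrees with h on the perforated set, but on the holes, where [zeta] is minus the identity, it
    equals - div v, hence 0 almost everywhere. Integrals over the perforated set can thus be taken
    over U. *)
Let h1 (x : R3 R) : R := \sum_i \sum_a z i a x * wgrad U v x i a.
(** The factor 100 is 10 * 10, for the two sums over indices. Adding 1 replaces a square root, since
    kappa - 1 <= kappa^2. *)
Let kappa : R := 1 + 100 * (M ^+ 2 * ((1 + C0) * m)).
Let kappa_ge0 : 0 <= kappa.
Proof.
rewrite /kappa; apply: addr_ge0 => //; apply: mulr_ge0 => //; apply: mulr_ge0; first exact: sqr_ge0.
by apply: mulr_ge0 => //; exact: addr_ge0.
Qed.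
Let mU : measurable U. Proof. exact: open_measurable3. Qed.
Let mO : measurable O.
Proof. by apply: open_measurable3; exact: open_perforated cs. Qed.
Let OU : O `<=` U. Proof. by move=> x []. Qed.
Let mz i a : measurable_fun setT (z i a).
Proof. exact: ((zeta_solenoidal _ e0 ws i).1 a).1. Qed.
Let mzU i a : measurable_fun U (z i a).
Proof. exact: measurable_funTS (mz i a). Qed.
Let mv i : measurable_fun U (fun x => v x i 0). Proof. by have [] := hu i. Qed.
Let mg i j : measurable_fun U (fun x => wgrad U v x i j).
Proof. by have [_ + _] := hu i; exact. Qed.

Lemma restriction_rhsE x : O x -> h x = h1 x.
Proof.
move=> [Ux nx]; apply: eq_bigr => i _; apply: eq_bigr => a _.
rewrite !mxE; congr (_ * _).
by rewrite -(WcolE V sT e0 e4 us cs i a nx) (eq_sym a i).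
Qed.

Let mh1 : measurable_fun U h1.
Proof.
by apply: measurable_sum => i; apply: measurable_sum => a; exact: measurable_funM.
Qed.

Let sqint_h1 : (sqint U h1 <= ((kappa * eps) ^+ 2)%:E)%E.
Proof.
pose k := M ^+ 2 * (eps ^+ 2 * (1 + C0) * m).
have ent i a : (sqint U (fun x => (z i a x * wgrad U v x i a)%R) <= k%:E)%E.
  apply: le_trans (integral_mul_bounded 1 mU (mzU i a) (mg i a) M0 (hgM i a)) _.
  rewrite /k (EFinM (M ^+ 2)); apply: lee_wpmul2l; first by rewrite lee_fin exprn_ge0.
  have := integral_zeta2 oU sT e0 e4 us cs C00 ws h6 i a.
  by rewrite muU -EFinM.
have := @sqint_sum3 U (fun i x => \sum_a z i a x * wgrad U v x i a) (10 * k) mU.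
move=> /(_ _ _)/wrap[].
- by move=> i; apply: measurable_sum => a; exact: measurable_funM.
- move=> i; apply: (sqint_sum3 mU) => a; last exact: ent.
  exact: measurable_funM.
move=> hh; apply: le_trans hh _; rewrite lee_fin exprMn.
have kE : 10 * (10 * k) = (kappa - 1) * eps ^+ 2 by rewrite /k /kappa; ring.
rewrite kE; apply: ler_wpM2r; first exact: sqr_ge0.
have : 0 <= kappa - 1.
  rewrite /kappa addrAC subrr add0r; apply: mulr_ge0 => //; apply: mulr_ge0; first exact: sqr_ge0.
  by apply: mulr_ge0 => //; exact: addr_ge0.
by move=> ?; nra.
Qed.

(** For each i, the weak solenoidality of column i of [zeta] is tested with v_i, which is admissible
    because v_i is an H^1 limit of test functions in U. *)
Let int_h1 : \int[mu]_(x in U) h1 x = 0.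
Proof.
have lz i a : L2 U (z i a).
  by apply: (L2_subset measurableT mU _ ((zeta_solenoidal _ e0 ws i).1 a)).
have lg i a := (H10s_L2 mU (hu i)).2 a.
have i1 i := L2_sum_integrable mU (lz i) (lg i).
rewrite /h1 Rintegral_sum3 // big1 // => i _.
have e (f g : R3 R -> R) : f = g -> \int[mu]_(x in U) f x = 0 -> \int[mu]_(x in U) g x = 0.
  by move=> ->.
have := H10s_lim mU (hu i) (L2_0 U) (lz i) => /(_ _)/wrap[].
  move=> phi tphi.
  have := (zeta_solenoidal s e0 ws i).2 _ (test_funS (@subsetT _ U) tphi).
  rewrite /Rintegral (@integral_sub_support _ setT U) //.
    by move=> h0; rewrite -[RHS]h0; congr fine; apply: eq_integral => x _; rewrite mul0r add0r.
  move=> x _ nUx; have [_ hd] := test_fun_out tphi nUx.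
  by rewrite big1 // => a _; rewrite /pd hd mulr0.
by apply: e; apply/funext => x; rewrite mul0r add0r.
Qed.

Let h_L20 : inLp 2%:E O (scal h) /\ \int[mu]_(x in O) h x = 0.
Proof.
have mh : measurable_fun O h.
  apply: (eq_measurable_fun h1); first by move=> x /set_mem Ox; rewrite restriction_rhsE.
  exact: measurable_funS OU mh1.
split.
  split.
    move=> i j; rewrite (_ : (fun x => _) = h) //.
    by apply/funext => x; rewrite !ord1 mxE eqxx mulr1n.
  apply: (@le_lt_trans _ _ (kappa * eps)%:E); last by rewrite ltry.
  have k0 : 0 <= kappa * eps by apply: mulr_ge0; [exact: kappa_ge0|exact: ltW].
  apply/(LN_nat_le 1 _ _ k0).
  apply: le_trans sqint_h1; apply: (@le_trans _ _ (sqint O h1)).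
    apply: ge0_le_integral_nomeas => x Ox; first by rewrite lee_fin sqr_ge0.
    by rewrite lee_fin frob_sqr !big_ord1 mxE eqxx mulr1n restriction_rhsE.
  apply: (@ge0_subset_integral _ _ _ mu O U mO mU) => //.
    by apply/measurable_EFinP; exact: measurable_funX.
  by move=> x _; rewrite lee_fin sqr_ge0.
(* Passing from the perforated set to U changes nothing, because div v = 0 almost everywhere makes
   h1 vanish on the holes. *)
transitivity (\int[mu]_(x in U) zext O h1 x).
  rewrite /Rintegral (@integral_sub_support _ U O) //.
    congr fine; apply: eq_integral => x /set_mem Ox.
    by rewrite /zext mem_set // restriction_rhsE.
  by move=> x _ nOx; rewrite /zext memNset.
rewrite -[RHS]int_h1; apply: ae_eq_Rintegral => //.
  by apply: measurable_funTS; apply: measurable_zext => //; exact: measurable_funS OU mh1.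
have [_ [_ hdiv]] := hv.
apply: filterS hdiv => x hx Ux; rewrite /zext; case: ifPn => // /negP nO.
have hx1 : holes U T eps x by apply: contrapT => nh; apply: nO; apply: mem_set.
have hd : \sum_i wgrad U v x i i = 0 := hx Ux.
apply/esym; transitivity (- \sum_i wgrad U v x i i); last by rewrite hd oppr0.
rewrite /h1 -sumrN; apply: eq_bigr => i _.
rewrite (bigD1 i) //= big1 => [|a ai]; rewrite (zeta_hole V sT e0 e4 us cs _ _ hx1).
  by rewrite eqxx addr0 mulN1r.
by rewrite (negbTE ai) oppr0 mul0r.
Qed.

Let h_LN : (LN 2%:E O (scal h) <= (kappa * eps)%:E)%E.
Proof.
have k0 : 0 <= kappa * eps by apply: mulr_ge0; [exact: kappa_ge0|exact: ltW].
apply/(LN_nat_le 1 _ _ k0).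
apply: le_trans sqint_h1; apply: (@le_trans _ _ (sqint O h1)).
  apply: ge0_le_integral_nomeas => x Ox; first by rewrite lee_fin exprn_ge0 // frob_ge0.
  by rewrite lee_fin frob_sqr !big_ord1 mxE eqxx mulr1n restriction_rhsE.
apply: (@ge0_subset_integral _ _ _ mu O U mO mU) => //.
  by apply/measurable_EFinP; exact: measurable_funX.
by move=> x _; rewrite lee_fin sqr_ge0.
Qed.

Let Bh := B eps h.
Let S : R := CS * (`|C| * kappa + 1) ^+ 6.

Let Bh_H10s a : H10s O (fun x => Bh x a 0) (fun j x => wgrad O Bh x a j).
Proof.
by have [hB1 _ _ _] := hB; apply: inH10_H10s; [exact: open_perforated cs|exact: hB1 h_L20].
Qed.

(** The Sobolev inequality is applied on the perforated set itself, since its constant is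
    independent of the domain; only the gradient part of the H^1 bound on B[h] enters. *)
Let Bh_pow6 a : (\int[mu]_(x in O) (Bh x a 0 ^+ 6)%:E <= (S * eps ^+ 6)%:E)%E.
Proof.
have [_ _ _ hB4] := hB.
have k0 : 0 <= kappa by exact: kappa_ge0.
(* C may have any sign, hence |C|; the extra eps makes t positive, as the Sobolev bound with K = t^2
   requires. *)
pose t := (`|C| * kappa + 1) * eps.
have t0 : 0 < t by apply: mulr_gt0 => //; rewrite ltr_wpDl // mulr_ge0.
have hLN : (LN 2%:E O (wgrad O Bh) <= t%:E)%E.
  apply: (@le_trans _ _ (H1norm O Bh)); first by rewrite /H1norm leeDr // Lnorm_ge0.
  apply: le_trans (hB4 _ h_L20) _; apply: (@le_trans _ _ (`|C|%:E * (kappa * eps)%:E)%E).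
    apply: (@le_trans _ _ (`|C|%:E * LN 2%:E O (scal h))%E).
      by apply: lee_wpmul2r; [exact: Lnorm_ge0|rewrite lee_fin ler_norm].
    by apply: lee_wpmul2l; [rewrite lee_fin|exact: h_LN].
  rewrite -EFinM lee_fin -subr_ge0 (_ : t - _ = eps); first exact: ltW.
  by rewrite /t; ring.
have hs := (LN_nat_le 1 _ _ (ltW t0)).1 hLN.
have := sob mO (Bh_H10s a) (exprn_gt0 2 t0) => /(_ _)/wrap[].
  by move=> j; apply: le_trans hs; exact: (sqint_entry O (wgrad O Bh) a j).
move=> h0; apply: le_trans h0 _; rewrite lee_fin /S /t.
by rewrite -exprM exprMn mulrA.
Qed.

Let A6 : R := M ^+ 6 * (C0 * m).
Let Z : R := 32 * (2080 * A6 + S).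
Let err a (x : R3 R) : R := (\sum_i z i a x * v x i 0) + zext O (fun y => - Bh y a 0) x.

Lemma restriction_errE a x : U x ->
  zero_ext O (restriction U T V B eps v) x a 0 - v x a 0 = err a x.
Proof.
move=> Ux; have dl : v x a 0 = \sum_i (a == i)%:R * v x i 0.
  by rewrite sum3; move: a; apply: ord3P; rewrite /= ?mul1r ?mul0r ?addr0 ?add0r.
rewrite /zero_ext /err /zext; case: ifPn => [/set_mem [_ nh]|/negP nO].
  rewrite /restriction !mxE dl addrAC -sumrB; congr (_ + _); apply: eq_bigr => i _.
  by rewrite ?mxE -mulrBl (WcolE V sT e0 e4 us cs).
have hx1 : holes U T eps x by apply: contrapT => nh; apply: nO; apply: mem_set.
rewrite mxE sub0r addr0 dl -sumrN; apply: eq_bigr => i _.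
by rewrite (zeta_hole V sT e0 e4 us cs _ _ hx1) mulNr.
Qed.

Let mBh a : measurable_fun setT (zext O (fun y => - Bh y a 0)).
Proof.
apply: measurable_zext => //; apply: measurable_funN.
by have [] := Bh_H10s a.
Qed.

Let merr a : measurable_fun U (err a).
Proof.
apply: measurable_funD; last exact: measurable_funTS.
by apply: measurable_sum => i; exact: measurable_funM.
Qed.

Lemma restriction_measurable a :
  measurable_fun U (fun x => zero_ext O (restriction U T V B eps v) x a 0).
Proof.
apply: (eq_measurable_fun (fun x => err a x + v x a 0)).
  by move=> x /set_mem Ux; rewrite -restriction_errE // subrK.
exact: measurable_funD.
Qed.

Let err_pow6 a : (\int[mu]_(x in U) (err a x ^+ 6)%:E <= (Z * eps ^+ 6)%:E)%E.
Proof.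
have mzv i : measurable_fun U (fun x => z i a x * v x i 0) by exact: measurable_funM.
have mB : measurable_fun U (zext O (fun y => - Bh y a 0)) by exact: measurable_funTS.
apply: le_trans (integral_pow6_add mU _ mB) _; first by apply: measurable_sum => i.
have t1 : (\int[mu]_(x in U) ((\sum_i z i a x * v x i 0) ^+ 6)%:E <= (2080 * (A6 * eps ^+ 6))%:E)%E.
  apply: (pow6_sum3 mU mzv) => i.
  apply: le_trans (integral_mul_bounded 3 mU (mzU i a) (mv i) M0 (hvM i)) _.
  rewrite (_ : A6 * eps ^+ 6 = M ^+ 6 * (eps ^+ 6 * C0 * m)); last by rewrite /A6; ring.
  rewrite (EFinM (M ^+ 6)); apply: lee_wpmul2l; first by rewrite lee_fin exprn_ge0.
  have := integral_zeta6 oU sT e0 e4 us cs C00 ws h6 i a; rewrite muU -EFinM => hz.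
  apply: le_trans hz; apply: (@ge0_subset_integral _ _ _ mu U setT mU measurableT) => //.
    by apply/measurable_EFinP; apply: measurable_funX; exact: mz.
  by move=> x _; rewrite lee_fin sixth_ge0.
have t2 : (\int[mu]_(x in U) (zext O (fun y => (- Bh y a 0)%R) x ^+ 6)%:E <= (S * eps ^+ 6)%:E)%E.
  apply: (@le_trans _ _ (\int[mu]_x (zext O (fun y => (- Bh y a 0)%R) x ^+ 6)%:E)%E).
    apply: (@ge0_subset_integral _ _ _ mu U setT mU measurableT) => //.
      by apply/measurable_EFinP; apply: measurable_funX; exact: mBh.
    by move=> x _; rewrite lee_fin sixth_ge0.
  rewrite (integral_zext_pow 5); apply: le_trans (Bh_pow6 a).
  apply: ge0_le_integral_nomeas => x _; first by rewrite lee_fin sixth_ge0.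
  by rewrite lee_fin (_ : (- Bh x a 0) ^+ 6 = Bh x a 0 ^+ 6) //; ring.
apply: (@le_trans _ _ (32%:E * ((2080 * (A6 * eps ^+ 6))%:E + (S * eps ^+ 6)%:E))%E).
  by apply: lee_wpmul2l => //; exact: leeD.
by rewrite -EFinD -EFinM lee_fin /Z; rewrite le_eqVlt; apply/orP; left; apply/eqP; ring.
Qed.

Lemma restriction_error :
  (LN 6%:E U (fun x => (zero_ext O (restriction U T V B eps v) x - v x)%R) <=
   ((1 + 48 * (32 * (2080 * (M ^+ 6 * (C0 * m)) +
      CS * (`|C| * (1 + 100 * (M ^+ 2 * ((1 + C0) * m))) + 1) ^+ 6))) * eps)%:E)%E.
Proof.
rewrite -/A6 -/kappa -/S -/Z.
have S0 : 0 <= S.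
  apply: mulr_ge0; first exact: CS0.
  apply: exprn_ge0; apply: addr_ge0; last exact: ler01.
  by apply: mulr_ge0; [exact: normr_ge0|exact: kappa_ge0].
have A60 : 0 <= A6 by apply: mulr_ge0; [exact: exprn_ge0|exact: mulr_ge0].
have Z0 : 0 <= Z by rewrite /Z; move: A60 S0; generalize A6 S => p q p0 q0; lra.
have z48 : 0 <= 48 * Z by move: Z0; generalize Z => q q0; lra.
have c0 : 0 <= (1 + 48 * Z) * eps by apply: mulr_ge0; [exact: addr_ge0|exact: ltW].
apply/(LN_nat_le 5 _ _ c0).
have m6 a : measurable_fun U (fun x => (err a x ^+ 6)%:E).
  by apply/measurable_EFinP; exact: measurable_funX.
apply: (@le_trans _ _ (\int[mu]_(x in U) (16%:E * (\sum_a (err a x ^+ 6)%:E)))%E).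
  apply: ge0_le_integral_nomeas => x Ux; first by rewrite lee_fin sixth_ge0.
  rewrite sumEFin -EFinM lee_fin (_ : 6 = 2 * 3)%N // exprM frob_sqr !sum3 !big_ord1 !mxE.
  have e a : zero_ext O (restriction U T V B eps v) x a 0 - v x a 0 = err a x by exact: restriction_errE.
  rewrite !e !exprM; apply: cube_add3; exact: sqr_ge0.
have s0 x : (0 <= \sum_a (err a x ^+ 6)%:E)%E.
  by apply: sume_ge0 => a _; rewrite lee_fin sixth_ge0.
rewrite (@ge0_integralZl_EFin _ _ _ mu U mU); last 3 first.
- by move=> x _; exact: s0.
- by apply: emeasurable_sum => a; exact: m6.
- by [].
rewrite (@ge0_integral_sum _ _ _ mu U mU) //; last first.
  by move=> a x _; rewrite lee_fin sixth_ge0.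
(* The 48 is 16 * 3: the cube of a sum of three squares costs 16, and three components are added. *)
apply: (@le_trans _ _ (16%:E * (48 / 16 * (Z * eps ^+ 6))%:E)%E).
  apply: lee_wpmul2l => //.
  apply: (@le_trans _ _ (\sum_(a < 3) (Z * eps ^+ 6)%:E)%E).
    by apply: lee_sum => a _; exact: err_pow6.
  by rewrite sumEFin lee_fin sum3; rewrite le_eqVlt; apply/orP; left; apply/eqP; field.
rewrite -EFinM lee_fin exprMn.
have -> : 16 * (48 / 16 * (Z * eps ^+ 6)) = (48 * Z) * eps ^+ 6 by field.
apply: ler_wpM2r; first by rewrite exprn_ge0 // ltW.
(* A number that is at least 1 lies below its sixth power; this takes the place of a sixth root of
   48 Z. *)
have w1 : 1 <= 1 + 48 * Z by rewrite lerDl.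
apply: (@le_trans _ _ (1 + 48 * Z)); first by rewrite lerDr.
by rewrite -[leLHS]expr1 ler_weXn2l.
Qed.

End RestrictionError.

Section ReferenceHole.
Context {R : realType}.
Local Notation mu := (@mu3 R).

Lemma reference_hole_measure (beta : R) (T : set (R3 R)) : reference_hole beta T ->
  [/\ measurable T, closure T `<=` eball 0 (1/8) &
      exists2 tau, 0 < tau & mu T = tau%:E].
Proof.
move=> [[oT [x Tx] _] [_ sT] _ _ _]; have mT := open_measurable3 oT.
have h8 : 0 < 1/8 :> R by lra.
have fT : (mu T < +oo)%E.
  apply: le_lt_trans (mu3_cube_fin (1/8 : R)).
  apply: (@le_measure _ _ _ mu); rewrite ?inE //; first exact: measurable_cube.
  move=> y Ty; have /(eballP _ _ h8) := sT _ (@subset_closure _ T y Ty).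
  by rewrite subr0 => h; apply: sqn_cube; exact: ltW.
split=> //; exists (fine (mu T)); last by rewrite fineK // ge0_fin_numE.
by rewrite fine_gt0 // fT andbT; exact: open_mu_gt0 oT Tx.
Qed.

Lemma nonzero_pow6 (U : set (R3 R)) (v : R3 R -> 'cV[R]_3) : measurable U ->
  (forall i, measurable_fun U (fun x => v x i 0)) ->
  ~ {ae mu, forall x, U x -> v x = 0} ->
  (0 < \int[mu]_(x in U) (frob (v x) ^+ 6)%:E)%E.
Proof.
move=> mU mv nv; rewrite lt0e; apply/andP; split; last first.
  by apply: integral_ge0 => x _; rewrite lee_fin sixth_ge0.
apply/negP => /eqP I0; apply: nv.
have mp : measurable_fun U (fun x => (pow6 U v x)%:E).
  by apply/measurable_EFinP; apply: measurable_funTS; exact: measurable_pow6.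
have := (@ae_eq_integral_abs _ _ _ mu U mU _ mp).1 => /(_ _)/wrap[].
  rewrite -[RHS]I0; apply: eq_integral => x /set_mem Ux.
  by rewrite gee0_abs ?lee_fin ?pow6_ge0 // pow6E.
apply: filterS => x /= hx Ux; have := hx Ux; rewrite pow6E // => -[/eqP].
rewrite expf_eq0 /= => /eqP f0; apply/matrixP => i j; rewrite mxE.
by apply/eqP; rewrite -normr_le0 -f0 abs_entry_le_frob.
Qed.

(** Half the minimum of 1 and J works: L lies in (0, 1), so L^6 <= L < J. *)
Lemma small_power (tau : R) (I : \bar R) : 0 < tau -> (0 < I)%E ->
  exists2 L : R, 0 < L & ((L ^+ 6)%:E < tau%:E * I)%E.
Proof.
move=> tau0 I0; have [J J0 JI] : exists2 J : R, 0 < J & (J%:E <= tau%:E * I)%E.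
  move: I I0 => [x| |] // x0; last by exists 1 => //; rewrite gt0_muley ?lte_fin // leey.
  by exists (tau * x); rewrite ?EFinM // mulr_gt0.
pose L := Num.min 1 J / 2.
have m0 : 0 < Num.min 1 J by rewrite lt_min ltr01.
have L0 : 0 < L by rewrite divr_gt0.
have m1 : Num.min 1 J <= 1 by rewrite ge_min lexx.
have mJ : Num.min 1 J <= J by rewrite ge_min lexx orbT.
exists L => //; apply: lt_le_trans JI; rewrite lte_fin.
apply: (@le_lt_trans _ _ L); last by rewrite /L; lra.
rewrite exprS ler_piMr ?(ltW L0) // exprn_ile1 ?(ltW L0) //; rewrite /L; lra.
Qed.

End ReferenceHole.

Unset Implicit Arguments.

Theorem proposition3p4 (R : realType) (beta : R) (Omega T0 : set (R3 R))
    (hbeta0 : 0 < beta) (hbeta1 : beta < 1)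
    (hOmega : domain Omega) (hOmegab : bounded_set Omega)
    (hOmegaC : class_C2beta beta Omega)
    (hT0 : reference_hole beta T0) :
  (forall (v : R3 R -> 'cV[R]_3) (ve : R -> R3 R -> 'cV[R]_3),
     inX Omega v ->
     (\forall eps \near 0^'+,
        inLp 6%:E Omega (ve eps) /\
        {ae @mu3 R, forall x, holes Omega T0 eps x -> ve eps x = 0}) ->
     (poweR (mu3 T0) (6^-1)%R * LN 6%:E Omega v <=
      limf_einf (fun eps : R =>
        (eps^-1)%:E * LN 6%:E Omega (fun x => (ve eps x - v x)%R)) 0^'+)%E)
  /\
  (forall (V : R -> 'I_3 -> R3 R -> 'cV[R]_3) (Q : R -> 'I_3 -> R3 R -> R)
          (B : R -> (R3 R -> R) -> R3 R -> 'cV[R]_3),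
     (forall r i, 4 <= r -> stokes_cell T0 r i (V r i) (Q r i)) ->
     (exists C : R, \forall eps \near 0^'+,
        div_right_inverse (perforated Omega T0 eps) C (B eps)) ->
   forall v : R3 R -> 'cV[R]_3,
     inX Omega v ->
     ~ {ae @mu3 R, forall x, Omega x -> v x = 0} ->
   exists c C : R, [/\ 0 < c, 0 < C &
     \forall eps \near 0^'+,
       let err := LN 6%:E Omega (fun x =>
         (zero_ext (perforated Omega T0 eps)
                   (restriction Omega T0 V B eps v) x - v x)%R) in
       ((c * eps)%:E <= err)%E /\ (err <= (C * eps)%:E)%E]).
Proof.
have [oU _ _] := hOmega; have mU := open_measurable3 oU.
have [mT sT [tau tau0 muT]] := reference_hole_measure hT0.
have sT' : T0 `<=` eball 0 (1/8) by move=> x Tx; apply: sT; exact: subset_closure.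
split=> [v ve hv hve|V Q B hV [C hB] v hv nv].
  exact: (liminf_lower_bound oU hOmegab mT sT' muT tau0 hv hve).
have [M [M0 hu hvM hgM]] := inX_bounds oU hv.
have mv i : measurable_fun Omega (fun x => v x i 0) by have [] := hu i.
(* The lower constant: v is nonzero, so the integral of |v|^6 is positive and a positive [Lr] fits
   strictly below the bound. *)
have [Lr Lr0 hLr] := small_power tau0 (nonzero_pow6 mU mv nv).
have low := near_lower_bound oU hOmegab mT sT' muT tau0 hv (ltW Lr0) hLr.
have [C0 C00 hC0] := @corr_facts R.
have [CS CS0 sob] := @H10s_sobolev R.
have [m m0 muU] : exists2 m, 0 <= m & mu3 Omega = m%:E.
  exists (fine (mu3 Omega)); first by rewrite fine_ge0.
  by rewrite fineK // ge0_fin_numE //; exact: bounded_mu_fin.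
pose K := 1 + 48 * (32 * (2080 * (M ^+ 6 * (C0 * m)) +
      CS * (`|C| * (1 + 100 * (M ^+ 2 * ((1 + C0) * m))) + 1) ^+ 6)).
(* The constant K of the error estimate is enlarged to |K| + 1 so that its positivity is
   immediate. *)
exists Lr, (`|K| + 1); split; [exact: Lr0|by rewrite ltr_wpDl|].
near=> eps.
have e0 : 0 < eps by near: eps; exact: nbhs_right_gt.
(* This makes the radius [(4 * eps ^+ 2)^-1] of the cell problem at least 4, the range in which the
   solutions V are given. *)
have e4 : eps <= 1/4 by near: eps; apply: nbhs_right_le; lra.
have hBe : div_right_inverse (perforated Omega T0 eps) C (B eps) by near: eps.
have lowe : forall u : R3 R -> 'cV[R]_3,
    (forall i, measurable_fun Omega (fun x => u x i 0)) ->
    {ae @mu3 R, forall x, holes Omega T0 eps x -> u x = 0} ->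
    ((Lr * eps)%:E <= LN 6%:E Omega (fun x => (u x - v x)%R))%E by near: eps.
have [s us cs] := cells_seq hOmegab e0.
have r4 := radius_ge4 e0 e4.
have ws i : weakly_solenoidal (corr T0 ((4 * eps ^+ 2)^-1) i (V ((4 * eps ^+ 2)^-1) i)).
  by have [l2 _ wd] := hC0 _ _ _ _ _ sT r4 (hV _ i r4); split.
have h6 i : forall a,
    (\int[@mu3 R]_x (corr T0 ((4 * eps ^+ 2)^-1) i (V ((4 * eps ^+ 2)^-1) i) a x ^+ 6)%:E <= C0%:E)%E.
  by have [_ h6 _] := hC0 _ _ _ _ _ sT r4 (hV _ i r4).
split.
  apply: lowe => [a|].
    exact: (restriction_measurable oU sT e0 e4 us cs muU m0 C00 M0 ws h6 hv hu hgM hBe a).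
  apply: aeW => x hx; rewrite /zero_ext memNset // => -[_]; exact.
apply: le_trans (restriction_error oU sT e0 e4 us cs muU m0 C00 M0 (ltW CS0) ws h6 sob hv hu hvM hgM hBe) _.
rewrite lee_fin -/K; apply: ler_wpM2r; first exact: ltW.
by apply: le_trans (ler_norm K) _; rewrite lerDl.
Unshelve. all: by end_near. Qed.
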